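(* Let $K\in\mathbb{N}$ and let $x_1>\dots>x_K$ be any finite sequence of distinct real numbers. Then there exists $\delta>0$ such that for all small enough $\varepsilon>0$ there exists a bounded Toeplitz operator $T_a:A^2(\mathbb{D})\to A^2(\mathbb{D})$ with a real valued symbol $a\in L^\infty(\mathbb{D})$ and the properties $$\sigma_{\rm ess}(T_a)\cap B(x_n,\varepsilon)\neq\emptyset\quad\text{for all } n\le K$$ and $$\mathrm{dist}\big(\sigma_{\rm ess}(T_a)\cap U_\varepsilon,\ \sigma_{\rm ess}(T_a)\setminus U_\varepsilon\big)\ge\delta,\qquad\text{where } U_\varepsilon=\bigcup_{n\le K}B(x_n,\varepsilon).$$
   Context: $\mathbb{D}$ is the open unit disc of $\mathbb{C}$; $A^2(\mathbb{D})$ is the Bergman space, i.e. the closed subspace of analytic functions in $L^2(\mathbb{D})$ (with respect to area measure), and $P_{\mathbb{D}}$ is the orthogonal projection of $L^2(\mathbb{D})$ onto $A^2(\mathbb{D})$. For $a\in L^\infty(\mathbb{D})$, the Toeplitz operator with symbol $a$ is $T_af=P_{\mathbb{D}}(af)$, $f\in A^2(\mathbb{D})$. $B(x,r)$ is the Euclidean ball (disc) in $\mathbb{C}$ with center $x$ and radius $r>0$. $\sigma_{\rm ess}(T)$ denotes the essential spectrum of a bounded operator $T$ (the set of $\lambda\in\mathbb{C}$ such that $T-\lambda I$ is not Fredholm). $\mathrm{dist}(A,B)=\inf\{|s-t|: s\in A,\ t\in B\}$. *)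

(* Defs.v *)
From HB Require Import structures.
From mathcomp Require Import all_boot all_order all_algebra.
From mathcomp Require Import complex.
From mathcomp Require Import all_classical all_reals all_analysis.
From mathcomp Require Import measurable_realfun.

Set Implicit Arguments.
Unset Strict Implicit.
Unset Printing Implicit Defensive.

Import Order.TTheory GRing.Theory Num.Theory.
Import numFieldNormedType.Exports.

Local Open Scope classical_set_scope.
Local Open Scope ring_scope.
Local Open Scope complex_scope.

(* The regular module R[i]^o is R[i] itself; it is the form under which the    *)
(* library puts a normed C-vector space structure on C, so that derivability   *)
(* at a point means complex derivability.                                      *)
Notation Cplx R := (R[i]^o).

Section BergmanFunctions.
Context {R : realType}.
Local Notation C := (Cplx R).
Local Notation plane := (measurableTypeR R * measurableTypeR R)%type.

Definition unit_disc : set C := [set z | `|z| < 1].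

(* C carries no measurable structure in the library: integrals over C are      *)
(* taken over R * R, in the coordinates z = x + i y.                           *)
Definition to_cplx (p : plane) : C := p.1 +i* p.2.

Definition disc_coord : set plane := to_cplx @^-1` unit_disc.

Definition area : {measure set plane -> \bar R} :=
  (@lebesgue_measure R \x @lebesgue_measure R)%E.

Definition cmodulus (z : C) : R := complex.Re `|z|.

Definition measurable_disc (f : C -> C) : Prop :=
  measurable_fun disc_coord (fun p => complex.Re (f (to_cplx p))) /\
  measurable_fun disc_coord (fun p => complex.Im (f (to_cplx p))).

Definition integral_disc (f : C -> C) : C :=
  (\int[area]_(p in disc_coord) complex.Re (f (to_cplx p))) +i*
  (\int[area]_(p in disc_coord) complex.Im (f (to_cplx p))).

Definition sqnorm_disc (f : C -> C) : \bar R :=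
  (\int[area]_(p in disc_coord) (cmodulus (f (to_cplx p)) ^+ 2)%:E)%E.

Definition L2_disc (f : C -> C) : Prop :=
  measurable_disc f /\ (sqnorm_disc f < +oo)%E.

Definition Linfty_disc (f : C -> C) : Prop :=
  measurable_disc f /\
  exists M : R, {ae area, forall p, disc_coord p ->
                  cmodulus (f (to_cplx p)) <= M}.

Definition inner_disc (f g : C -> C) : C :=
  integral_disc (fun z => f z * (g z)^*).

Definition analytic_disc (f : C -> C) : Prop :=
  forall z, unit_disc z -> derivable f z 1.

(* An analytic function on the disc is represented by its extension by zero to *)
(* the whole of C, so that equality of representatives is equality on the disc.*)
Definition bergman_function : set (C -> C) :=
  [set f | [/\ analytic_disc f, L2_disc f
             & forall z, ~ unit_disc z -> f z = 0]].

Lemma cmodulusE (z : C) :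
  cmodulus z = Num.sqrt (complex.Re z ^+ 2 + complex.Im z ^+ 2).
Proof. by rewrite /cmodulus normc_def. Qed.

Lemma cnormE (z : C) : `|z| = (cmodulus z)%:C.
Proof. by rewrite /cmodulus normc_def. Qed.

Lemma cmodulus_ge0 (z : C) : 0 <= cmodulus z.
Proof. by rewrite cmodulusE sqrtr_ge0. Qed.

Lemma cmodulusD (z w : C) : cmodulus (z + w) <= cmodulus z + cmodulus w.
Proof. by rewrite -lecR rmorphD /= -!cnormE ler_normD. Qed.

Lemma cmodulusM (z w : C) : cmodulus (z * w) = cmodulus z * cmodulus w.
Proof. by apply: complexI; rewrite rmorphM /= -!cnormE normrM. Qed.

Lemma cmodulus0 : cmodulus 0 = 0.
Proof. by apply: complexI; rewrite -cnormE normr0. Qed.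

Lemma cmodulus_eq0 (z : C) : cmodulus z = 0 -> z = 0.
Proof. by move=> h; apply: normr0_eq0; rewrite cnormE h. Qed.

Lemma cmodulus_sqr (z : C) :
  cmodulus z ^+ 2 = complex.Re z ^+ 2 + complex.Im z ^+ 2.
Proof. by rewrite cmodulusE sqr_sqrtr// addr_ge0// sqr_ge0. Qed.

Lemma disc_coordE : disc_coord = [set p | p.1 ^+ 2 + p.2 ^+ 2 < 1].
Proof.
apply/seteqP; split=> p; rewrite /disc_coord /unit_disc /= cnormE ltcR.
  by move=> h; rewrite -(cmodulus_sqr (to_cplx p)) expr_lt1// cmodulus_ge0.
by move=> h; rewrite -(expr_lt1 (n := 2))// ?cmodulus_sqr// cmodulus_ge0.
Qed.

Lemma measurable_disc_coord : measurable disc_coord.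
Proof.
have m : measurable_fun [set: plane] (fun p => p.1 ^+ 2 + p.2 ^+ 2 : R).
  apply: measurable_funD; apply: measurable_funX.
    exact: measurable_fst.
  exact: measurable_snd.
have -> : disc_coord = [set: plane] `&`
    (fun p : plane => p.1 ^+ 2 + p.2 ^+ 2 : R) @^-1` [set` `]-oo, 1[].
  by rewrite setTI disc_coordE; apply/seteqP; split=> p /=; rewrite in_itv.
by apply: m => //; exact: measurable_itv.
Qed.

Lemma measurable_cmodulus (f : C -> C) : measurable_disc f ->
  measurable_fun disc_coord (fun p => cmodulus (f (to_cplx p))).
Proof.
move=> [mr mi].
pose g (p : plane) : R := complex.Re (f (to_cplx p)) ^+ 2 +
                          complex.Im (f (to_cplx p)) ^+ 2.
have -> : (fun p => cmodulus (f (to_cplx p))) = @Num.sqrt R \o g.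
  by apply/funext => p; rewrite cmodulusE.
apply: measurableT_comp; last first.
  by apply: measurable_funD; apply: measurable_funX.
by apply: continuous_measurable_fun => ?; exact: sqrt_continuous.
Qed.

Lemma sqnorm_disc_ge0 (f : C -> C) : (0 <= sqnorm_disc f)%E.
Proof. by apply: integral_ge0 => p _; rewrite lee_fin sqr_ge0. Qed.

Lemma sqrte_sqnorm_disc (f : C -> C) :
  sqrte (sqnorm_disc f) =
  ('N[area]_2%:E[EFin \o ((fun p => cmodulus (f (to_cplx p))) \_ disc_coord)])%E.
Proof.
rewrite -poweR12_sqrt ?sqnorm_disc_ge0// unlock /sqnorm_disc.
congr (_ `^ _)%E; rewrite [LHS]integral_mkcond; apply: eq_integral => p _ /=.
rewrite !patchE; case: ifPn => _.
  by rewrite powR_mulrn// ger0_norm// cmodulus_ge0.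
by rewrite normr0 powR0.
Qed.

Lemma measurable_discD (f g : C -> C) :
  measurable_disc f -> measurable_disc g -> measurable_disc (f + g).
Proof.
have mD := measurable_disc_coord.
move=> [mr mi] [mr' mi']; split.
  rewrite (_ : (fun _ => _) = fun p => complex.Re (f (to_cplx p)) +
      complex.Re (g (to_cplx p))); first exact: measurable_funD.
  by apply/funext => p; rewrite addrfctE; case: (f _); case: (g _).
rewrite (_ : (fun _ => _) = fun p => complex.Im (f (to_cplx p)) +
    complex.Im (g (to_cplx p))); first exact: measurable_funD.
by apply/funext => p; rewrite addrfctE; case: (f _); case: (g _).
Qed.

Lemma measurable_discZ (a : C) (f : C -> C) :
  measurable_disc f -> measurable_disc (a *: f).
Proof.
have mD := measurable_disc_coord.
case: a => a b [mr mi]; split.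
  rewrite (_ : (fun _ => _) = fun p => a * complex.Re (f (to_cplx p)) -
      b * complex.Im (f (to_cplx p))).
    by apply: measurable_funB; apply: measurable_funM.
  by apply/funext => p /=; rewrite scalrfctE; case: (f _).
rewrite (_ : (fun _ => _) = fun p => a * complex.Im (f (to_cplx p)) +
      b * complex.Re (f (to_cplx p))).
  by apply: measurable_funD; apply: measurable_funM.
by apply/funext => p /=; rewrite scalrfctE; case: (f _).
Qed.

Lemma measurable_sqr_cmodulus (f : C -> C) : measurable_disc f ->
  measurable_fun disc_coord (fun p => (cmodulus (f (to_cplx p)) ^+ 2)%:E).
Proof.
move=> mf; apply/measurable_EFinP; apply: measurable_funX.
exact: measurable_cmodulus.
Qed.

Lemma sqnorm_disc_triangle (f g : C -> C) :
  measurable_disc f -> measurable_disc g ->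
  (sqrte (sqnorm_disc (f + g)%R) <=
   sqrte (sqnorm_disc f) + sqrte (sqnorm_disc g))%E.
Proof.
move=> mf mg.
have mD := measurable_disc_coord.
have mN h : measurable_disc h -> measurable_fun [set: plane]
    ((fun p => cmodulus (h (to_cplx p))) \_ disc_coord).
  move=> mh; apply/(measurable_restrictT _ mD).
  exact: measurable_cmodulus.
rewrite (sqrte_sqnorm_disc f) (sqrte_sqnorm_disc g).
apply: (le_trans _ (minkowski_EFin _ (mN _ mf) (mN _ mg) _)); last first.
  by rewrite ler1n.
rewrite -poweR12_sqrt ?sqnorm_disc_ge0// unlock /sqnorm_disc.
apply: gt0_ler_poweR => //.
- by rewrite in_itv/= leey sqnorm_disc_ge0.
- rewrite in_itv/= leey andbT.
  by apply: integral_ge0 => p _; rewrite lee_fin powR_ge0.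
pose h p := ((cmodulus (f (to_cplx p)) + cmodulus (g (to_cplx p))) ^+ 2)%:E.
rewrite [leRHS](_ : _ = (\int[area]_(p in disc_coord) h p)%E).
  apply: ge0_le_integral => //.
  - by move=> p _; rewrite lee_fin sqr_ge0.
  - by apply: measurable_sqr_cmodulus; exact: measurable_discD.
  - apply/measurable_EFinP; apply: measurable_funX.
    by apply: measurable_funD; exact: measurable_cmodulus.
  - move=> p _; rewrite lee_fin ler_sqr ?nnegrE ?addr_ge0 ?cmodulus_ge0//.
    exact: cmodulusD.
rewrite [RHS]integral_mkcond; apply: eq_integral => p _ /=.
rewrite !patchE; case: ifPn => _.
  by rewrite powR_mulrn// ger0_norm// addr_ge0// cmodulus_ge0.
by rewrite addr0 normr0 powR0.
Qed.

Lemma sqnorm_discZ (a : C) (f : C -> C) : measurable_disc f ->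
  sqnorm_disc (a *: f) = ((cmodulus a ^+ 2)%:E * sqnorm_disc f)%E.
Proof.
move=> mf; rewrite /sqnorm_disc -ge0_integralZl_EFin//.
- by apply: eq_integral => p _; rewrite scalrfctE cmodulusM exprMn EFinM.
- exact: measurable_disc_coord.
- by move=> p _; rewrite lee_fin sqr_ge0.
- exact: measurable_sqr_cmodulus.
- exact: sqr_ge0.
Qed.

Lemma sqnorm_disc0 : sqnorm_disc 0 = 0%E.
Proof.
by rewrite /sqnorm_disc integral0_eq// => p _; rewrite cmodulus0 expr0n.
Qed.

Definition bergman_pred : {pred C -> C} := mem bergman_function.

Lemma bergman_submod_closed : submod_closed bergman_pred.
Proof.
split.
  have d0 : analytic_disc (0 : C -> C) by move=> z Dz; exact: derivable_cst.
  have m0 : measurable_disc (0 : C -> C) by split; exact: measurable_cst.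
  by rewrite inE; split=> //; split=> //; rewrite sqnorm_disc0.
move=> a f g; rewrite !inE => -[df [mf lf] f0] [dg [mg lg] g0]; split.
- by move=> z Dz; apply: derivableD; [exact/derivableZ/df|exact: dg].
- have maf := measurable_discZ a mf.
  split; first exact: measurable_discD.
  have := sqnorm_disc_triangle maf mg.
  rewrite sqnorm_discZ// => h.
  have fin (x : \bar R) : (0 <= x)%E -> (sqrte x < +oo)%E -> (x < +oo)%E.
    by case: x => //= r _ _; rewrite ltry.
  apply: fin; first exact: sqnorm_disc_ge0.
  apply: (le_lt_trans h); rewrite sqrteM ?lee_fin ?sqr_ge0//.
  have fin' (x : \bar R) : (0 <= x)%E -> (x < +oo)%E -> (sqrte x < +oo)%E.
    by case: x => //= r _ _; rewrite ltry.
  rewrite lte_add_pinfty ?fin' ?sqnorm_disc_ge0//.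
  have := fin' _ (sqnorm_disc_ge0 f) lf.
  have := sqrte_ge0 (sqnorm_disc f).
  by case: (sqrte (sqnorm_disc f)) => //= r _ _; rewrite ltry.
- by move=> z Dz; rewrite !fctE f0// g0// scaler0 addr0.
Qed.

HB.instance Definition _ :=
  GRing.isSubmodClosed.Build _ _ bergman_pred bergman_submod_closed.

Lemma norm_to_cplx_le (p q : plane) :
  cmodulus (to_cplx p - to_cplx q) <= `|p.1 - q.1| + `|p.2 - q.2|.
Proof.
rewrite cmodulusE /=.
set x := p.1 - q.1; set y := p.2 - q.2.
rewrite -ler_sqr ?nnegrE ?addr_ge0 ?sqrtr_ge0//.
rewrite sqr_sqrtr ?addr_ge0 ?sqr_ge0// -(real_normK (num_real x)).
rewrite -(real_normK (num_real y)) sqrrD.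
by rewrite lerD2r lerDl mulrn_wge0// mulr_ge0.
Qed.

Lemma bergman_function_eq0 (f : C -> C) :
  bergman_function f -> sqnorm_disc f = 0%E -> f = 0.
Proof.
move=> [df [mf _] f0] If0; apply/funext => z; apply/eqP/negP => /negP fz0.
have [Dz|/f0 fz] := pselect (unit_disc z); last by rewrite fz eqxx in fz0.
have cf : {for z, continuous f}.
  by apply: differentiable_continuous; apply/derivable1_diffP; exact: df.
have nbD : nbhs z unit_disc.
  apply/nbhs_ballP; exists (1 - `|z|); first by rewrite /= subr_gt0.
  move=> w; rewrite -ball_normE/= ltrBrDl => h.
  by apply: le_lt_trans h; rewrite -[in leLHS](subKr z w) ler_normB.
have nbf : nbhs z [set w | f w != 0].
  have : nbhs (f z) [set w | w != 0].
    apply/nbhs_ballP; exists `|f z|; first by rewrite /= normr_gt0.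
    by move=> w; rewrite -ball_normE/=; apply: contraTneq => ->; rewrite subr0 ltxx.
  exact: cf.
have /nbhs_ballP[e e0 he] : nbhs z (unit_disc `&` [set w | f w != 0]).
  exact: filterI.
have er : e = (complex.Re e)%:C.
  by move: e0; rewrite /= ltcE/= => /andP[/eqP ie _]; case: (e) ie => a b /= ->.
pose d := complex.Re e / 2.
have d0 : 0 < d by move: e0; rewrite /= er ltcR => ?; rewrite divr_gt0.
pose x := complex.Re z; pose y := complex.Im z.
have zE : z = to_cplx (x, y) by rewrite /x /y; case: (z).
pose B : set plane := `]x - d, x + d[ `*` `]y - d, y + d[.
have /negligibleP B0 : area.-negligible B.
  have /ae_eq_integral_abs : (\int[area]_(p in disc_coord)
      `|(cmodulus (f (to_cplx p)) ^+ 2)%:E| = 0)%E.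
    rewrite -[RHS]If0; apply: eq_integral => p _.
    by rewrite gee0_abs// lee_fin sqr_ge0.
  move=> /(_ measurable_disc_coord (measurable_sqr_cmodulus mf)).
  apply: negligibleS => p [/= px py] /=.
  have /he[Dp fp] : ball z e (to_cplx p).
    rewrite -ball_normE/= er zE cnormE ltcR.
    apply: (le_lt_trans (norm_to_cplx_le _ _)) => /=.
    rewrite (splitr (complex.Re e)) ltrD//= distrC ltr_distl.
      by move: px; rewrite in_itv.
    by move: py; rewrite in_itv.
  move=> /(_ Dp) [] /eqP; rewrite sqrf_eq0 => /eqP/cmodulus_eq0 fp0.
  by move/eqP: fp; apply.
have : area B = 0%E by apply: B0; apply: measurableX; exact: measurable_itv.
have itvE (t : R) : lebesgue_measure (`]t - d, t + d[%classic : set R) =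
    (d + d)%:E.
  rewrite lebesgue_measure_itv/= lte_fin ltrD2l gtrN// -EFinB.
  by rewrite opprB addrC subrKA.
have -> : area B = ((d + d)%:E * (d + d)%:E)%E.
  rewrite -[X in (X * _)%E](itvE x) -[X in (_ * X)%E](itvE y).
  by apply: product_measure1E; exact: measurable_itv.
rewrite -EFinM => /eqP; rewrite eqe.
by rewrite mulf_eq0 orbb gt_eqF// addr_gt0.
Qed.

End BergmanFunctions.

Record bergman (R : realType) := Bergman {
  bergman_val :> Cplx R -> Cplx R;
  bergmanP : bergman_val \in bergman_pred }.

Section BergmanSpace.
Context {R : realType}.
Local Notation C := (Cplx R).

HB.instance Definition _ := [isSub for @bergman_val R].
HB.instance Definition _ := [Choice of bergman R by <:].
HB.instance Definition _ := [SubChoice_isSubLmodule of bergman R by <:].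

Implicit Types f g : bergman R.

Lemma bergman_functionP f : bergman_function f.
Proof. by have := bergmanP f; rewrite inE. Qed.

Definition bergman_norm f : R[i] := (Num.sqrt (fine (sqnorm_disc f)))%:C.

Let sqnormE f : sqnorm_disc f = (fine (sqnorm_disc f))%:E.
Proof.
have [_ [_ lf] _] := bergman_functionP f.
by rewrite fineK// ge0_fin_numE// sqnorm_disc_ge0.
Qed.

Let bergman_normD f g :
  bergman_norm (f + g) <= bergman_norm f + bergman_norm g.
Proof.
have [_ [mf _] _] := bergman_functionP f.
have [_ [mg _] _] := bergman_functionP g.
rewrite -rmorphD lecR -lee_fin.
have := sqnorm_disc_triangle mf mg.
have -> : (f : C -> C) + (g : C -> C) = (f + g : bergman R) by [].
by rewrite (sqnormE f) (sqnormE g) (sqnormE (f + g)).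
Qed.

Let bergman_normZ (a : C) f : bergman_norm (a *: f) = `|a| * bergman_norm f.
Proof.
have [_ [mf _] _] := bergman_functionP f.
rewrite cnormE -rmorphM; congr (_%:C).
rewrite [bergman_val _](_ : _ = a *: (f : C -> C))// sqnorm_discZ// sqnormE -EFinM.
by rewrite sqrtrM ?sqr_ge0// sqrtr_sqr ger0_norm// cmodulus_ge0.
Qed.

Let bergman_norm0_eq0 f : bergman_norm f = 0 -> f = 0.
Proof.
move=> /complexI/eqP; rewrite sqrtr_eq0 => h; apply/val_inj => /=.
apply: bergman_function_eq0; first exact: bergman_functionP.
apply/eqP; rewrite eq_le sqnorm_disc_ge0 andbT sqnormE lee_fin//.
Qed.

HB.instance Definition _ := Lmodule_isNormed.Build R[i] (bergman R)
  bergman_normD bergman_normZ bergman_norm0_eq0.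

(* For g in L^2 the orthogonal projection onto the Bergman space is the unique *)
(* h in it such that g - h is orthogonal to it (xget returns the default 0 if  *)
(* there is no such h).                                                        *)
Definition bergman_proj (g : C -> C) : bergman R :=
  xget 0 [set h : bergman R |
    forall k : bergman R, inner_disc (g - (h : C -> C)) k = 0].

Definition toeplitz (a : C -> C) (f : bergman R) : bergman R :=
  bergman_proj (fun z => a z * f z).

(* Extended-real valued: the distance to the empty set is +oo. *)
Definition set_dist (A B : set C) : \bar R :=
  ereal_inf [set (cmodulus (s - t))%:E | s in A & t in B].

End BergmanSpace.

Section Fredholm.
Context {K : numFieldType} {V : normedModType K}.

Definition bounded_operator (T : V -> V) : Prop :=
  linear T /\ exists M : K, forall v, `|T v| <= M * `|v|.

Definition finite_dim_kernel (T : V -> V) : Prop :=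
  exists (n : nat) (b : 'I_n -> V), forall v, T v = 0 ->
    exists c : 'I_n -> K, v = \sum_(i < n) c i *: b i.

Definition finite_dim_cokernel (T : V -> V) : Prop :=
  exists (n : nat) (b : 'I_n -> V), forall v,
    exists (u : V) (c : 'I_n -> K), v = T u + \sum_(i < n) c i *: b i.

Definition fredholm (T : V -> V) : Prop :=
  [/\ bounded_operator T, finite_dim_kernel T, closed (range T)
    & finite_dim_cokernel T].

Definition essential_spectrum (T : V -> V) : set K :=
  [set l | ~ fredholm (fun v => T v - l *: v)].

End Fredholm.

(* Main.v *)
Require Import Defs.
From HB Require Import structures.
From mathcomp Require Import all_boot all_order all_algebra.
From mathcomp Require Import complex ring lra.
From mathcomp Require Import all_classical all_reals all_analysis.
From mathcomp Require Import measurable_realfun.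
Set Implicit Arguments.
Unset Strict Implicit.
Unset Printing Implicit Defensive.
Import Order.TTheory GRing.Theory Num.Theory.
Import numFieldNormedType.Exports.
Local Open Scope classical_set_scope.
Local Open Scope ring_scope.
Local Open Scope complex_scope.

(* In the disc, place small squares B_m centred at 1 - 4^-(m+1), with side a       *)
(* multiple eta of the distance to the circle, inside disjoint larger squares.     *)
(* Let 1 / h_m be the maximum of the integral of |f|^2 over B_m for |f| <= 1. As   *)
(* a Bergman function varies little on B_m, the Toeplitz operator of h_m 1_{B_m}   *)
(* is O(eta)-close to the projection onto the evaluation kernel at the centre of   *)
(* B_m. Kernels and maximisers tend weakly to 0, so along a sparse subsequence the *)
(* squares decouple: the operators T_al of symbol sum_j al_j h_j 1_{B_j} satisfy   *)
(* |T_al T_be - T_{al be}|^2 = O(eta) for bounded al, be.                          *)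
(*   Let c_j run cyclically over the x_n - x_1 and a = x_1 + sum_j c_j h_j 1_{B_j}.*)
(* If l is at distance >= eps from every x_n and mu = l - x_1, then T_be - 1/mu    *)
(* with be_j = c_j / (mu (c_j - mu)) inverts T_a - l up to an error of norm <= 1/2 *)
(* on both sides, so T_a - l is invertible by Neumann series. Hence the essential  *)
(* spectrum lies in U_eps, and the second distance is that to the empty set.       *)
(* Conversely the maximisers on the squares with c_j = x_n - x_1 tend weakly to 0  *)
(* and are asymptotic eigenvectors of T_a for x_n; a gliding hump then shows that  *)
(* the range of T_a - x_n has infinite codimension.                                *)
(*   The pointwise bounds on Bergman functions are obtained from Green's formula   *)
(* on squares for f(z) conj(z) v(|z|^2), proved by bisection as in Goursat.        *)

(** * Green's formula on squares *)

(** The construction imitates a diagonal operator. If e_j were orthonormal in the Bergman space and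
    c_j took each value x_n - x_1 infinitely often, the operator x_1 + sum_j c_j <., e_j> e_j would
    have spectrum {x_1, ..., x_K}. The Toeplitz operator of x_1 + sum_j c_j h_j 1_{B_j} reproduces
    this up to an error that tends to 0 with the relative size eta of the squares B_j.

    A single square acts almost as a rank one projection. [bergman_value] and [bergman_lip] control
    a Bergman function on the inner square by its norm on the outer one, so the form h |f|^2 over
    the square is within O(eta) of w |f(centre)|^2 ([mass_center]), and the normalisation by h makes
    the corresponding kernel nearly a unit vector ([kernel_center]). The test function [peak] shows
    h = O(eta^-2) ([top_lower]), which keeps all other constants free of eta. Since the outer
    squares are disjoint, and the sites so sparse that kernels and maximisers hardly see each
    other's squares ([sparse_sites]), the errors add up to O(eta) |f|^2 however many sites there
    are. The outcome is [almost_multiplicative]: al -> [toeplitz (sym eta site al)] is nearly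
    multiplicative.

    Two consequences finish the proof. The scalar inverse of c_j - mu becomes a two-sided parametrix
    ([resolvent]), so nothing at distance at least eps from all x_n is in the essential spectrum.
    Each x_n itself is in it: for fixed eta the maximisers are approximate eigenvectors with errors
    tending to 0 ([quasimode]), and [infinite_cokernel] applies.

    The function theory starts from complex derivability alone. Goursat's bisection gives Green's
    formula ([circulation_eq0]), hence radial mean values ([radial_mean]), local bounds, and a
    uniform second-order remainder ([taylor2]); the latter yields completeness of the space
    ([bergman_complete]), then [Riesz] and the projection. *)

Lemma le_of_eq {R : realType} (a b : R) : a = b -> a <= b.
Proof. by move=> ->. Qed.

Lemma itv_dist {R : realType} (a l x z : R) : a <= x -> x <= a + l -> a <= z -> z <= a + l ->
  `|z - x| <= l.
Proof. by move=> ax xa az za; rewrite ler_norml; apply/andP; split; lra. Qed.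

Lemma norm_sum4_le {R : realType} (w1 w2 w3 w4 q : R) : `|w1| <= q -> `|w2| <= q -> `|w3| <= q ->
  `|w4| <= q -> `|w1 + w2 + w3 + w4| <= 4%:R * q.
Proof.
move=> h1 h2 h3 h4; have n1 := ler_normD (w1 + w2 + w3) w4.
have n2 := ler_normD (w1 + w2) w3; have n3 := ler_normD w1 w2; lra.
Qed.

Lemma circulation_estimate {R : realType} (I1 I2 I3 py qx e l : R) :
  `|I1 - (- py * l) * l| <= 4%:R * e * l * l -> `|I2 - (qx * l) * l| <= 4%:R * e * l * l ->
  `|I3 - (qx - py) * l ^+ 2| <= e * l ^+ 2 -> `|I1 + I2 - I3| <= 9%:R * e * l ^+ 2.
Proof.
rewrite !ler_norml => /andP[h1 h2] /andP[h3 h4] /andP[h5 h6]; apply/andP; split; lra.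
Qed.

Section GreenGoursat.
Context {R : realType}.
Local Notation mu := (@lebesgue_measure R).
Local Notation plane := (measurableTypeR R * measurableTypeR R)%type.

(* Real differentiability of P at (x, y), with gradient (px, py). *)
Definition expands (P : R -> R -> R) (x y px py : R) := forall e, 0 < e ->
  exists2 d, 0 < d & forall x' y', `|x' - x| <= d -> `|y' - y| <= d ->
    `|P x' y' - P x y - px * (x' - x) - py * (y' - y)|
      <= e * (`|x' - x| + `|y' - y|).

(** Half-open sides make the four quarters of a square an exact partition, with no edge counted
    twice. *)
Definition square (a c l : R) : set plane := `]a, a + l] `*` `]c, c + l].

Lemma measurable_square a c l : measurable (square a c l).
Proof. by apply: measurableX; exact: measurable_itv. Qed.

Lemma lebesgue_itv_length (a l : R) : 0 <= l -> mu `]a, a + l]%classic = l%:E.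
Proof.
rewrite lebesgue_measure_itv/= lte_fin => l0; case: ltP => [_|].
  by rewrite -EFinB addrC addKr.
by rewrite -[leRHS]addr0 lerD2l => l1; congr EFin; apply/eqP; rewrite eq_le l0.
Qed.

Lemma area_square (a c l : R) : 0 <= l -> area (square a c l) = (l ^+ 2)%:E.
Proof.
move=> l0; have := lebesgue_itv_length a l0; have := lebesgue_itv_length c l0.
move=> h1 h2; rewrite expr2 EFinM -[in X in (X * _)%E]h2 -[in X in (_ * X)%E]h1.
by apply: product_measure1E; exact: measurable_itv.
Qed.

Lemma integrable_EFinB d (T : measurableType d) (m : {measure set T -> \bar R})
  (D : set T) (f h : T -> R) : measurable D -> m.-integrable D (EFin \o f) ->
  m.-integrable D (EFin \o h) -> m.-integrable D (EFin \o (fun x => f x - h x)).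
Proof. by move=> mD fi hi; exact: (integrableB mD fi hi). Qed.

(** At [k = 0] it doubles as the bound of an integral by supremum times measure. *)
Lemma Rintegral_near_cst d (T : measurableType d) (m : {measure set T -> \bar R})
  (D : set T) (h : T -> R) (k e s : R) : measurable D -> m D = s%:E ->
  m.-integrable D (EFin \o h) -> (forall x, D x -> `|h x - k| <= e) ->
  `|\int[m]_(x in D) h x - k * s| <= e * s.
Proof.
move=> mD Ds ih hk.
have ic r : m.-integrable D (EFin \o (fun=> r)).
  apply/integrableP; split; first exact: measurable_cst.
  by rewrite (integral_cst m mD `|r%:E|%E) Ds -EFinM ltry.
have cE r : \int[m]_(x in D) r = r * s by rewrite Rintegral_cst// Ds.
rewrite -(cE k) -RintegralB// -(cE e).
apply: (le_trans (le_normr_Rintegral mD _)).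
  exact: (integrable_EFinB mD ih (ic k)).
apply: le_Rintegral => //.
exact: (integrable_norm (integrable_EFinB mD ih (ic k))).
Qed.

Lemma expands_continuous P : (forall x y, exists px py, expands P x y px py) ->
  (forall y, continuous (P ^~ y)) /\ (forall x, continuous (P x)).
Proof.
move=> hP; have H x y e : 0 < e -> exists2 d, 0 < d &
    forall x' y', `|x' - x| <= d -> `|y' - y| <= d -> `|P x' y' - P x y| <= e.
  move=> e0; have [px [py /(_ 1 ltr01)[d d0 hd]]] := hP x y.
  have k0 : 0 < 2 + `|px| + `|py| by rewrite !ltr_wpDr.
  exists (Num.min d (e / (2 + `|px| + `|py|))).
    by rewrite lt_min d0 divr_gt0.
  move=> x' y'; rewrite !le_min !ler_pdivlMr// => /andP[xd xe] /andP[yd ye].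
  have := hd x' y' xd yd; rewrite mul1r => h.
  set A := (X in `|X| <= _) in h.
  have -> : P x' y' - P x y = A + px * (x' - x) + py * (y' - y) by rewrite /A; ring.
  have {}h : `|A + px * (x' - x) + py * (y' - y)| <=
      `|x' - x| + `|y' - y| + `|px| * `|x' - x| + `|py| * `|y' - y|.
    rewrite -!normrM; apply: (le_trans (ler_normD _ _)); rewrite lerD2r.
    by apply: (le_trans (ler_normD _ _)); rewrite lerD2r.
  apply: (le_trans h).
  have := normr_ge0 px; have := normr_ge0 py.
  have := normr_ge0 (x' - x); have := normr_ge0 (y' - y).
  move: xe ye; set X := `|x' - x|; set Y := `|y' - y|; set p := `|px|; set q := `|py|.
  move=> xe ye Y0 X0 q0 p0.
  have m1 : Num.max X Y * (2 + p + q) <= e by case: (leP X Y).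
  have m2 : X <= Num.max X Y by rewrite le_max lexx.
  have m3 : Y <= Num.max X Y by rewrite le_max lexx orbT.
  apply: le_trans m1; nra.
split=> [y x|x y]; apply/cvgrPdist_le => e e0; have [d d0 hd] := H x y e e0;
  near=> z; rewrite distrC hd ?subrr ?normr0 ?ltW//;
  near: z; apply: (@cvgr_dist_lt _ _ _ (nbhs _)) => //.
Unshelve. all: by end_near. Qed.

Variables (P Q : R -> R -> R) (g : plane -> R) (S : set plane).
Hypothesis expPQ : forall x y : R, exists px py qx qy,
  [/\ expands P x y px py, expands Q x y qx qy & g (x, y) = qx - py].
Hypothesis g_cont : forall x y e : R, 0 < e -> exists2 d, 0 < d &
  forall x' y', `|x' - x| <= d -> `|y' - y| <= d -> `|g (x', y') - g (x, y)| <= e.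
Hypothesis g_int : forall a c l, area.-integrable (square a c l) (EFin \o g).

Let hP x y : exists px py, expands P x y px py.
Proof. by have [px [py [_ [_ [? _ _]]]]] := expPQ x y; exists px, py. Qed.
Let hQ x y : exists px py, expands Q x y px py.
Proof. by have [_ [_ [qx [qy [_ ? _]]]]] := expPQ x y; exists qx, qy. Qed.

Let cont_int (h : R -> R) (a b : R) : continuous h ->
  mu.-integrable `]a, b] (EFin \o h).
Proof.
move=> ch; apply: (@integrableS _ _ _ mu `[a, b]) => //.
- by apply: subset_itvr; rewrite bnd_simp.
- apply: continuous_compact_integrable; first exact: segment_compact.
  exact: continuous_subspaceT.
Qed.

Let intP y a b : mu.-integrable `]a, b] (EFin \o (P ^~ y)).
Proof. exact/cont_int/(expands_continuous hP).1. Qed.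
Let intQ x a b : mu.-integrable `]a, b] (EFin \o (Q x)).
Proof. exact/cont_int/(expands_continuous hQ).2. Qed.

(** The counterclockwise boundary integral of P dx + Q dy minus the area integral of the curl [g];
    Green's formula says that it is zero. *)
Definition circulation a c l : R :=
  (\int[mu]_(x in `]a, a + l]) P x c - \int[mu]_(x in `]a, a + l]) P x (c + l)) +
  (\int[mu]_(y in `]c, c + l]) Q (a + l) y - \int[mu]_(y in `]c, c + l]) Q a y) -
  \int[area]_(p in square a c l) g p.
Local Notation W := circulation.

Let split1 (h : R -> R) (a l : R) : 0 <= l ->
  mu.-integrable `]a, a + (l + l)] (EFin \o h) ->
  \int[mu]_(x in `]a, a + (l + l)]) h x =
  \int[mu]_(x in `]a, a + l]) h x + \int[mu]_(x in `]a + l, a + l + l]) h x.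
Proof.
move=> l0 ih; rewrite -[in X in _ = _ + X]addrA -(Rintegral_itvB (x := a + l) ih).
- by rewrite [RHS]addrC subrK.
- by rewrite bnd_simp lerDl.
- by rewrite bnd_simp addrA lerDl.
Qed.

(** Sides shared by two quarters cancel and area terms add up, so the defect in Green's formula is
    additive under bisection. *)
Lemma circulation_split (a c l : R) : 0 <= l ->
  W a c (l + l) = W a c l + W (a + l) c l + W a (c + l) l + W (a + l) (c + l) l.
Proof.
move=> l0; rewrite /W.
have -> : \int[area]_(p in square a c (l + l)) g p =
   \int[area]_(p in square a c l) g p + \int[area]_(p in square (a + l) c l) g p +
   (\int[area]_(p in square a (c + l) l) g p +
   \int[area]_(p in square (a + l) (c + l) l) g p).
  have E t : `]t, t + (l + l)]%classic = `]t, t + l] `|` `]t + l, t + l + l] :> set R.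
    by rewrite addrA -itv_bndbnd_setU// bnd_simp lerDl.
  have dis t (x : R) : x \in `]t, t + l] -> x \in `]t + l, t + l + l] -> False.
    by rewrite !in_itv/= => /andP[_ h] /andP[/lt_le_trans/(_ h)]; rewrite ltxx.
  have SE : square a c (l + l) = (square a c l `|` square (a + l) c l) `|`
      (square a (c + l) l `|` square (a + l) (c + l) l).
    rewrite /square !E; apply/seteqP; split => -[x y] /=; tauto.
  have gi := g_int a c (l + l); rewrite SE in gi.
  have m a' c' := measurable_square a' c' l.
  have d1 c' : [disjoint square a c' l & square (a + l) c' l].
    by apply/disj_setPS => -[x y] /= [[h1 _] [h2 _]]; exact: dis h1 h2.
  have d2 : [disjoint square a c l `|` square (a + l) c l &
      square a (c + l) l `|` square (a + l) (c + l) l].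
    by apply/disj_setPS => -[x y] /= -[[[_ h1]|[_ h1]] [[_ h2]|[_ h2]]]; exact: dis h1 h2.
  have mU c' : measurable (square a c' l `|` square (a + l) c' l) by exact: measurableU.
  have mUU := measurableU _ _ (mU c) (mU (c + l)).
  rewrite SE (Rintegral_setU (mU _) (mU _) gi d2).
  rewrite (Rintegral_setU (m _ _) (m _ _) _ (d1 _)); last first.
    by apply: (integrableS mUU _ _ gi) => //; left.
  rewrite (Rintegral_setU (m _ _) (m _ _) _ (d1 _))//.
  by apply: (integrableS mUU _ _ gi) => //; right.
rewrite !split1//; do ?exact: intP; do ?exact: intQ.
rewrite !(addrA a) !(addrA c); do ![move: (Rintegral _ _ _) => ?]; ring.
Qed.

(** Goursat's estimate. The first-order parts of [P] and [Q] give exactly the curl at [(x, y)] times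
    the area. Each pair of opposite sides leaves a remainder of at most 4 e l^2, and the variation
    of [g] one of e l^2, hence the factor 9. *)
Lemma circulation_local (x y e : R) : 0 < e -> exists2 d, 0 < d &
  forall a c l : R, 0 < l -> l <= d -> a <= x <= a + l -> c <= y <= c + l ->
  `|W a c l| <= 9%:R * e * l ^+ 2.
Proof.
move=> e0; have [px [py [qx [qy [eP eQ gE]]]]] := expPQ x y.
have [dP dP0 hdP] := eP e e0; have [dQ dQ0 hdQ] := eQ e e0.
have [dg dg0 hdg] := g_cont x y e0.
exists (Num.min dP (Num.min dQ dg)); first by rewrite !lt_min dP0 dQ0.
move=> a c l l0; rewrite !le_min => /and3P[lP lQ lg] /andP[ax xa] /andP[cy yc].
have near_x z : a <= z -> z <= a + l -> `|z - x| <= l := itv_dist ax xa.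
have near_y z : c <= z -> z <= c + l -> `|z - y| <= l := itv_dist cy yc.
have l0' := ltW l0; have al : a <= a + l by rewrite lerDl.
have cl : c <= c + l by rewrite lerDl.
have slack (u v : R) : u <= l -> v <= l -> e * (u + v) <= 2 * e * l.
  by move=> ul vl; rewrite [2 * e]mulrC -mulrA ler_pM2l// mulr_natl mulr2n lerD.
have B1 : `|\int[mu]_(t in `]a, a + l]) (P t c - P t (c + l)) - (- py * l) * l| <= 4%:R * e * l * l.
  apply: Rintegral_near_cst; [exact: measurable_itv|exact: lebesgue_itv_length| |].
    by apply: integrable_EFinB; [exact: measurable_itv|exact: intP|exact: intP].
  move=> t /=; rewrite in_itv/= => /andP[at1 ta1].
  have nt : `|t - x| <= l := near_x t (ltW at1) ta1.
  have nc : `|c - y| <= l := near_y c (lexx c) cl.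
  have nd : `|c + l - y| <= l := near_y (c + l) cl (lexx _).
  have := hdP t c (le_trans nt lP) (le_trans nc lP).
  have := hdP t (c + l) (le_trans nt lP) (le_trans nd lP).
  have k1 := slack _ _ nt nc; have k2 := slack _ _ nt nd.
  move=> /le_trans /(_ k2) h1 /le_trans /(_ k1) h2.
  apply: etrans (le_trans (ler_normB _ _) (lerD h2 h1)); congr (`|_| <= _); ring.
have B2 : `|\int[mu]_(t in `]c, c + l]) (Q (a + l) t - Q a t) - (qx * l) * l| <= 4%:R * e * l * l.
  apply: Rintegral_near_cst; [exact: measurable_itv|exact: lebesgue_itv_length| |].
    by apply: integrable_EFinB; [exact: measurable_itv|exact: intQ|exact: intQ].
  move=> t /=; rewrite in_itv/= => /andP[at1 ta1].
  have nt : `|t - y| <= l := near_y t (ltW at1) ta1.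
  have nc : `|a - x| <= l := near_x a (lexx a) al.
  have nd : `|a + l - x| <= l := near_x (a + l) al (lexx _).
  have := hdQ a t (le_trans nc lQ) (le_trans nt lQ).
  have := hdQ (a + l) t (le_trans nd lQ) (le_trans nt lQ).
  have k1 := slack _ _ nc nt; have k2 := slack _ _ nd nt.
  move=> /le_trans /(_ k2) h1 /le_trans /(_ k1) h2.
  apply: etrans (le_trans (ler_normB _ _) (lerD h1 h2)); congr (`|_| <= _); ring.
have B3 : `|\int[area]_(p in square a c l) g p - g (x, y) * l ^+ 2| <= e * l ^+ 2.
  apply: Rintegral_near_cst; [exact: measurable_square|exact: area_square|exact: g_int|].
  move=> [s t] [/=]; rewrite !in_itv/= => /andP[s1 s2] /andP[t1 t2].
  apply: hdg; apply: le_trans lg.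
    exact: near_x (ltW s1) s2.
  exact: near_y (ltW t1) t2.
rewrite /W -!RintegralB//; do ?exact: intP; do ?exact: intQ.
by rewrite gE in B3; exact: circulation_estimate B1 B2 B3.
Qed.

(** Selects a quarter on which the defect still exceeds [k] times the area. The last quarter is
    taken by default, which [stepP] justifies: were all four defects below their share, so would be
    that of the whole square. *)
Let step (k : R) (s : R * R * R) : R * R * R :=
  let a := s.1.1 in let c := s.1.2 in let h := s.2 / 2 in
  if k * h ^+ 2 < `|W a c h| then (a, c, h)
  else if k * h ^+ 2 < `|W (a + h) c h| then (a + h, c, h)
  else if k * h ^+ 2 < `|W a (c + h) h| then (a, c + h, h)
  else (a + h, c + h, h).

Let stepP (k : R) (s : R * R * R) : 0 < s.2 -> k * s.2 ^+ 2 < `|W s.1.1 s.1.2 s.2| ->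
  let s' := step k s in
  [/\ k * s'.2 ^+ 2 < `|W s'.1.1 s'.1.2 s'.2|, s'.2 = s.2 / 2,
      s.1.1 <= s'.1.1, s'.1.1 + s'.2 <= s.1.1 + s.2 &
      s.1.2 <= s'.1.2 /\ s'.1.2 + s'.2 <= s.1.2 + s.2].
Proof.
case: s => [[a c] l] /= l0 kW; rewrite /step/=; set h := l / 2.
have h0 : 0 < h by rewrite divr_gt0.
have lE : l = h + h by rewrite -splitr.
have hl : h <= l by rewrite lE lerDl ltW.
have A (t : R) : [/\ t <= t + h, t + h <= t + l & t + h + h <= t + l].
  by rewrite lerDl lerD2l -addrA -lE (ltW h0).
have [Aa1 Aa2 Aa3] := A a; have [Ac1 Ac2 Ac3] := A c.
case: ifPn => [h1|]; first by split.
rewrite -leNgt => h1.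
case: ifPn => [h2|]; first by split.
rewrite -leNgt => h2.
case: ifPn => [h3|]; first by split.
rewrite -leNgt => h3.
split => //.
rewrite ltNge; apply/negP => h4; move: kW; rewrite lE circulation_split ?(ltW h0)//.
rewrite -lE; apply/negP; rewrite -leNgt.
have -> : k * l ^+ 2 = 4%:R * (k * h ^+ 2) by rewrite lE; ring.
by rewrite /= in h4; exact: (norm_sum4_le h1 h2 h3 h4).
Qed.

(** A nonzero defect yields nested squares shrinking to a point, on all of which it exceeds [k]
    times the area; [circulation_local] at that point forbids this. *)
Lemma circulation_eq0 (a c l : R) : 0 < l -> W a c l = 0.
Proof.
move=> l0; apply/eqP/negP => /negP W0.
(* Half the ratio of the defect to the area, so that the initial square satisfies the strict
   inequality. *)
pose k := `|W a c l| / (2 * l ^+ 2).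
have k0 : 0 < k by rewrite divr_gt0 ?normr_gt0// mulr_gt0// exprn_gt0.
pose s n := iter n (step k) (a, c, l).
have H n : [/\ 0 < (s n).2, (s n).2 = l / 2 ^+ n &
    k * (s n).2 ^+ 2 < `|W (s n).1.1 (s n).1.2 (s n).2|].
  elim: n => [|n [p0 pE pW]].
    rewrite /s/= expr0 divr1; split => //.
    have -> : k * l ^+ 2 = `|W a c l| / 2 by rewrite /k; field; rewrite gt_eqF.
    by rewrite ltr_pdivrMr// ltr_pMr ?normr_gt0// ltr1n.
  have [h1 h2 _ _ _] := stepP p0 pW.
  rewrite {1 2 3}/s iterS -/(s n); split => //; first by rewrite h2 divr_gt0.
  by rewrite h2 pE exprS invfM mulrCA mulrC.
have M n : [/\ (s n).1.1 <= (s n.+1).1.1, (s n.+1).1.1 + (s n.+1).2 <= (s n).1.1 + (s n).2,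
    (s n).1.2 <= (s n.+1).1.2 & (s n.+1).1.2 + (s n.+1).2 <= (s n).1.2 + (s n).2].
  have [p0 pE pW] := H n; have [_ _ h3 h4 [h5 h6]] := stepP p0 pW.
  by rewrite /s iterS -/(s n).
have nested (u v : nat -> R) : (forall n, 0 < v n) ->
    (forall n, u n <= u n.+1) -> (forall n, u n.+1 + v n.+1 <= u n + v n) ->
    exists x, forall n, u n <= x <= u n + v n.
  move=> v0 um vm; have um' m n : (m <= n)%N -> u m <= u n.
    by move=> mn; rewrite -(subnK mn); elim: (n - m)%N => // p IH; exact: le_trans IH (um _).
  have vm' m n : (m <= n)%N -> u n + v n <= u m + v m.
    by move=> mn; rewrite -(subnK mn); elim: (n - m)%N => // p IH; exact: le_trans (vm _) IH.
  have uv m n : u m <= u n + v n.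
    apply: (@le_trans _ _ (u (maxn m n))); first exact/um'/leq_maxl.
    by apply: (le_trans _ (vm' _ _ (leq_maxr m n))); rewrite lerDl ltW.
  exists (sup (range u)) => n; apply/andP; split.
    by apply: ub_le_sup; [exists (u 0 + v 0) => _ [m _ <-]|exists n].
  by apply: ge_sup; [exists (u 0), 0|move=> _ [m _ <-]].
have [x hx] := nested (fun n => (s n).1.1) (fun n => (s n).2)
  (fun n => let: And3 h _ _ := H n in h) (fun n => let: And4 h _ _ _ := M n in h)
  (fun n => let: And4 _ h _ _ := M n in h).
have [y hy] := nested (fun n => (s n).1.2) (fun n => (s n).2)
  (fun n => let: And3 h _ _ := H n in h) (fun n => let: And4 _ _ h _ := M n in h)
  (fun n => let: And4 _ _ _ h := M n in h).
have [d d0 hd] := @circulation_local x y (k / 9%:R) (divr_gt0 k0 (ltr0Sn _ _)).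
have [n hn] : exists n, l / 2 ^+ n <= d.
  exists (Num.truncn (l / d)).+1; rewrite ler_pdivrMr ?exprn_gt0// mulrC -ler_pdivrMr//.
  apply: (le_trans (ltW (truncnS_gt _))); rewrite -natrX ler_nat ltnW//.
  exact: ltn_expl.
have [p0 pE pW] := H n.
have := hd _ _ _ p0 _ (hx n) (hy n); rewrite {1}pE => /(_ hn).
by rewrite [9%:R * _]mulrC mulfVK ?pnatr_eq0// leNgt pW.
Qed.

End GreenGoursat.

(** * Radial mean values and pointwise bounds *)

Section Expansions.
Context {R : realType}.
Implicit Types (x y a b c d e t : R) (P Q : R -> R -> R).

Lemma expands_lip P x y px py : expands P x y px py ->
  exists2 d, 0 < d & exists2 k, 0 < k & forall x' y', `|x' - x| <= d -> `|y' - y| <= d ->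
    `|P x' y' - P x y| <= k * (`|x' - x| + `|y' - y|).
Proof.
move=> /(_ 1 ltr01)[d d0 hd]; exists d => //; exists (1 + `|px| + `|py|).
  by rewrite !ltr_wpDr.
move=> x' y' hx hy; have := hd _ _ hx hy.
set A := (X in `|X| <= _) => h.
have -> : P x' y' - P x y = A + px * (x' - x) + py * (y' - y) by rewrite /A; ring.
have {}h2 : `|A + px * (x' - x) + py * (y' - y)| <=
    1 * (`|x' - x| + `|y' - y|) + `|px| * `|x' - x| + `|py| * `|y' - y|.
  rewrite -!normrM; apply: (le_trans (ler_normD _ _)); rewrite lerD2r.
  by apply: (le_trans (ler_normD _ _)); rewrite lerD2r.
apply: (le_trans h2).
have := mulr_ge0 (normr_ge0 px) (normr_ge0 (y' - y)).
have := mulr_ge0 (normr_ge0 py) (normr_ge0 (x' - x)).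
by lra.
Qed.

Lemma expands_cont P x y px py e : expands P x y px py -> 0 < e ->
  exists2 d, 0 < d & forall x' y', `|x' - x| <= d -> `|y' - y| <= d ->
    `|P x' y' - P x y| <= e.
Proof.
move=> /expands_lip[d d0 [k k0 h]] e0; exists (Num.min d (e / (k + k))).
  by rewrite lt_min d0 divr_gt0// addr_gt0.
move=> x' y'; rewrite !le_min => /andP[h1 h2] /andP[h3 h4].
apply: (le_trans (h _ _ h1 h3)).
apply: (@le_trans _ _ (k * (e / (k + k) + e / (k + k)))).
  by rewrite ler_pM2l// lerD.
by apply: le_of_eq; field; rewrite gt_eqF// addr_gt0.
Qed.

Lemma expands_linear x y a b c : expands (fun x y => a * x + b * y + c) x y a b.
Proof.
move=> e e0; exists 1 => // x' y' _ _.
rewrite [X in `|X| <= _](_ : _ = 0); last by rewrite /=; ring.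
by rewrite normr0 mulr_ge0 ?addr_ge0// ltW.
Qed.

Lemma expandsD P Q x y px py qx qy : expands P x y px py -> expands Q x y qx qy ->
  expands (fun x y => P x y + Q x y) x y (px + qx) (py + qy).
Proof.
move=> hP hQ e e0; have e2 : 0 < e / 2 by rewrite divr_gt0.
have [d1 d10 h1] := hP _ e2; have [d2 d20 h2] := hQ _ e2.
exists (Num.min d1 d2); first by rewrite lt_min d10.
move=> x' y'; rewrite !le_min => /andP[a1 a2] /andP[b1 b2].
rewrite /=; set X := (X in `|X| <= _).
have -> : X = (P x' y' - P x y - px * (x' - x) - py * (y' - y)) +
  (Q x' y' - Q x y - qx * (x' - x) - qy * (y' - y)) by rewrite /X; ring.
apply: (le_trans (ler_normD _ _)); rewrite [in leRHS](splitr e) mulrDl.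
by apply: lerD; [exact: h1|exact: h2].
Qed.

Lemma expandsZ P x y px py c : expands P x y px py ->
  expands (fun x y => c * P x y) x y (c * px) (c * py).
Proof.
move=> hP e e0; have c0 : 0 < `|c| + 1 by rewrite ltr_wpDl.
have [d d0 h] := hP _ (divr_gt0 e0 c0); exists d => // x' y' hx hy.
have := h _ _ hx hy; rewrite /=; set X := (X in `|X| <= _).
set Y := (X in _ -> `|X| <= _).
have -> : Y = c * X by rewrite /X /Y; ring.
rewrite normrM; set D := `|x' - x| + _ => hX.
have D0 : 0 <= D by rewrite addr_ge0.
apply: (@le_trans _ _ ((`|c| + 1) * (e / (`|c| + 1) * D))); last first.
  by rewrite mulrA mulrCA mulfV ?mulr1// gt_eqF.
by apply: ler_pM => //; rewrite lerDl.
Qed.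

Lemma expandsM P Q x y px py qx qy : expands P x y px py -> expands Q x y qx qy ->
  expands (fun x y => P x y * Q x y) x y
    (px * Q x y + P x y * qx) (py * Q x y + P x y * qy).
Proof.
move=> hP hQ e e0; have e3 : 0 < e / 3%:R by rewrite divr_gt0.
have [d1 d10 h1] := expandsZ (Q x y) hP e3.
have [d2 d20 h2] := expandsZ (P x y) hQ e3.
have [d3 d30 [k k0 h3]] := expands_lip hP.
have [d4 d40 h4] := expands_cont hQ (divr_gt0 e3 k0).
exists (Num.min (Num.min d1 d2) (Num.min d3 d4)).
  by rewrite !lt_min d10 d20 d30.
move=> x' y'; rewrite !le_min => /andP[/andP[a1 a2] /andP[a3 a4]].
move=> /andP[/andP[b1 b2] /andP[b3 b4]].
have {}h1 := h1 _ _ a1 b1; have {}h2 := h2 _ _ a2 b2.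
have {}h3 := h3 _ _ a3 b3; have {}h4 := h4 _ _ a4 b4.
move: h1 h2 h3; set D := `|x' - x| + `|y' - y|.
have D0 : 0 <= D by rewrite addr_ge0.
set X1 := (X in `|X| <= _); set X2 := (X in _ -> `|X| <= _ -> _) => h1 h2 h3.
rewrite /=; set Y := (X in `|X| <= _).
have -> : Y = X1 + X2 + (P x' y' - P x y) * (Q x' y' - Q x y) by rewrite /X1 /X2 /Y; ring.
apply: (le_trans (ler_normD _ _)); rewrite normrM.
apply: (le_trans (lerD (ler_normD _ _) (ler_pM (normr_ge0 _) (normr_ge0 _) h3 h4))).
have -> : k * D * (e / 3%:R / k) = e / 3%:R * D by field; rewrite gt_eqF.
by rewrite /X1 /X2 in h1 h2 *; lra.
Qed.

Definition expands1 (v : R -> R) t dv := forall e, 0 < e ->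
  exists2 d, 0 < d & forall t', `|t' - t| <= d ->
    `|v t' - v t - dv * (t' - t)| <= e * `|t' - t|.

Lemma expands_comp v P x y px py dv : expands1 v (P x y) dv -> expands P x y px py ->
  expands (fun x y => v (P x y)) x y (dv * px) (dv * py).
Proof.
move=> hv hP e e0; have e2 : 0 < e / 2 by rewrite divr_gt0.
have [d1 d10 [k k0 h1]] := expands_lip hP.
have [d2 d20 h2] := hv _ (divr_gt0 e2 k0).
have [d3 d30 h3] := expandsZ dv hP e2.
have [d4 d40 h4] := expands_cont hP d20.
exists (Num.min (Num.min d1 d3) d4); first by rewrite !lt_min d10 d30.
move=> x' y'; rewrite !le_min => /andP[/andP[a1 a3] a4] /andP[/andP[b1 b3] b4].
have {}h1 := h1 _ _ a1 b1; have {}h3 := h3 _ _ a3 b3.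
have {}h2 := h2 _ (h4 _ _ a4 b4).
rewrite /=; set Y := (X in `|X| <= _).
have -> : Y = (v (P x' y') - v (P x y) - dv * (P x' y' - P x y)) +
  (dv * P x' y' - dv * P x y - dv * px * (x' - x) - dv * py * (y' - y)) by rewrite /Y; ring.
apply: (le_trans (ler_normD _ _)).
apply: (le_trans (lerD h2 h3)); rewrite [in leRHS](splitr e) mulrDl lerD2r.
apply: (@le_trans _ _ (e / 2 / k * (k * (`|x' - x| + `|y' - y|)))).
  by rewrite ler_pM2l// divr_gt0.
by rewrite mulrA mulfVK// gt_eqF.
Qed.

Lemma expands_local P Q x y px py d : 0 < d ->
  (forall x' y', `|x' - x| <= d -> `|y' - y| <= d -> P x' y' = Q x' y') ->
  expands P x y px py -> expands Q x y px py.
Proof.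
move=> d0 PQ hP e e0; have [d1 d10 h1] := hP _ e0.
exists (Num.min d d1); first by rewrite lt_min d0.
move=> x' y'; rewrite !le_min => /andP[a1 a2] /andP[b1 b2].
have e1 := PQ _ _ a1 b1; have e2 : P x y = Q x y by apply: PQ; rewrite subrr normr0 ltW.
by rewrite -e1 -e2; apply: h1.
Qed.

(* An elementary C^1 bump: [bump s t] is supported in [t <= 1/s] and has        *)
(* derivative [- weight s t].                                                   *)
Definition bump (s t : R) : R := Num.max 0 (1 - s * t) ^+ 2.
Definition weight (s t : R) : R := 2 * s * Num.max 0 (1 - s * t).

(** The square of the positive part has a 2-Lipschitz derivative, so its second-order remainder is
    at most the square of the increment. *)
Lemma bump_expand s t t' :
  `|bump s t' - bump s t + weight s t * (t' - t)| <= s ^+ 2 * (t' - t) ^+ 2.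
Proof.
have K (a h : R) : `|Num.max 0 (a + h) ^+ 2 - Num.max 0 a ^+ 2 - 2 * Num.max 0 a * h| <= h ^+ 2.
  rewrite ler_norml; case: (leP 0 (a + h)); case: (leP 0 a) => h1 h2; nra.
have := K (1 - s * t) (- s * (t' - t)); rewrite /bump /weight.
have -> : 1 - s * t + - s * (t' - t) = 1 - s * t' by ring.
congr (`|_| <= _); ring.
Qed.

(** For 0 < s < r this is [bump s t - bump r t] divided by [t], with the singularity at 0 removed:
    while [r * t <= 1] both bumps are squares of affine functions and the quotient is a
    polynomial. *)
Definition bump_quot (r s t : R) : R :=
  if r * t <= 1 then (r - s) * (2 - (r + s) * t) else bump s t / t.

Lemma bump_quotE r s t : 0 < s -> s < r -> t * bump_quot r s t = bump s t - bump r t.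
Proof.
move=> s0 sr; rewrite /bump_quot; case: ifPn => [h|].
  have hs : s * t <= 1.
    have [t0|t0] := leP 0 t; first by apply: le_trans h; rewrite ler_wpM2r// ltW.
    by apply: (@le_trans _ _ 0) => //; rewrite mulr_ge0_le0// ltW.
  by rewrite /bump !max_r ?subr_ge0//; ring.
rewrite -ltNge => h; have t0 : 0 < t.
  rewrite ltNge; apply/negP => t0; move: h; rewrite ltNge => /negP; apply.
  by apply: (@le_trans _ _ 0) => //; rewrite mulr_ge0_le0// ltW// (lt_trans s0).
rewrite [bump r t]/bump max_l ?subr_le0 ?ltW// expr0n subr0.
by rewrite mulrCA mulfV ?mulr1// gt_eqF.
Qed.

Lemma bump_quot_eq0 r s t : 0 < s -> s < r -> 1 <= s * t -> bump_quot r s t = 0.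
Proof.
move=> s0 sr h; have t0 : 0 < t by rewrite -(pmulr_rgt0 _ s0) (lt_le_trans ltr01).
have rt : 1 <= r * t by apply: (le_trans h); rewrite ler_pM2r// ltW.
have := bump_quotE t s0 sr; rewrite /bump !max_l ?subr_le0// expr0n subrr.
by move/eqP; rewrite mulf_eq0 gt_eqF//= => /eqP.
Qed.

(** The second identity is the derivative of t v(t) for the quotient v. At t = 0 the polynomial
    branch is expanded; for t > 0 the expansion of t v(t) is divided by t. *)
Lemma bump_quot_expands r s t : 0 < s -> s < r -> 0 <= t -> exists dv,
  expands1 (bump_quot r s) t dv /\
  bump_quot r s t + t * dv = weight r t - weight s t.
Proof.
move=> s0 sr; have r0 := lt_trans s0 sr.
rewrite le_eqVlt => /predU1P[<-|t0].
  exists (- (r - s) * (r + s)); split; last first.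
    by rewrite /bump_quot /weight !mulr0 subr0 ler01 max_r//; ring.
  move=> e e0; exists (1 / r); first by rewrite divr_gt0.
  move=> t'; rewrite subr0 => ht; rewrite /bump_quot mulr0 ler01.
  have -> : r * t' <= 1.
    by rewrite mulrC -ler_pdivlMr//; apply: le_trans ht; exact: ler_norm.
  rewrite [X in `|X| <= _](_ : _ = 0); last by rewrite /=; ring.
  by rewrite normr0 mulr_ge0// ltW.
set v := bump_quot r s; set N' := weight r t - weight s t.
pose dv := (N' - v t) / t; exists dv.
have dvE : t * dv = N' - v t by rewrite /dv mulrCA mulfV ?mulr1// gt_eqF.
split; last by rewrite dvE addrC subrK.
have vE := bump_quotE _ s0 sr; rewrite -/v in vE.
pose k := (s ^+ 2 + r ^+ 2 + `|dv|) / (t / 2).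
have k0 : 0 < k.
  by rewrite divr_gt0 ?divr_gt0// ltr_wpDr// addr_gt0// exprn_gt0.
move=> e e0; exists (Num.min (t / 2) (e / k)).
  by rewrite lt_min; apply/andP; split; apply: divr_gt0.
move=> t'; rewrite le_min => /andP[ht]; rewrite ler_pdivlMr// => he.
have tt' : t / 2 <= t' by move: ht; rewrite ler_norml; lra.
have t'0 : 0 < t' by rewrite (lt_le_trans _ tt')// divr_gt0.
have : `|t' * (v t' - v t - dv * (t' - t))| <= (s ^+ 2 + r ^+ 2 + `|dv|) * (t' - t) ^+ 2.
  have -> : t' * (v t' - v t - dv * (t' - t)) =
     (bump s t' - bump s t + weight s t * (t' - t)) -
     (bump r t' - bump r t + weight r t * (t' - t)) - dv * (t' - t) ^+ 2.
    have -> : t' * (v t' - v t - dv * (t' - t)) =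
      t' * v t' - t * v t - (t' - t) * v t - (t * dv) * (t' - t) - dv * (t' - t) ^+ 2 by ring.
    by rewrite !vE dvE /N'; ring.
  apply: (le_trans (ler_normB _ _)); rewrite normrM (ger0_norm (sqr_ge0 (t' - t))).
  rewrite [leRHS]mulrDl lerD2r.
  apply: (le_trans (ler_normB _ _)); rewrite mulrDl.
  by apply: lerD; exact: bump_expand.
rewrite normrM (gtr0_norm t'0) -(real_normK (num_real (t' - t))) => h.
rewrite -(ler_pM2l t'0); apply: (le_trans h).
apply: (@le_trans _ _ (t / 2 * (e * `|t' - t|))); last first.
  by apply: ler_wpM2r => //; rewrite mulr_ge0// ltW.
rewrite expr2 [in leRHS]mulrA [in leLHS]mulrA; apply: ler_wpM2r => //.
have -> : s ^+ 2 + r ^+ 2 + `|dv| = k * (t / 2).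
  by rewrite /k mulfVK// gt_eqF// divr_gt0.
rewrite mulrAC [t / 2 * e]mulrC; apply: ler_wpM2r; first by rewrite divr_ge0// ltW.
by rewrite mulrC.
Qed.

End Expansions.

(** * Radial means of analytic functions *)

Section RadialMean.
Context {R : realType}.
Local Notation plane := (measurableTypeR R * measurableTypeR R)%type.
Implicit Types (x y a b c e t r s : R) (P Q : R -> R -> R).

Lemma integrable_EFinM d (T : measurableType d) (m : {measure set T -> \bar R})
  (D : set T) (f h : T -> R) (k : R) : measurable D ->
  m.-integrable D (EFin \o f) -> measurable_fun D h ->
  (forall z, D z -> `|h z| <= k) -> m.-integrable D (EFin \o (fun z => f z * h z)).
Proof.
move=> mD fi mh hk; apply: (integrableMl mD fi mh).
by exists k; split; [exact: num_real|move=> M kM z Dz; exact: le_trans (hk z Dz) (ltW kM)].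
Qed.

Definition pcont (F : R -> R -> R) x y := forall e : R, 0 < e -> exists2 d : R, 0 < d &
  forall x' y', `|x' - x| <= d -> `|y' - y| <= d -> `|F x' y' - F x y| <= e.

Lemma pcontD P Q x y : pcont P x y -> pcont Q x y -> pcont (fun x y => P x y + Q x y) x y.
Proof.
move=> hP hQ e e0; have e2 : 0 < e / 2 by rewrite divr_gt0.
have [d1 d10 h1] := hP _ e2; have [d2 d20 h2] := hQ _ e2.
exists (Num.min d1 d2); first by rewrite lt_min d10.
move=> x' y'; rewrite !le_min => /andP[a1 a2] /andP[b1 b2].
rewrite opprD addrACA [leRHS](splitr e).
by apply: (le_trans (ler_normD _ _)); apply: lerD; [exact: h1|exact: h2].
Qed.

Lemma pcontM P Q x y : pcont P x y -> pcont Q x y -> pcont (fun x y => P x y * Q x y) x y.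
Proof.
move=> hP hQ e e0.
have k0 : 0 < 1 + `|P x y| + `|Q x y| by rewrite !ltr_wpDr.
pose k := 1 + `|P x y| + `|Q x y|.
have m0 : 0 < Num.min 1 (e / k) by rewrite lt_min ltr01; apply: divr_gt0.
have [d1 d10 h1] := hP _ m0; have [d2 d20 h2] := hQ _ m0.
exists (Num.min d1 d2); first by rewrite lt_min d10.
move=> x' y'; rewrite !le_min => /andP[a1 a2] /andP[b1 b2].
have {}h1 := h1 _ _ a1 b1; have {}h2 := h2 _ _ a2 b2.
have -> : P x' y' * Q x' y' - P x y * Q x y = (P x' y' - P x y) * (Q x' y' - Q x y) +
  P x y * (Q x' y' - Q x y) + (P x' y' - P x y) * Q x y by ring.
set m := Num.min _ _ in m0 h1 h2.
have m1 : m <= 1 by rewrite ge_min lexx.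
have mk : m * k <= e by rewrite -ler_pdivlMr// ge_min lexx orbT.
apply: (le_trans (ler_normD _ _)); rewrite normrM.
apply: (le_trans (lerD (ler_normD _ _) (lexx _))); rewrite !normrM.
apply: le_trans mk; rewrite /k.
have := normr_ge0 (P x y); have := normr_ge0 (Q x y).
move: h1 h2; have := normr_ge0 (P x' y' - P x y); have := normr_ge0 (Q x' y' - Q x y).
move: `|P x' y' - P x y| `|Q x' y' - Q x y| `|P x y| `|Q x y| => A B p q B0 A0 hA hB q0 p0.
have : A * B <= m * 1 by apply: ler_pM => //; exact: le_trans hB m1.
have : p * B <= p * m by apply: ler_wpM2l.
have : A * q <= m * q by apply: ler_wpM2r.
by lra.
Qed.

Lemma expands_pcont P x y px py : expands P x y px py -> pcont P x y.
Proof. by move=> hP e e0; exact: expands_cont hP e0. Qed.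

Lemma pcont_local P Q x y d : 0 < d ->
  (forall x' y', `|x' - x| <= d -> `|y' - y| <= d -> P x' y' = Q x' y') ->
  pcont P x y -> pcont Q x y.
Proof.
move=> d0 PQ hP e e0; have [d1 d10 h1] := hP _ e0.
exists (Num.min d d1); first by rewrite lt_min d0.
move=> x' y'; rewrite !le_min => /andP[a1 a2] /andP[b1 b2].
have e1 := PQ _ _ a1 b1; have e2 : P x y = Q x y by apply: PQ; rewrite subrr normr0 ltW.
by rewrite -e1 -e2; apply: h1.
Qed.

Definition sqdist x0 y0 x y := (x - x0) ^+ 2 + (y - y0) ^+ 2.

Lemma sqdist_ge0 x0 y0 x y : 0 <= sqdist x0 y0 x y.
Proof. by rewrite addr_ge0// sqr_ge0. Qed.

Lemma expands_eq P Q x y px py qx qy : P =2 Q -> px = qx -> py = qy ->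
  expands P x y px py -> expands Q x y qx qy.
Proof.
by move=> PQ <- <-; have -> : Q = P by apply/funext => a; apply/funext => b; rewrite PQ.
Qed.

Lemma expands_fst x0 x y : expands (fun x _ => x - x0) x y 1 0.
Proof.
by apply: expands_eq (expands_linear x y 1 0 (- x0)) => // a b; rewrite mul1r mul0r addr0.
Qed.

Lemma expands_snd y0 x y : expands (fun _ y => y - y0) x y 0 1.
Proof.
by apply: expands_eq (expands_linear x y 0 1 (- y0)) => // a b; rewrite mul1r mul0r add0r.
Qed.

Lemma expands_sqdist x0 y0 x y :
  expands (sqdist x0 y0) x y (2 * (x - x0)) (2 * (y - y0)).
Proof.
have h1 := expands_fst x0 x y; have h2 := expands_snd y0 x y.
have := expandsD (expandsM h1 h1) (expandsM h2 h2).
by apply: expands_eq => [a b||] /=; rewrite /sqdist; ring.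
Qed.

Lemma weight_lip s t t' : 0 < s -> `|weight s t' - weight s t| <= 2 * s ^+ 2 * `|t' - t|.
Proof.
move=> s0; have K (a h : R) : `|Num.max 0 (a + h) - Num.max 0 a| <= `|h|.
  by rewrite ler_norml; case: (leP 0 (a + h)); case: (leP 0 a) => h1 h2;
     have := ler_norm h; have := ler_norm (- h); rewrite normrN; lra.
have -> : weight s t' - weight s t =
    2 * s * (Num.max 0 ((1 - s * t) + - s * (t' - t)) - Num.max 0 (1 - s * t)).
  rewrite /weight (_ : 1 - s * t + - s * (t' - t) = 1 - s * t'); by ring.
rewrite normrM ger0_norm ?mulr_ge0 ?(ltW s0)//.
apply: (le_trans (ler_wpM2l _ (K _ _))); first by rewrite mulr_ge0 ?(ltW s0).
rewrite normrM normrN (gtr0_norm s0) expr2 !mulrA//.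
Qed.

Lemma weight_ge0 s t : 0 < s -> 0 <= weight s t.
Proof. by move=> s0; rewrite !mulr_ge0 ?(ltW s0)// le_max lexx. Qed.

Lemma weight_le s t : 0 < s -> 0 <= t -> weight s t <= 2 * s.
Proof.
move=> s0 t0; rewrite /weight ler_piMr ?mulr_ge0 ?(ltW s0)// ge_max ler01 gerBl.
by rewrite mulr_ge0// ltW.
Qed.

Lemma weight_eq0 s t : 1 <= s * t -> weight s t = 0.
Proof. by move=> h; rewrite /weight max_l ?mulr0// subr_le0. Qed.

Lemma pcont_weight s x0 y0 x y : 0 < s ->
  pcont (fun x y => weight s (sqdist x0 y0 x y)) x y.
Proof.
move=> s0 e e0; have k0 : 0 < 2 * s ^+ 2 by rewrite mulr_gt0// exprn_gt0.
have [d d0 hd] := expands_cont (expands_sqdist x0 y0 x y) (divr_gt0 e0 k0).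
exists d => // x' y' hx hy; apply: (le_trans (weight_lip _ _ s0)).
by rewrite mulrC -ler_pdivlMr//; exact: hd.
Qed.

Lemma measurable_sqdist x0 y0 :
  measurable_fun [set: plane] (fun p => sqdist x0 y0 p.1 p.2).
Proof.
apply: measurable_funD; apply: measurable_funX; apply: measurable_funB => //.
Qed.

Lemma measurable_weight s x0 y0 :
  measurable_fun [set: plane] (fun p => weight s (sqdist x0 y0 p.1 p.2)).
Proof.
apply: measurable_funM => //; apply: measurable_maxr => //.
by apply: measurable_funB => //; apply: measurable_funM => //; exact: measurable_sqdist.
Qed.

(** Green's formula for the real and imaginary parts [p], [q] of v(|z - z0|^2) f(z) conj(z - z0),
    where f = u + i w and v is the bump quotient. By the Cauchy-Riemann equations the curl is 2 u (v
    + t v') at t = |z - z0|^2, that is, 2 u times the difference of the two weights. The field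
    vanishes at distance at least [rho] from the centre, in particular on the boundary of the
    square. *)
Lemma radial_weight_indep (u w : R -> R -> R) x0 y0 rho r s :
  0 < rho -> s = rho ^- 2 -> s < r ->
  (forall x y, sqdist x0 y0 x y <= rho ^+ 2 -> exists a b,
     expands u x y a (- b) /\ expands w x y b a) ->
  (forall a c l, area.-integrable (square a c l) (EFin \o (fun p => u p.1 p.2))) ->
  \int[area]_(p in square (x0 - rho) (y0 - rho) (rho + rho))
     (u p.1 p.2 * weight r (sqdist x0 y0 p.1 p.2)) =
  \int[area]_(p in square (x0 - rho) (y0 - rho) (rho + rho))
     (u p.1 p.2 * weight s (sqdist x0 y0 p.1 p.2)).
Proof.
move=> rho0 sE sr an iu.
have s0 : 0 < s by rewrite sE invr_gt0 exprn_gt0.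
have r0 := lt_trans s0 sr.
have srho t : rho ^+ 2 <= t -> 1 <= s * t.
  by move=> h; rewrite sE mulrC ler_pdivlMr ?exprn_gt0// mul1r.
have rrho t : rho ^+ 2 <= t -> 1 <= r * t.
  move=> h; apply: (le_trans (srho _ h)); apply: ler_wpM2r; last exact: ltW.
  by rewrite (le_trans _ h)// sqr_ge0.
pose T := sqdist x0 y0; pose v := bump_quot r s.
pose p x y := v (T x y) * (u x y * (x - x0) + w x y * (y - y0)).
pose q x y := v (T x y) * (w x y * (x - x0) + (-1) * (u x y * (y - y0))).
pose g (z : plane) := 2 * (u z.1 z.2 * (weight r (T z.1 z.2) - weight s (T z.1 z.2))).
have out x y : rho ^+ 2 < T x y -> exists2 d, 0 < d &
    forall x' y', `|x' - x| <= d -> `|y' - y| <= d -> rho ^+ 2 <= T x' y'.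
  move=> h; have h2 : 0 < T x y - rho ^+ 2 by rewrite subr_gt0.
  have [d d0 hd] := expands_cont (expands_sqdist x0 y0 x y) h2.
  exists d => // x' y' hx hy; have := hd _ _ hx hy.
  by rewrite ler_norml => /andP[h3 _]; rewrite -/T in h3; lra.
have p0 x y : rho ^+ 2 <= T x y -> p x y = 0 /\ q x y = 0.
  by move=> h; rewrite /p /q /v bump_quot_eq0 ?srho// !mul0r.
have exp0 x y : expands (fun _ _ : R => 0 : R) x y 0 0.
  by apply: expands_eq (expands_linear x y 0 0 0) => // a b; rewrite !mul0r !addr0.
(* Analyticity is given only within distance [rho]; farther out [p] and [q] vanish locally. *)
have pq x y : exists px py qx qy,
    [/\ expands q x y px py, expands p x y qx qy & g (x, y) = qx - py].
  have [h|h] := leP (T x y) (rho ^+ 2); last first.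
    have [d d0 hd] := out x y h; exists 0, 0, 0, 0; split.
    - by apply: (expands_local d0) (exp0 x y) => x' y' hx hy; rewrite (p0 _ _ _).2// hd.
    - by apply: (expands_local d0) (exp0 x y) => x' y' hx hy; rewrite (p0 _ _ _).1// hd.
    - by rewrite /g/= !weight_eq0 ?srho ?rrho ?(ltW h)// subr0 !mulr0.
  have [a [b [eu ew]]] := an _ _ h.
  have [dv [ev vE]] := bump_quot_expands s0 sr (sqdist_ge0 x0 y0 x y).
  have eT := expands_comp ev (expands_sqdist x0 y0 x y).
  have hX := expands_fst x0 x y; have hY := expands_snd y0 x y.
  have hp := expandsM eT (expandsD (expandsM eu hX) (expandsM ew hY)).
  have hq := expandsM eT (expandsD (expandsM ew hX) (expandsZ (-1) (expandsM eu hY))).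
  do 4 eexists; split; [exact: hq|exact: hp|].
  by rewrite /g/= -/T -vE -/(T x y) -/v /T /sqdist; ring.
have gc x y : pcont (fun x y => g (x, y)) x y.
  have [h|h] := leP (T x y) (rho ^+ 2); last first.
    have [d d0 hd] := out x y h; apply: (pcont_local d0) (expands_pcont (exp0 x y)).
    move=> x' y' hx hy; have h' := hd _ _ hx hy.
    have e1 : weight r (T x' y') = 0 by apply: weight_eq0; exact: rrho.
    have e2 : weight s (T x' y') = 0 by apply: weight_eq0; exact: srho.
    by rewrite /g/= e1 e2 subrr !mulr0.
  have [a [b [eu _]]] := an _ _ h.
  have cc k : pcont (fun _ _ => k) x y.
    by move=> e e0; exists 1 => // *; rewrite subrr normr0 ltW.
  rewrite /g/=; apply: pcontM (cc 2) _; apply: pcontM (expands_pcont eu) _.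
  apply: pcontD (pcont_weight _ _ _ _ r0) _.
  have -> : (fun x y : R => - weight s (T x y)) = (fun x y => -1 * weight s (T x y)).
    by apply/funext => x'; apply/funext => y'; rewrite mulN1r.
  exact: pcontM (cc (-1)) (pcont_weight _ _ _ _ s0).
have iw k a c l : 0 < k -> area.-integrable (square a c l)
    (EFin \o (fun z => u z.1 z.2 * weight k (T z.1 z.2))).
  move=> k0; apply: (integrable_EFinM (k := 2 * k)).
  - exact: measurable_square.
  - exact: iu.
  - apply: (@measurable_funS _ _ _ _ setT) => //; exact: measurable_weight.
  - by move=> z _; rewrite ger0_norm ?weight_ge0// weight_le// sqdist_ge0.
have gE : g = (fun z => 2 * (u z.1 z.2 * weight r (T z.1 z.2) - u z.1 z.2 * weight s (T z.1 z.2))).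
  by apply/funext => z; rewrite /g mulrBr.
have ig' a c l := integrable_EFinB (measurable_square a c l) (iw r a c l r0) (iw s a c l s0).
have ig a c l : area.-integrable (square a c l) (EFin \o g).
  rewrite gE; have := integrableZl (measurable_square a c l) 2 (ig' a c l).
  by apply: eq_integrable; [exact: measurable_square|].
have rr0 : 0 < rho + rho by rewrite addr_gt0.
have := circulation_eq0 pq gc ig (x0 - rho) (y0 - rho) rr0.
rewrite /circulation.
have I0 (h : R -> R) (a b : R) : (forall t, h t = 0) ->
    \int[@lebesgue_measure R]_(x in `]a, b]) h x = 0.
  move=> h0; rewrite (_ : h = fun=> 0); last exact/funext.
  by rewrite Rintegral_cst ?mul0r//; exact: measurable_itv.
have TA x y : `|x - x0| = rho \/ `|y - y0| = rho -> rho ^+ 2 <= T x y.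
  by case=> h; rewrite -h real_normK ?num_real// ?lerDl ?lerDr sqr_ge0.
have E1 : x0 - rho + (rho + rho) - x0 = rho by ring.
have E2 : y0 - rho + (rho + rho) - y0 = rho by ring.
have E3 t : t - rho - t = - rho by ring.
rewrite !I0; first last.
- by move=> t; rewrite (p0 _ _ _).2//; apply: TA; right; rewrite E3 normrN gtr0_norm.
- by move=> t; rewrite (p0 _ _ _).2//; apply: TA; right; rewrite E2 gtr0_norm.
- by move=> t; rewrite (p0 _ _ _).1//; apply: TA; left; rewrite E1 gtr0_norm.
- by move=> t; rewrite (p0 _ _ _).1//; apply: TA; left; rewrite E3 normrN gtr0_norm.
rewrite !subr0 !add0r => /eqP; rewrite oppr_eq0 gE.
rewrite RintegralZl; [|exact: measurable_square|exact: ig'].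
rewrite mulf_eq0 pnatr_eq0/= RintegralB; [|exact: measurable_square|exact: iw|exact: iw].
by rewrite subr_eq0 => /eqP.
Qed.

End RadialMean.

Section MeanValue.
Context {R : realType}.
Local Notation plane := (measurableTypeR R * measurableTypeR R)%type.
Implicit Types (x y a b c e t r s : R) (P Q : R -> R -> R).

Lemma Rintegral_support d (T : measurableType d) (m : {measure set T -> \bar R})
  (D E : set T) (h : T -> R) : D `<=` E -> (forall z, E z -> ~ D z -> h z = 0) ->
  \int[m]_(z in E) h z = \int[m]_(z in D) h z.
Proof.
move=> DE h0; rewrite Rintegral_mkcond [RHS]Rintegral_mkcond.
apply: eq_Rintegral => z _; rewrite !patchE.
have [zD|zD] := boolP (z \in D); have [zE|zE] := boolP (z \in E) => //.
  by move: zD zE; rewrite inE => /DE; rewrite notin_setE.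
by apply: h0; [rewrite inE in zE|rewrite notin_setE in zD].
Qed.

Lemma sqdist_lt x0 y0 x y rho : sqdist x0 y0 x y < rho ^+ 2 -> 0 < rho ->
  `|x - x0| < rho /\ `|y - y0| < rho.
Proof.
move=> h rho0; split; rewrite -(@ltr_pXn2r _ 2) ?nnegrE ?(ltW rho0)//;
  rewrite real_normK ?num_real//; apply: le_lt_trans h; rewrite /sqdist.
  by rewrite lerDl sqr_ge0.
by rewrite lerDr sqr_ge0.
Qed.

Lemma weight_support x0 y0 rho (z : plane) : 0 < rho ->
  ~ square (x0 - rho) (y0 - rho) (rho + rho) z ->
  weight (rho ^- 2) (sqdist x0 y0 z.1 z.2) = 0.
Proof.
move=> rho0 hz; apply: weight_eq0; rewrite mulrC ler_pdivlMr ?exprn_gt0// mul1r.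
rewrite leNgt; apply/negP => /sqdist_lt/(_ rho0)[h1 h2]; apply: hz.
by split => /=; rewrite in_itv/=; move: h1 h2; rewrite !ltr_norml; lra.
Qed.

Lemma integrable_weight s x0 y0 a c l : 0 < s -> 0 <= l -> area.-integrable (square a c l)
    (EFin \o (fun z => weight s (sqdist x0 y0 z.1 z.2))).
Proof.
move=> s0 l0; apply: measurable_bounded_integrable.
- exact: measurable_square.
- by rewrite area_square// ltry.
- apply: (@measurable_funS _ _ _ _ setT) => //; exact: measurable_weight.
- exists (2 * s); split; [exact: num_real|move=> M kM z _].
  by apply: le_trans (ltW kM); rewrite ger0_norm ?weight_ge0// weight_le// sqdist_ge0.
Qed.

Lemma integrable_mul_weight (u : R -> R -> R) s x0 y0 a c l : 0 < s ->
  area.-integrable (square a c l) (EFin \o (fun p => u p.1 p.2)) ->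
  area.-integrable (square a c l)
    (EFin \o (fun z => u z.1 z.2 * weight s (sqdist x0 y0 z.1 z.2))).
Proof.
move=> s0 iu; apply: (integrable_EFinM (k := 2 * s)) => //.
- exact: measurable_square.
- apply: (@measurable_funS _ _ _ _ setT) => //; exact: measurable_weight.
- by move=> z _; rewrite ger0_norm ?weight_ge0// weight_le// sqdist_ge0.
Qed.

Definition weight_mass x0 y0 rho := \int[area]_(p in square (x0 - rho) (y0 - rho) (rho + rho))
     weight (rho ^- 2) (sqdist x0 y0 p.1 p.2).

(* The Cauchy--Riemann equations for u + i w. *)
Definition conj_expands (u w : R -> R -> R) x y := exists a b,
   expands u x y a (- b) /\ expands w x y b a.

(** By [radial_weight_indep] the weight may be replaced by any sharper one. As [r] grows the weight
    concentrates at the centre, where [u] is continuous, while its mass, which is the case [u = 1],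
    stays the same. *)
Lemma radial_mean (u w : R -> R -> R) x0 y0 rho : 0 < rho ->
  (forall x y, sqdist x0 y0 x y <= rho ^+ 2 -> conj_expands u w x y) ->
  (forall a c l, area.-integrable (square a c l) (EFin \o (fun p => u p.1 p.2))) ->
  \int[area]_(p in square (x0 - rho) (y0 - rho) (rho + rho))
     (u p.1 p.2 * weight (rho ^- 2) (sqdist x0 y0 p.1 p.2)) = u x0 y0 * weight_mass x0 y0 rho.
Proof.
move=> rho0 an iu; set s := rho ^- 2; set S := square _ _ _.
have s0 : 0 < s by rewrite /s invr_gt0 exprn_gt0.
have rr0 : 0 <= rho + rho by rewrite addr_ge0 ?ltW.
have mS : measurable S by exact: measurable_square.
have mass r : s < r -> \int[area]_(p in S) weight r (sqdist x0 y0 p.1 p.2) = weight_mass x0 y0 rho.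
  have e1 k : \int[area]_(p in S) (1 * weight k (sqdist x0 y0 p.1 p.2)) =
      \int[area]_(p in S) weight k (sqdist x0 y0 p.1 p.2).
    by apply: eq_Rintegral => p _; rewrite mul1r.
  move=> sr; rewrite /weight_mass -/s -/S -(e1 r) -(e1 s).
  apply: (@radial_weight_indep R (fun _ _ => 1) (fun _ _ => 0) x0 y0 rho r s rho0 erefl sr).
    move=> x y _; exists 0, 0; rewrite oppr0; split.
      by apply: expands_eq (expands_linear x y 0 0 1) => // p q; rewrite !mul0r !add0r.
    by apply: expands_eq (expands_linear x y 0 0 0) => // p q; rewrite !mul0r !add0r.
  move=> a c l; have [l0|l0] := leP 0 l.
    apply: measurable_bounded_integrable; [exact: measurable_square| |exact: measurable_cst|].
      by rewrite area_square// ltry.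
    by exists 1; split; [exact: num_real|move=> M kM z _; rewrite normr1 ltW].
  have -> : square a c l = set0.
    rewrite /square (_ : `]a, a + l]%classic = set0) ?set0X//.
    by apply: set_itv_ge; rewrite -leNgt bnd_simp; lra.
  exact: integrable_set0.
set A := \int[_]_(_ in _) _.
have key e : 0 < e -> `|A - u x0 y0 * weight_mass x0 y0 rho| <= e * weight_mass x0 y0 rho.
  move=> e0; have [|a [b [eu _]]] := an x0 y0; first by rewrite /sqdist !subrr expr0n addr0 sqr_ge0.
  have [d d0 hd] := expands_cont eu e0.
  (* From [d ^- 2] on, the weight is supported within distance [d] of the centre, where [u] varies
     by at most [e]. *)
  pose r := Num.max (s + 1) (d ^- 2).
  have sr : s < r by rewrite lt_max ltrDl ltr01.
  have r0 := lt_trans s0 sr.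
  have -> : A = \int[area]_(p in S) (u p.1 p.2 * weight r (sqdist x0 y0 p.1 p.2)).
    by rewrite (radial_weight_indep rho0 erefl sr an iu).
  have iw := integrable_weight x0 y0 (x0 - rho) (y0 - rho) r0 rr0.
  have iuw := integrable_mul_weight x0 y0 r0 (iu (x0 - rho) (y0 - rho) (rho + rho)).
  rewrite -(mass r sr) -!RintegralZl// -RintegralB//; last first.
    have := integrableZl mS (u x0 y0) iw.
    by apply: eq_integrable.
  have iZ k : area.-integrable S (EFin \o (fun p => k * weight r (sqdist x0 y0 p.1 p.2))).
    by have := integrableZl mS k iw; apply: eq_integrable.
  have iB := integrable_EFinB mS iuw (iZ (u x0 y0)).
  apply: (le_trans (le_normr_Rintegral mS iB)).
  apply: le_Rintegral => //; first exact: (integrable_norm iB).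
  move=> z _; rewrite -mulrBl normrM (ger0_norm (weight_ge0 _ r0)).
  have [h|h] := leP 1 (r * sqdist x0 y0 z.1 z.2); first by rewrite weight_eq0// !mulr0.
  apply: ler_wpM2r; first exact: weight_ge0.
  have h2 : sqdist x0 y0 z.1 z.2 < d ^+ 2.
    apply: (@lt_le_trans _ _ r^-1).
      by rewrite -(ltr_pM2l r0) mulfV ?gt_eqF.
    by rewrite -[leRHS]invrK lef_pV2 ?posrE ?invr_gt0 ?exprn_gt0// le_max lexx orbT.
  by have [h3 h4] := sqdist_lt h2 d0; apply: hd; exact: ltW.
have M0 : 0 <= weight_mass x0 y0 rho by apply: Rintegral_ge0 => p _; exact: weight_ge0.
apply/eqP; rewrite -subr_eq0 -normr_eq0; apply/eqP/le_anti; rewrite normr_ge0 andbT.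
apply/ler_addgt0Pl => e e0; rewrite addr0.
have k0 : 0 < weight_mass x0 y0 rho + 1 by rewrite ltr_wpDl.
apply: (le_trans (key _ (divr_gt0 e0 k0))).
by rewrite mulrAC -mulrA ler_piMr ?(ltW e0)// ler_pdivrMr// mul1r lerDl.
Qed.

(** On the concentric square of side [rho] the weight is at least [rho ^- 2], the inverse of the
    area of that square. *)
Lemma weight_mass_ge1 x0 y0 rho : 0 < rho -> 1 <= weight_mass x0 y0 rho.
Proof.
move=> rho0; set s := rho ^- 2.
have s0 : 0 < s by rewrite /s invr_gt0 exprn_gt0.
set S := square (x0 - rho) (y0 - rho) (rho + rho).
set Q := square (x0 - rho / 2) (y0 - rho / 2) rho.
have QS : Q `<=` S by move=> z [/=]; rewrite !in_itv/= => h1 h2; split; rewrite /= in_itv/=; lra.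
have r0 := ltW rho0; have rr0 : 0 <= rho + rho by rewrite addr_ge0.
have sE : s * rho ^+ 2 = 1 by rewrite /s mulVf// gt_eqF// exprn_gt0.
rewrite -lee_fin /weight_mass -/s -/S /Rintegral fineK; last first.
  by apply: integrable_fin_num; [exact: measurable_square|exact: integrable_weight].
apply: (@le_trans _ _ (\int[area]_(p in Q) (weight s (sqdist x0 y0 p.1 p.2))%:E)%E); last first.
  apply: ge0_subset_integral => //; [exact: measurable_square|exact: measurable_square| |].
    apply/measurable_EFinP; apply: (@measurable_funS _ _ _ _ setT) => //; exact: measurable_weight.
  by move=> z _; rewrite lee_fin weight_ge0.
apply: (@le_trans _ _ (\int[area]_(p in Q) s%:E)%E).
  by rewrite integral_cst/= ?area_square -?EFinM ?sE//; exact: measurable_square.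
apply: ge0_le_integral => //.
- exact: measurable_square.
- by move=> z _; rewrite lee_fin ltW.
- apply/measurable_EFinP; apply: (@measurable_funS _ _ _ _ setT) => //; exact: measurable_weight.
move=> z [/=]; rewrite !in_itv/= lee_fin => h1 h2.
have h3 : 2 * (s * sqdist x0 y0 z.1 z.2) <= 1.
  have K X : - (rho / 2) <= X -> X <= rho / 2 -> X ^+ 2 <= (rho / 2) ^+ 2 by nra.
  have k1 : (z.1 - x0) ^+ 2 <= (rho / 2) ^+ 2 by apply: K; lra.
  have k2 : (z.2 - y0) ^+ 2 <= (rho / 2) ^+ 2 by apply: K; lra.
  apply: (@le_trans _ _ (s * rho ^+ 2)); last by rewrite sE.
  by rewrite mulrCA ler_pM2l// /sqdist; lra.
rewrite /weight max_r; last lra.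
by rewrite -[leLHS]mulr1 [2 * s]mulrC -mulrA ler_pM2l//; lra.
Qed.

End MeanValue.

(** * Value and Lipschitz bounds from local integrals *)

Lemma dist_add_le {R : realType} (x0 a p r s : R) : `|a - x0| <= r -> `|p - a| <= s ->
  `|p - x0| <= r + s.
Proof.
by move=> h1 h2; rewrite -(subrKA a) [r + s]addrC; exact: le_trans (ler_normD _ _) (lerD h2 h1).
Qed.

Lemma sum_dist_le {R : realType} (x0 rho x x' z : R) : `|x - x0| <= rho -> `|x' - x0| <= rho ->
  x0 - 2 * rho < z -> z <= x0 - 2 * rho + 4%:R * rho -> `|(z - x) + (z - x')| <= 6%:R * rho.
Proof. by rewrite !ler_norml => /andP[? ?] /andP[? ?] ? ?; apply/andP; split; lra. Qed.

Section PointBounds.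
Context {R : realType}.
Local Notation plane := (measurableTypeR R * measurableTypeR R)%type.
Implicit Types (x y a b c e t r s : R) (P Q : R -> R -> R).

Lemma value_bound (u w : R -> R -> R) x0 y0 rho : 0 < rho ->
  (forall x y, sqdist x0 y0 x y <= rho ^+ 2 -> conj_expands u w x y) ->
  (forall a c l, area.-integrable (square a c l) (EFin \o (fun p => u p.1 p.2))) ->
  `|u x0 y0| <= 2 * rho ^- 2 *
     \int[area]_(p in square (x0 - rho) (y0 - rho) (rho + rho)) `|u p.1 p.2|.
Proof.
move=> rho0 an iu; have s0 : 0 < rho ^- 2 by rewrite invr_gt0 exprn_gt0.
have M1 := weight_mass_ge1 x0 y0 rho0; have M0 := le_trans ler01 M1.
apply: (@le_trans _ _ `|u x0 y0 * weight_mass x0 y0 rho|).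
  by rewrite normrM (ger0_norm M0) ler_peMr.
rewrite -(radial_mean rho0 an iu).
have iuw := integrable_mul_weight x0 y0 s0 (iu (x0 - rho) (y0 - rho) (rho + rho)).
have mS := measurable_square (x0 - rho) (y0 - rho) (rho + rho).
have in1 := integrable_norm (iu (x0 - rho) (y0 - rho) (rho + rho)).
apply: (le_trans (le_normr_Rintegral mS iuw)).
rewrite -RintegralZl//; apply: le_Rintegral => //; first exact: (integrable_norm iuw).
  by have := integrableZl mS (2 * rho ^- 2) in1; apply: eq_integrable.
move=> z _; rewrite normrM mulrC ler_wpM2r// ger0_norm ?weight_ge0//.
by apply: weight_le => //; exact: sqdist_ge0.
Qed.

Lemma le_Rintegral_subset (A B : set plane) (h : plane -> R) :
  measurable A -> measurable B -> A `<=` B -> area.-integrable B (EFin \o h) ->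
  (forall z, B z -> 0 <= h z) ->
  \int[area]_(p in A) h p <= \int[area]_(p in B) h p.
Proof.
move=> mA mB AB ih h0; rewrite /Rintegral fine_le//.
- by apply: integrable_fin_num => //; exact: integrableS ih.
- exact: integrable_fin_num.
- apply: ge0_subset_integral => //; first by case/integrableP : ih.
Qed.

(** Both values are radial means that can be taken over the same square [S], and the weight is
    Lipschitz in its centre. The masses at the two centres are compared in the same way, which
    accounts for 396 = 12 + 2 * 12 * 16. *)
Lemma value_lip (u w : R -> R -> R) x0 y0 rho x y x' y' : 0 < rho ->
  (forall x y, `|x - x0| <= 2 * rho -> `|y - y0| <= 2 * rho -> conj_expands u w x y) ->
  (forall a c l, area.-integrable (square a c l) (EFin \o (fun p => u p.1 p.2))) ->
  `|x - x0| <= rho -> `|y - y0| <= rho -> `|x' - x0| <= rho -> `|y' - y0| <= rho ->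
  `|u x y - u x' y'| <= 396%:R * rho ^- 3 * (`|x - x'| + `|y - y'|) *
     \int[area]_(p in square (x0 - 2 * rho) (y0 - 2 * rho) (4%:R * rho)) `|u p.1 p.2|.
Proof.
move=> rho0 an iu xx yy xx' yy'; set S := square _ _ _.
set D := `|x - x'| + _; have D0 : 0 <= D by rewrite addr_ge0.
have s0 : 0 < rho ^- 2 by rewrite invr_gt0 exprn_gt0.
have r0 := ltW rho0.
have mS : measurable S by exact: measurable_square.
have l0 : 0 <= 4%:R * rho by rewrite mulr_ge0.
have QS a b : `|a - x0| <= rho -> `|b - y0| <= rho ->
    square (a - rho) (b - rho) (rho + rho) `<=` S.
  rewrite !ler_norml => ha hb z [/=]; rewrite !in_itv/= => h1 h2.
  by split; rewrite /= in_itv/=; lra.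
have an' a b : `|a - x0| <= rho -> `|b - y0| <= rho ->
    forall p q, sqdist a b p q <= rho ^+ 2 -> conj_expands u w p q.
  move=> ha hb p q; rewrite /sqdist => h.
  have K c : c ^+ 2 <= rho ^+ 2 -> `|c| <= rho.
    by rewrite -(real_normK (num_real c)) ler_pXn2r// nnegrE.
  have h1 : `|p - a| <= rho by apply: K; apply: le_trans h; rewrite lerDl sqr_ge0.
  have h2 : `|q - b| <= rho by apply: K; apply: le_trans h; rewrite lerDr sqr_ge0.
  by apply: an; rewrite mulr_natl mulr2n; [exact: dist_add_le ha h1|exact: dist_add_le hb h2].
set I := \int[area]_(p in S) `|u p.1 p.2|.
have in1 : area.-integrable S (EFin \o (fun p => `|u p.1 p.2|)) := integrable_norm (iu _ _ _).
have I0 : 0 <= I by apply: Rintegral_ge0.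
have val a b : `|a - x0| <= rho -> `|b - y0| <= rho -> `|u a b| <= 2 * rho ^- 2 * I.
  move=> ha hb; apply: (le_trans (value_bound rho0 (an' _ _ ha hb) iu)).
  rewrite ler_pM2l ?mulr_gt0//; apply: le_Rintegral_subset => //; last exact: QS.
  exact: measurable_square.
pose M a b := \int[area]_(p in S) weight (rho ^- 2) (sqdist a b p.1 p.2).
have ME a b : `|a - x0| <= rho -> `|b - y0| <= rho -> M a b = weight_mass a b rho.
  move=> ha hb; apply: Rintegral_support; first exact: QS.
  by move=> z _; exact: weight_support.
pose A a b := \int[area]_(p in S) (u p.1 p.2 * weight (rho ^- 2) (sqdist a b p.1 p.2)).
have AE a b : `|a - x0| <= rho -> `|b - y0| <= rho -> A a b = u a b * M a b.
  move=> ha hb; rewrite ME// -(radial_mean rho0 (an' _ _ ha hb) iu).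
  apply: Rintegral_support; first exact: QS.
  by move=> z _ h; rewrite weight_support ?mulr0.
have lip z : S z -> `|weight (rho ^- 2) (sqdist x y z.1 z.2) -
    weight (rho ^- 2) (sqdist x' y' z.1 z.2)| <= 12%:R * rho ^- 3 * D.
  move=> [/=]; rewrite !in_itv/= => h1 h2; apply: (le_trans (weight_lip _ _ s0)).
  have -> : 12%:R * rho ^- 3 * D = 2 * (rho ^- 2) ^+ 2 * (6%:R * rho * D).
    by field; rewrite gt_eqF.
  apply: ler_wpM2l; first by rewrite mulr_ge0// sqr_ge0.
  have -> : sqdist x y z.1 z.2 - sqdist x' y' z.1 z.2 =
     - ((x - x') * ((z.1 - x) + (z.1 - x')) + (y - y') * ((z.2 - y) + (z.2 - y'))).
    by rewrite /sqdist; ring.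
  rewrite normrN; apply: (le_trans (ler_normD _ _)); rewrite !normrM /D mulrDr.
  case/andP: h1 => h1 h1'; case/andP: h2 => h2 h2'.
  apply: lerD; rewrite mulrC; apply: ler_wpM2r => //.
    exact: sum_dist_le xx xx' h1 h1'.
  exact: sum_dist_le yy yy' h2 h2'.
have iuw a b : area.-integrable S _ := integrable_mul_weight a b s0 (iu _ _ _).
have iw a b : area.-integrable S _ := integrable_weight a b _ _ s0 l0.
have dA : `|A x y - A x' y'| <= 12%:R * rho ^- 3 * D * I.
  have iB := integrable_EFinB mS (iuw x y) (iuw x' y').
  rewrite /A -RintegralB//; apply: (le_trans (le_normr_Rintegral mS iB)).
  rewrite /I -RintegralZl//; apply: le_Rintegral => //; first exact: (integrable_norm iB).
    by have := integrableZl mS (12%:R * rho ^- 3 * D) in1; apply: eq_integrable.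
  by move=> z Sz; rewrite -mulrBr normrM mulrC ler_wpM2r//; exact: lip.
have dM : `|M x y - M x' y'| <= 12%:R * rho ^- 3 * D * (16%:R * rho ^+ 2).
  have iB := integrable_EFinB mS (iw x y) (iw x' y').
  rewrite /M -RintegralB//.
  have := @Rintegral_near_cst R _ _ area S _ 0 (12%:R * rho ^- 3 * D) (16%:R * rho ^+ 2) mS _ iB.
  rewrite mul0r subr0; apply; first by rewrite area_square//; congr EFin; ring.
  by move=> z Sz; rewrite subr0; exact: lip.
have M1 : 1 <= M x y by rewrite ME//; exact: weight_mass_ge1.
apply: (@le_trans _ _ (`|u x y - u x' y'| * M x y)).
  by rewrite ler_peMr.
have M0 := le_trans ler01 M1.
rewrite -{1}(ger0_norm M0) -normrM.
have -> : (u x y - u x' y') * M x y = (A x y - A x' y') - u x' y' * (M x y - M x' y').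
  by rewrite !AE//; ring.
apply: (le_trans (ler_normB _ _)); rewrite normrM.
apply: (le_trans (lerD dA (ler_pM (normr_ge0 _) (normr_ge0 _) (val _ _ xx' yy') dM))).
apply: le_of_eq; field.
by rewrite gt_eqF.
Qed.

End PointBounds.

(** * Complex derivability in real coordinates *)

Section ComplexLayer.
Context {R : realType}.
Local Notation plane := (measurableTypeR R * measurableTypeR R)%type.
Local Notation C := (Cplx R).
Implicit Types (x y e s : R) (z k a : C) (f : C -> C).

Definition repart f x y : R := complex.Re (f (to_cplx (x, y))).
Definition impart f x y : R := complex.Im (f (to_cplx (x, y))).

Lemma cmodulusN z : cmodulus (- z) = cmodulus z.
Proof. by rewrite /cmodulus normrN. Qed.

Lemma cmodulusB z z' : cmodulus (z - z') = cmodulus (z' - z).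
Proof. by rewrite -cmodulusN opprB. Qed.

Lemma cmodulusR (r : R) : cmodulus (r%:C : C) = `|r|.
Proof. by rewrite cmodulusE /= expr0n addr0 sqrtr_sqr. Qed.

Lemma cmodulus_conj z : cmodulus (z^* : C) = cmodulus z.
Proof. by rewrite !cmodulusE; case: z => a b /=; rewrite sqrrN. Qed.

Lemma normRe_le z : `|complex.Re z| <= cmodulus z.
Proof.
by rewrite cmodulusE -sqrtr_sqr ler_wsqrtr// lerDl sqr_ge0.
Qed.

Lemma normIm_le z : `|complex.Im z| <= cmodulus z.
Proof.
by rewrite cmodulusE -sqrtr_sqr ler_wsqrtr// lerDr sqr_ge0.
Qed.

Lemma cmodulus_le z : cmodulus z <= `|complex.Re z| + `|complex.Im z|.
Proof.
rewrite cmodulusE -ler_sqr ?nnegrE ?sqrtr_ge0 ?addr_ge0//.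
rewrite sqr_sqrtr ?addr_ge0 ?sqr_ge0// sqrrD !real_normK ?num_real//.
by rewrite lerD2r lerDl mulrn_wge0// mulr_ge0.
Qed.

Lemma cmodulusV z : cmodulus (z^-1 : C) = (cmodulus z)^-1.
Proof.
have [->|z0] := eqVneq z 0; first by rewrite invr0 cmodulus0 invr0.
have m0 : cmodulus z != 0 by apply: contra z0 => /eqP/cmodulus_eq0/eqP.
by apply: (mulIf m0); rewrite -cmodulusM !mulVf// cmodulusR normr1.
Qed.

Lemma cmodulus_ltE z e : (cmodulus z < e) = (`|z| < e%:C).
Proof. by rewrite cnormE ltcR. Qed.

Lemma cmodulus_leE z e : (cmodulus z <= e) = (`|z| <= e%:C).
Proof. by rewrite cnormE lecR. Qed.

(** Norms and radii take values in [R[i]], where positive elements are real; this translation into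
    real moduli serves all later estimates. *)
Lemma derivable_expand f z : derivable f z 1 -> exists a : C,
  forall e : R, 0 < e -> exists2 d : R, 0 < d & forall k : C, cmodulus k <= d ->
    cmodulus (f (z + k) - f z - a * k) <= e * cmodulus k.
Proof.
move=> /cvg_ex[/= a ha]; exists a => e e0.
have eC : 0 < (e%:C : R[i]) by rewrite ltcR.
have /cvgrPdist_le /(_ _ eC) := ha.
rewrite near_withinE => /nbhs_ballP[r r0 hr].
have rE : r = (complex.Re r)%:C.
  by move: r0; rewrite /= ltcE/= => /andP[/eqP ie _]; case: (r) ie => p q /= ->.
have r0' : 0 < complex.Re r by move: r0; rewrite /= rE ltcR.
exists (complex.Re r / 2); first by rewrite divr_gt0.
move=> k kd; have [->|k0] := eqVneq k 0.
  by rewrite addr0 subrr mulr0 subr0 cmodulus0 mulr0.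
have := hr k; rewrite -ball_normE/= sub0r normrN rE -cmodulus_ltE.
have kr : cmodulus k < complex.Re r.
  by apply: (le_lt_trans kd); rewrite gtr_pMr// invf_lt1// ltr1n.
move=> /(_ kr k0); rewrite -cmodulus_leE.
have -> : a - k^-1 *: (f (k *: 1 + z) - f z) = - (k^-1 * (f (z + k) - f z - a * k)).
  rewrite [k *: 1]mulr1 [k + z]addrC /GRing.scale/=.
  rewrite (mulrBr k^-1 (f (z + k) - f z)) (_ : k^-1 * (a * k) = a) ?opprB//.
  by rewrite mulrC mulfK.
rewrite cmodulusN cmodulusM cmodulusV mulrC ler_pdivrMr//.
rewrite lt_neqAle cmodulus_ge0 andbT eq_sym.
by apply: contra k0 => /eqP/cmodulus_eq0/eqP.
Qed.

Lemma expand_derivable f z a :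
  (forall e : R, 0 < e -> exists2 d : R, 0 < d & forall k : C, cmodulus k <= d ->
    cmodulus (f (z + k) - f z - a * k) <= e * cmodulus k) -> derivable f z 1.
Proof.
move=> h; apply/cvg_ex; exists a; apply/cvgrPdist_le => eC eC0.
have eE : eC = (complex.Re eC)%:C.
  by move: eC0; rewrite /= ltcE/= => /andP[/eqP ie _]; case: (eC) ie => p q /= ->.
have e0 : 0 < complex.Re eC by move: eC0; rewrite /= eE ltcR.
have [d d0 hd] := h _ e0; rewrite near_withinE; apply/nbhs_ballP.
exists (d%:C); first by rewrite /= ltcR.
move=> k; rewrite -ball_normE/= sub0r normrN -cmodulus_ltE => kd k0.
rewrite eE -cmodulus_leE.
have -> : a - k^-1 *: (f (k *: 1 + z) - f z) = - (k^-1 * (f (z + k) - f z - a * k)).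
  rewrite [k *: 1]mulr1 [k + z]addrC /GRing.scale/=.
  rewrite (mulrBr k^-1 (f (z + k) - f z)) (_ : k^-1 * (a * k) = a) ?opprB//.
  by rewrite mulrC mulfK.
rewrite cmodulusN cmodulusM cmodulusV mulrC ler_pdivrMr; first by apply: hd; exact: ltW.
rewrite lt_neqAle cmodulus_ge0 andbT eq_sym.
by apply: contra k0 => /eqP/cmodulus_eq0/eqP.
Qed.

Lemma derivable_conj_expands f x y : derivable f (to_cplx (x, y)) 1 ->
  conj_expands (repart f) (impart f) x y.
Proof.
move=> /derivable_expand[[a b] h]; exists a, b.
have K e : 0 < e -> exists2 d : R, 0 < d & forall x' y', `|x' - x| <= d -> `|y' - y| <= d ->
    cmodulus (f (to_cplx (x', y')) - f (to_cplx (x, y)) -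
      (a +i* b) * ((x' - x) +i* (y' - y))) <= e * (`|x' - x| + `|y' - y|).
  move=> e0; have [d d0 hd] := h _ e0; exists (d / 2); first by rewrite divr_gt0.
  move=> x' y' hx hy; have kl : cmodulus ((x' - x) +i* (y' - y)) <= `|x' - x| + `|y' - y|.
    exact: cmodulus_le.
  have := hd ((x' - x) +i* (y' - y)); have -> : to_cplx (x, y) + ((x' - x) +i* (y' - y)) = to_cplx (x', y').
    rewrite [LHS](_ : _ = (x + (x' - x)) +i* (y + (y' - y)))//.
    by rewrite ![_ + (_ - _)]addrC !subrK.
  move=> hd'; apply: (le_trans (hd' _)); last by rewrite ler_pM2l.
  by apply: (le_trans kl); rewrite (splitr d) lerD.
split=> e e0; have [d d0 hd] := K e e0; exists d => // x' y' hx hy;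
  apply: le_trans (hd x' y' hx hy).
- apply: le_trans (normRe_le _); apply: le_of_eq; congr `|_|.
  rewrite /repart; case: (f _) => p q; case: (f _) => p' q' /=; ring.
- apply: le_trans (normIm_le _); apply: le_of_eq; congr `|_|.
  rewrite /impart; case: (f _) => p q; case: (f _) => p' q' /=; ring.
Qed.

(** Multiplication by -i: w - i u = -i (u + i w) is analytic too, so bounds on real parts transfer
    to imaginary parts. *)
Lemma conj_expands_swap (u w : R -> R -> R) x y : conj_expands u w x y ->
  conj_expands w (fun x y => - u x y) x y.
Proof.
move=> [a [b [hu hw]]]; exists b, (- a); rewrite opprK; split => //.
by apply: expands_eq (expandsZ (-1) hu) => [p q||]; rewrite ?mulN1r ?opprK.
Qed.

End ComplexLayer.

Section ComplexBounds.
Context {R : realType}.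
Local Notation plane := (measurableTypeR R * measurableTypeR R)%type.
Local Notation C := (Cplx R).
Implicit Types (x y e s rho a c l : R) (z : C) (f : C -> C).

Definition square_integrable f := forall a c l : R,
  area.-integrable (square a c l) (EFin \o (fun p => repart f p.1 p.2)) /\
  area.-integrable (square a c l) (EFin \o (fun p => impart f p.1 p.2)).

Lemma measurable_cmodulus_fun (D : set plane) f :
  measurable_fun D (fun p => repart f p.1 p.2) ->
  measurable_fun D (fun p => impart f p.1 p.2) ->
  measurable_fun D (fun p => cmodulus (f (to_cplx p))).
Proof.
move=> mr mi.
have -> : (fun p => cmodulus (f (to_cplx p))) =
    @Num.sqrt R \o (fun p => repart f p.1 p.2 ^+ 2 + impart f p.1 p.2 ^+ 2).
  by apply/funext => p; rewrite cmodulusE.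
apply: measurableT_comp; last by apply: measurable_funD; apply: measurable_funX.
by apply: continuous_measurable_fun => ?; exact: sqrt_continuous.
Qed.

Lemma integrable_cmodulus f a c l : square_integrable f ->
  area.-integrable (square a c l) (EFin \o (fun p => cmodulus (f (to_cplx p)))).
Proof.
move=> /(_ a c l)[i1 i2]; have mS := measurable_square a c l.
apply: (le_integrable mS _ _ (integrableD mS (integrable_norm i1) (integrable_norm i2))).
  apply/measurable_EFinP; apply: measurable_cmodulus_fun.
    by apply/measurable_EFinP; case/integrableP : i1.
  by apply/measurable_EFinP; case/integrableP : i2.
move=> p _ /=; rewrite lee_fin ger0_norm ?cmodulus_ge0// ger0_norm ?addr_ge0//.
exact: cmodulus_le.
Qed.

Let le_part (h : R -> R -> R) f a c l : square_integrable f ->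
  area.-integrable (square a c l) (EFin \o (fun p => h p.1 p.2)) ->
  (forall p : plane, `|h p.1 p.2| <= cmodulus (f (to_cplx p))) ->
  \int[area]_(p in square a c l) `|h p.1 p.2| <=
  \int[area]_(p in square a c l) cmodulus (f (to_cplx p)).
Proof.
move=> fi hi hf; apply: le_Rintegral => //; first exact: measurable_square.
  exact: (integrable_norm hi).
exact: integrable_cmodulus.
Qed.

Let swap_int f : square_integrable f -> forall a c l,
  area.-integrable (square a c l) (EFin \o (fun p => impart f p.1 p.2)).
Proof. by move=> fi a c l; have [] := fi a c l. Qed.

Let id_int f : square_integrable f -> forall a c l,
  area.-integrable (square a c l) (EFin \o (fun p => repart f p.1 p.2)).
Proof. by move=> fi a c l; have [] := fi a c l. Qed.

Lemma cvalue_bound f x0 y0 rho : 0 < rho ->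
  (forall x y, sqdist x0 y0 x y <= rho ^+ 2 -> conj_expands (repart f) (impart f) x y) ->
  square_integrable f ->
  cmodulus (f (to_cplx (x0, y0))) <= 4%:R * rho ^- 2 *
     \int[area]_(p in square (x0 - rho) (y0 - rho) (rho + rho)) cmodulus (f (to_cplx p)).
Proof.
move=> rho0 an fi; have k0 : 0 <= 2 * rho ^- 2 by rewrite mulr_ge0// invr_ge0 exprn_ge0// ltW.
have an2 x y h := conj_expands_swap (an x y h).
have key (m r i q A B D : R) : m <= r + i -> B <= D -> A <= D -> i <= 2 * q * B ->
    r <= 2 * q * A -> 0 <= 2 * q -> m <= 4%:R * q * D.
  move=> h1 h2 h3 h4 h5 h6.
  by have := ler_wpM2l h6 h2; have := ler_wpM2l h6 h3; lra.
exact: (key _ _ _ _ _ _ _ (cmodulus_le _)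
  (le_part fi (swap_int fi (x0 - rho) (y0 - rho) (rho + rho)) (fun p => normIm_le _))
  (le_part fi (id_int fi (x0 - rho) (y0 - rho) (rho + rho)) (fun p => normRe_le _))
  (value_bound rho0 an2 (swap_int fi)) (value_bound rho0 an (id_int fi)) k0).
Qed.

Lemma cvalue_lip f x0 y0 rho x y x' y' : 0 < rho ->
  (forall x y, `|x - x0| <= 2 * rho -> `|y - y0| <= 2 * rho ->
     conj_expands (repart f) (impart f) x y) ->
  square_integrable f ->
  `|x - x0| <= rho -> `|y - y0| <= rho -> `|x' - x0| <= rho -> `|y' - y0| <= rho ->
  cmodulus (f (to_cplx (x, y)) - f (to_cplx (x', y'))) <=
  792%:R * rho ^- 3 * (`|x - x'| + `|y - y'|) *
     \int[area]_(p in square (x0 - 2 * rho) (y0 - 2 * rho) (4%:R * rho)) cmodulus (f (to_cplx p)).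
Proof.
move=> rho0 an fi xx yy xx' yy'.
set D := `|x - x'| + _; have D0 : 0 <= D by rewrite addr_ge0.
have k0 : 0 <= 396%:R * rho ^- 3 * D.
  have r3 : 0 <= rho ^- 3 by rewrite invr_ge0 exprn_ge0// ltW.
  exact: (mulr_ge0 (mulr_ge0 (ler0n R 396) r3) D0).
have an2 x y h h' := conj_expands_swap (an x y h h').
have key (m r i q A B E : R) : m <= r + i -> B <= E -> A <= E -> i <= 396%:R * q * D * B ->
    r <= 396%:R * q * D * A -> 0 <= 396%:R * q * D -> m <= 792%:R * q * D * E.
  move=> h1 h2 h3 h4 h5 h6.
  by have := ler_wpM2l h6 h2; have := ler_wpM2l h6 h3; lra.
have reE : complex.Re (f (to_cplx (x, y)) - f (to_cplx (x', y'))) = repart f x y - repart f x' y'.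
  by rewrite /repart; case: (f _) => ? ?; case: (f _) => ? ?.
have imE : complex.Im (f (to_cplx (x, y)) - f (to_cplx (x', y'))) = impart f x y - impart f x' y'.
  by rewrite /impart; case: (f _) => ? ?; case: (f _) => ? ?.
have := cmodulus_le (f (to_cplx (x, y)) - f (to_cplx (x', y'))); rewrite reE imE => h.
exact: (key _ _ _ _ _ _ _ h
  (le_part fi (swap_int fi (x0 - 2 * rho) (y0 - 2 * rho) (4%:R * rho)) (fun p => normIm_le _))
  (le_part fi (id_int fi (x0 - 2 * rho) (y0 - 2 * rho) (4%:R * rho)) (fun p => normRe_le _))
  (value_lip rho0 an2 (swap_int fi) xx yy xx' yy') (value_lip rho0 an (id_int fi) xx yy xx' yy') k0).
Qed.

(** Analyticity and boundedness are only local here, so [f] is cut off outside the closed square of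
    half side 3 rho. The result is integrable on every square, and still analytic on the square of
    half side 2 rho that [cvalue_lip] looks at. *)
Lemma bounded_lip f x0 y0 rho B x y x' y' : 0 < rho -> 0 <= B ->
  measurable_fun [set: plane] (fun p => repart f p.1 p.2) ->
  measurable_fun [set: plane] (fun p => impart f p.1 p.2) ->
  (forall x y, `|x - x0| <= 3%:R * rho -> `|y - y0| <= 3%:R * rho ->
     derivable f (to_cplx (x, y)) 1 /\ cmodulus (f (to_cplx (x, y))) <= B) ->
  `|x - x0| <= rho -> `|y - y0| <= rho -> `|x' - x0| <= rho -> `|y' - y0| <= rho ->
  cmodulus (f (to_cplx (x, y)) - f (to_cplx (x', y'))) <=
  12672%:R * B / rho * (`|x - x'| + `|y - y'|).
Proof.
move=> rho0 B0 mr mi an xx yy xx' yy'.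
have r0 := ltW rho0.
pose S : set plane := `[x0 - 3%:R * rho, x0 + 3%:R * rho] `*` `[y0 - 3%:R * rho, y0 + 3%:R * rho].
have mS : measurable S by apply: measurableX; exact: measurable_itv.
have SE p : S p <-> `|p.1 - x0| <= 3%:R * rho /\ `|p.2 - y0| <= 3%:R * rho.
  rewrite /S/= !in_itv/= !ler_norml; split=> -[/andP[? ?] /andP[? ?]]; split; lra.
pose g (z : C) : C := if (complex.Re z, complex.Im z) \in S then f z else 0.
have gE p : g (to_cplx p) = if p \in S then f (to_cplx p) else 0 by rewrite /g -surjective_pairing.
have rE : (fun p : plane => repart g p.1 p.2) = (fun p => repart f p.1 p.2 * \1_S p).
  by apply/funext => -[p q]; rewrite /repart gE indicE; case: ifP => _ /=; rewrite ?mulr1 ?mulr0.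
have iE : (fun p : plane => impart g p.1 p.2) = (fun p => impart f p.1 p.2 * \1_S p).
  by apply/funext => -[p q]; rewrite /impart gE indicE; case: ifP => _ /=; rewrite ?mulr1 ?mulr0.
have gB p : cmodulus (g (to_cplx p)) <= B.
  rewrite gE; case: ifPn => [|_]; last by rewrite cmodulus0.
  by rewrite inE => /SE[h1 h2]; have [_] := an p.1 p.2 h1 h2; rewrite -surjective_pairing.
have fin a c l : (area (square a c l) < +oo)%E.
  have [l0|l0] := leP 0 l; first by rewrite area_square// ltry.
  have -> : square a c l = set0; last by rewrite measure0 ltry.
  rewrite /square (_ : `]a, a + l]%classic = set0) ?set0X//.
  by apply: set_itv_ge; rewrite -leNgt bnd_simp; lra.
have gi : square_integrable g.
  move=> a c l; split; apply: measurable_bounded_integrable => //.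
  - exact: measurable_square.
  - by apply: (@measurable_funS _ _ _ _ setT) => //; rewrite rE; exact: measurable_funM.
  - exists B; split; [exact: num_real|move=> M kM z _].
    exact: le_trans (normRe_le _) (le_trans (gB z) (ltW kM)).
  - exact: measurable_square.
  - by apply: (@measurable_funS _ _ _ _ setT) => //; rewrite iE; exact: measurable_funM.
  - exists B; split; [exact: num_real|move=> M kM z _].
    exact: le_trans (normIm_le _) (le_trans (gB z) (ltW kM)).
have gan p q : `|p - x0| <= 2 * rho -> `|q - y0| <= 2 * rho ->
    conj_expands (repart g) (impart g) p q.
  move=> hp hq; have [||df _] := an p q; [lra|lra|].
  have [a [b [e1 e2]]] := derivable_conj_expands df; exists a, b.
  have loc p' q' : `|p' - p| <= rho -> `|q' - q| <= rho -> f (to_cplx (p', q')) = g (to_cplx (p', q')).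
    move=> hp' hq'; rewrite gE ifT// inE; apply/SE => /=.
    by split; [move: hp hp'|move: hq hq']; rewrite !ler_norml; lra.
  split; first by apply: (expands_local rho0) e1 => p' q' hp' hq'; rewrite /repart loc.
  by apply: (expands_local rho0) e2 => p' q' hp' hq'; rewrite /impart loc.
have gf p q : `|p - x0| <= rho -> `|q - y0| <= rho -> f (to_cplx (p, q)) = g (to_cplx (p, q)).
  by move=> hp hq; rewrite gE ifT// inE; apply/SE => /=; split; lra.
rewrite !gf//; apply: (le_trans (cvalue_lip rho0 gan gi xx yy xx' yy')).
set D := `|x - x'| + _; have D0 : 0 <= D by rewrite addr_ge0.
have -> : 12672%:R * B / rho * D = 792%:R * rho ^- 3 * D * (B * (16%:R * rho ^+ 2)).
  by field; rewrite gt_eqF.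
have k0 : 0 <= 792%:R * rho ^- 3 * D.
  have q0 : 0 <= rho ^- 3 by rewrite invr_ge0 exprn_ge0.
  exact: (mulr_ge0 (mulr_ge0 (ler0n R 792) q0) D0).
move: (792%:R * _ * D) k0 => k k0; apply: (ler_wpM2l k0).
set Q := square _ _ _.
have mQ : measurable Q by exact: measurable_square.
have aQ : area Q = (16%:R * rho ^+ 2)%:E.
  by rewrite area_square ?mulr_ge0//; congr EFin; ring.
have := @Rintegral_near_cst R _ _ area Q (fun p => cmodulus (g (to_cplx p))) 0 B (16%:R * rho ^+ 2) mQ aQ.
rewrite mul0r subr0 => h; apply: (le_trans (ler_norm _)); apply: h.
  exact: integrable_cmodulus.
by move=> z _; rewrite subr0 ger0_norm ?cmodulus_ge0.
Qed.

End ComplexBounds.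

(** * A uniform second-order Taylor bound *)

Section SecondOrder.
Context {R : realType}.
Local Notation plane := (measurableTypeR R * measurableTypeR R)%type.
Local Notation C := (Cplx R).
Implicit Types (x y e s rho : R) (z h : C) (f : C -> C).

Definition measurable_cplx f :=
  measurable_fun [set: plane] (fun p => repart f p.1 p.2) /\
  measurable_fun [set: plane] (fun p => impart f p.1 p.2).

Lemma measurable_cplx_shift f h : measurable_cplx f -> measurable_cplx (fun z => f (z + h)).
Proof.
move=> [mr mi].
have ms : measurable_fun [set: plane] (fun p : plane => (p.1 + complex.Re h, p.2 + complex.Im h) : plane).
  apply/measurable_fun_pair => /=; apply: measurable_funD => //.
have E p : to_cplx p + h = to_cplx (p.1 + complex.Re h, p.2 + complex.Im h).
  by case: h {ms} => a b.
split.
- rewrite (_ : (fun p => _) = (fun p : plane => repart f p.1 p.2) \o (fun p : plane => (p.1 + complex.Re h, p.2 + complex.Im h))).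
    exact: measurableT_comp mr ms.
  by apply/funext => -[p q]; rewrite /repart E.
- rewrite (_ : (fun p => _) = (fun p : plane => impart f p.1 p.2) \o (fun p : plane => (p.1 + complex.Re h, p.2 + complex.Im h))).
    exact: measurableT_comp mi ms.
  by apply/funext => -[p q]; rewrite /impart E.
Qed.

Lemma measurable_cplxB f g : measurable_cplx f -> measurable_cplx g ->
  measurable_cplx (fun z => f z - g z).
Proof.
move=> [mr mi] [mr' mi']; split.
- rewrite (_ : (fun p => _) = (fun p : plane => repart f p.1 p.2 - repart g p.1 p.2)).
    exact: measurable_funB.
  by apply/funext => p; rewrite /repart; case: (f _); case: (g _).
- rewrite (_ : (fun p => _) = (fun p : plane => impart f p.1 p.2 - impart g p.1 p.2)).
    exact: measurable_funB.
  by apply/funext => p; rewrite /impart; case: (f _); case: (g _).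
Qed.

Lemma measurable_cplxZ f h : measurable_cplx f -> measurable_cplx (fun z => f z * h).
Proof.
case: h => a b [mr mi]; split.
- rewrite (_ : (fun p => _) = (fun p : plane => repart f p.1 p.2 * a - impart f p.1 p.2 * b)).
    by apply: measurable_funB; apply: measurable_funM.
  by apply/funext => p; rewrite /repart /impart; case: (f _).
- rewrite (_ : (fun p => _) = (fun p : plane => repart f p.1 p.2 * b + impart f p.1 p.2 * a)).
    by apply: measurable_funD; apply: measurable_funM.
  by apply/funext => p; rewrite /repart /impart; case: (f _).
Qed.

Lemma derivable_shift f h z : derivable f (z + h) 1 -> derivable (fun w => f (w + h)) z 1.
Proof.
move=> /derivable_expand[a ha]; apply: (@expand_derivable R _ _ a) => e e0.
have [d d0 hd] := ha e e0; exists d => // k kd.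
by rewrite /= (addrAC z k h); exact: hd.
Qed.

Definition diff_quot f h z := (f (z + h) - f z) * h^-1.

Lemma to_cplxK z : to_cplx (complex.Re z, complex.Im z) = z.
Proof. by case: z. Qed.

Lemma bounded_clip : exists2 K : R, 0 <= K & forall f z0 rho B z z',
  0 < rho -> 0 <= B -> measurable_cplx f ->
  (forall z, `|complex.Re (z - z0)| <= 3%:R * rho -> `|complex.Im (z - z0)| <= 3%:R * rho ->
     derivable f z 1 /\ cmodulus (f z) <= B) ->
  cmodulus (z - z0) <= rho -> cmodulus (z' - z0) <= rho ->
  cmodulus (f z - f z') <= K * (B / rho) * cmodulus (z - z').
Proof.
exists 25344%:R; first exact: ler0n.
move=> f z0 rho B z z' rho0 B0 [mr mi] an hz hz'.
have an' x y : `|x - complex.Re z0| <= 3%:R * rho -> `|y - complex.Im z0| <= 3%:R * rho ->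
     derivable f (to_cplx (x, y)) 1 /\ cmodulus (f (to_cplx (x, y))) <= B.
  by move=> h1 h2; apply: an; case: z0 {hz hz'} h1 h2.
have ReB (u v : C) : complex.Re (u - v) = complex.Re u - complex.Re v by case: u; case: v.
have ImB (u v : C) : complex.Im (u - v) = complex.Im u - complex.Im v by case: u; case: v.
have A u : cmodulus (u - z0) <= rho ->
    `|complex.Re u - complex.Re z0| <= rho /\ `|complex.Im u - complex.Im z0| <= rho.
  move=> h; rewrite -ReB -ImB.
  by split; [exact: le_trans (normRe_le _) h|exact: le_trans (normIm_le _) h].
have [h1 h2] := A _ hz; have [h3 h4] := A _ hz'.
have := bounded_lip rho0 B0 mr mi an' h1 h2 h3 h4; rewrite !to_cplxK => /le_trans; apply.
rewrite -ReB -ImB.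
have -> : 25344%:R * (B / rho) * cmodulus (z - z') = 12672%:R * B / rho * (2 * cmodulus (z - z')).
  by field; rewrite gt_eqF.
have k0 : 0 <= 12672%:R * B / rho.
  exact: (divr_ge0 (mulr_ge0 (ler0n R 12672) B0) (ltW rho0)).
move: (12672%:R * B / rho) k0 => k k0; apply: (ler_wpM2l k0).
by have := normRe_le (z - z'); have := normIm_le (z - z'); lra.
Qed.

(** The remainder is uniform in [f], which is what lets derivatives pass to pointwise limits in
    [bergman_complete]. Difference quotients of [f] are analytic and, by the Lipschitz bound,
    bounded, hence Lipschitz themselves; comparing the quotients for k, k/2, k/4, ... gives a
    geometric series. *)
Lemma taylor2 : exists2 K : R, 0 <= K & forall f z0 rho B, 0 < rho -> 0 <= B -> measurable_cplx f ->
  (forall z, `|complex.Re (z - z0)| <= 6%:R * rho -> `|complex.Im (z - z0)| <= 6%:R * rho ->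
     derivable f z 1 /\ cmodulus (f z) <= B) ->
  exists a : C, forall k : C, cmodulus k <= rho ->
    cmodulus (f (z0 + k) - f z0 - a * k) <= K ^+ 2 * B / rho ^+ 2 * cmodulus k ^+ 2.
Proof.
have [K K0 bounded_clip] := bounded_clip; exists K => // f z0 rho B rho0 B0 mf an.
have r0 := ltW rho0.
have [df _] := an z0 ltac:(by rewrite subrr /= normr0 mulr_ge0) ltac:(by rewrite subrr /= normr0 mulr_ge0).
have [a ha] := derivable_expand df; exists a => k kr.
have [->|k0] := eqVneq k 0.
  by rewrite addr0 subrr mulr0 subr0 cmodulus0 expr0n mulr0.
have s3 : 3%:R * rho <= 6%:R * rho by rewrite ler_pM2r// ler_nat.
have s6 : 3%:R * rho + 3%:R * rho <= 6%:R * rho by rewrite -mulrDl -natrD.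
have s4 : 3%:R * rho + rho <= 6%:R * rho.
  rewrite (_ : _ + rho = 4%:R * rho); last by ring.
  by rewrite ler_pM2r// ler_nat.
have ck0 (h : C) : h != 0 -> 0 < cmodulus h.
  move=> h0; rewrite lt_neqAle cmodulus_ge0 andbT eq_sym.
  by apply: contra h0 => /eqP/cmodulus_eq0/eqP.
have shiftB (z w : C) r : `|complex.Re (z - z0)| <= 3%:R * rho -> `|complex.Im (z - z0)| <= 3%:R * rho ->
    `|complex.Re (w - z)| <= r -> `|complex.Im (w - z)| <= r ->
    `|complex.Re (w - z0)| <= 3%:R * rho + r /\ `|complex.Im (w - z0)| <= 3%:R * rho + r.
  move=> h1 h2 h3 h4; have -> : w - z0 = (w - z) + (z - z0) by rewrite subrKA.
  move: h1 h2 h3 h4; case: (w - z) => a1 b1; case: (z - z0) => a2 b2 /=.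
  by rewrite !ler_norml; split; lra.
have lip z h : `|complex.Re (z - z0)| <= 3%:R * rho -> `|complex.Im (z - z0)| <= 3%:R * rho ->
    cmodulus h <= rho -> cmodulus (f (z + h) - f z) <= K * (B / rho) * cmodulus h.
  move=> h1 h2 hr; have hE : (z + h) - z = h by rewrite addrC addKr.
  have an' w : `|complex.Re (w - z)| <= 3%:R * rho -> `|complex.Im (w - z)| <= 3%:R * rho ->
      derivable f w 1 /\ cmodulus (f w) <= B.
    by move=> h3 h4; have [h5 h6] := shiftB _ _ _ h1 h2 h3 h4; exact: an (le_trans h5 s6) (le_trans h6 s6).
  have zr : cmodulus (z - z) <= rho by rewrite subrr cmodulus0.
  have hr' : cmodulus (z + h - z) <= rho by rewrite hE.
  by have := bounded_clip f z rho B (z + h) z rho0 B0 mf an' hr' zr; rewrite hE.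
pose g := diff_quot f.
have glip h z : h != 0 -> cmodulus h <= rho -> cmodulus (z - z0) <= rho ->
    cmodulus (g h z0 - g h z) <= K ^+ 2 * B / rho ^+ 2 * cmodulus (z0 - z).
  move=> h0 hr hz.
  have -> : K ^+ 2 * B / rho ^+ 2 = K * ((K * (B / rho)) / rho).
    by field; rewrite gt_eqF.
  have B1 : 0 <= K * (B / rho) by rewrite mulr_ge0// divr_ge0.
  have mg : measurable_cplx (g h).
    by apply: measurable_cplxZ; apply: measurable_cplxB => //; exact: measurable_cplx_shift.
  have zr : cmodulus (z0 - z0) <= rho by rewrite subrr cmodulus0.
  apply: (bounded_clip (g h) z0 rho _ z0 z rho0 B1 mg _ zr hz) => w h1 h2; split.
    have hE : (w + h) - w = h by rewrite addrC addKr.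
    have hR : `|complex.Re ((w + h) - w)| <= rho.
      by rewrite hE; exact: le_trans (normRe_le _) hr.
    have hI : `|complex.Im ((w + h) - w)| <= rho.
      by rewrite hE; exact: le_trans (normIm_le _) hr.
    have [h5 h6] := shiftB _ _ _ h1 h2 hR hI.
    have [dh _] := an (w + h) (le_trans h5 s4) (le_trans h6 s4).
    have [dw _] := an w (le_trans h1 s3) (le_trans h2 s3).
    have dB : derivable (fun z => f (z + h) - f z) w 1.
      exact: (derivableB (derivable_shift dh) dw).
    have gE : g h = h^-1 *: (fun z : C => f (z + h) - f z).
      apply/funext => t.
      exact: (mulrC (f (t + h) - f t) h^-1).
    rewrite gE.
    exact/derivableZ/dB.
  rewrite /g /diff_quot cmodulusM cmodulusV ler_pdivrMr ?ck0//.
  exact: lip.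
set c := K ^+ 2 * B / rho ^+ 2 in glip *.
have c0 : 0 <= c by rewrite /c divr_ge0 ?exprn_ge0// mulr_ge0// exprn_ge0// K0.
pose kn n : C := k * ((2 ^- n : R)%:C).
have kn0 n : kn n != 0.
  by rewrite mulf_neq0// eq_complex /= negb_and invr_neq0// expf_neq0// pnatr_eq0.
have ckn n : cmodulus (kn n) = cmodulus k * 2 ^- n.
  by rewrite cmodulusM cmodulusR ger0_norm// invr_ge0 exprn_ge0.
have knr n : cmodulus (kn n) <= rho.
  rewrite ckn; apply: le_trans kr; rewrite ler_piMr ?cmodulus_ge0//.
  by rewrite invf_le1 ?exprn_gt0// exprn_ege1// ler1n.
have knS n : kn n = kn n.+1 + kn n.+1.
  rewrite /kn -mulrDr -rmorphD; congr (_ * _%:C).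
  by rewrite exprS invfM [2^-1 * _]mulrC -splitr.
(* The quotient for h minus the quotient for h/2 is half the difference of the quotients for h/2
   based at z0 + h/2 and at z0. *)
have stp n : cmodulus (g (kn n) z0 - g (kn n.+1) z0) <= c * cmodulus k * 2 ^- n.+2.
  have -> : g (kn n) z0 - g (kn n.+1) z0 =
     (g (kn n.+1) (z0 + kn n.+1) - g (kn n.+1) z0) * ((2^-1 : R)%:C).
    rewrite /g /diff_quot (knS n) addrA.
    have -> : (2^-1 : R)%:C = (2 : C)^-1 by rewrite fmorphV rmorph_nat.
    move: (kn n.+1) (kn0 n.+1) => h h0; field.
    by rewrite h0 -mulr2n mulrn_eq0.
  rewrite cmodulusM cmodulusR ger0_norm ?invr_ge0//.
  apply: (@le_trans _ _ (c * cmodulus (kn n.+1) * 2^-1)).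
    apply: ler_wpM2r; first by rewrite invr_ge0.
    rewrite cmodulusB -[in leRHS]cmodulusN (_ : - kn n.+1 = z0 - (z0 + kn n.+1)).
      by apply: glip => //; rewrite addrC addKr.
    by rewrite opprD addrA subrr add0r.
  by rewrite ckn (exprS _ n.+1) invfM; move: (2 ^- n.+1) => p; apply: le_of_eq; ring.
have sum n : cmodulus (g (kn 0%N) z0 - g (kn n) z0) <= c * cmodulus k * (2^-1 - 2 ^- n.+1).
  elim: n => [|n IH]; first by rewrite subrr cmodulus0 expr1 subrr mulr0.
  rewrite -(subrKA (g (kn n) z0)); apply: (le_trans (cmodulusD _ _)).
  apply: (le_trans (lerD IH (stp n))); rewrite -mulrDr.
  apply: le_of_eq; congr (_ * _).
  by rewrite [in RHS]exprS [in LHS](exprS _ n.+1) invfM; move: (2 ^- n.+1) => p; field.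
have lim e : 0 < e -> cmodulus (g (kn 0%N) z0 - a) <= c * cmodulus k + e.
  move=> e0; have [d d0 hd] := ha e e0.
  have [N hN] : exists m, cmodulus k * 2 ^- m <= d.
    exists (Num.truncn (cmodulus k / d)).+1; rewrite ler_pdivrMr ?exprn_gt0// mulrC -ler_pdivrMr//.
    apply: (le_trans (ltW (truncnS_gt _))); rewrite -natrX ler_nat ltnW//.
    exact: ltn_expl.
  rewrite -(subrKA (g (kn N) z0)); apply: (le_trans (cmodulusD _ _)).
  apply: lerD.
    apply: (le_trans (sum N)); apply: ler_piMr; first by rewrite mulr_ge0 ?cmodulus_ge0.
    have : 0 <= 2 ^- N.+1 :> R by rewrite invr_ge0 exprn_ge0.
    have : (2^-1 : R) <= 1 by rewrite invf_le1// ler1n.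
    lra.
  have -> : g (kn N) z0 - a = (f (z0 + kn N) - f z0 - a * kn N) / kn N.
    by rewrite /g /diff_quot [RHS]mulrBl mulfK.
  rewrite cmodulusM cmodulusV ler_pdivrMr ?ck0//; apply: hd.
  by rewrite ckn.
have kn00 : kn 0%N = k by rewrite /kn expr0 invr1 mulr1.
have -> : f (z0 + k) - f z0 - a * k = (g (kn 0%N) z0 - a) * k.
  by rewrite kn00 /g /diff_quot [RHS]mulrBl mulfVK.
rewrite cmodulusM expr2 mulrA; apply: ler_wpM2r; first exact: cmodulus_ge0.
by apply/ler_addgt0Pl => e e0; rewrite ?[in leRHS](addrC e); exact: lim.
Qed.

End SecondOrder.

(** * The Bergman space as a Hilbert space *)

Section L2Layer.
Context {R : realType}.
Local Notation plane := (measurableTypeR R * measurableTypeR R)%type.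
Local Notation C := (Cplx R).
Local Notation D := (@disc_coord R).
Implicit Types (r e : R) (z c : C) (f g h : C -> C) (E : set plane).

Definition dot z w : R := complex.Re z * complex.Re w + complex.Im z * complex.Im w.

Lemma dotC z w : dot z w = dot w z.
Proof. by rewrite /dot mulrC [X in _ + X]mulrC. Qed.

Lemma dotDl z z' w : dot (z + z') w = dot z w + dot z' w.
Proof. by case: z; case: z' => a b a' b'; rewrite /dot /=; ring. Qed.

Lemma dotBl z z' w : dot (z - z') w = dot z w - dot z' w.
Proof. by case: z; case: z' => a b a' b'; rewrite /dot /=; ring. Qed.

Lemma dotZl r z w : dot (r%:C * z) w = r * dot z w.
Proof. by case: z => a b; rewrite /dot /=; ring. Qed.

Lemma dotMl c z w : dot (c * z) w = dot z (c^* * w).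
Proof. by case: c; case: z; case: w => a b a' b' a'' b''; rewrite /dot /=; ring. Qed.

Lemma dotzz z : dot z z = cmodulus z ^+ 2.
Proof. by rewrite cmodulus_sqr /dot !expr2. Qed.

Lemma dot_le z w : `|dot z w| <= cmodulus z ^+ 2 + cmodulus w ^+ 2.
Proof.
rewrite !cmodulus_sqr /dot; move: (complex.Re z) (complex.Im z) (complex.Re w) (complex.Im w) => a b a' b'.
have h1 : 0 <= (a + a') ^+ 2 + (b + b') ^+ 2 by rewrite addr_ge0 ?sqr_ge0.
have h2 : 0 <= (a - a') ^+ 2 + (b - b') ^+ 2 by rewrite addr_ge0 ?sqr_ge0.
have h3 : 0 <= a ^+ 2 + b ^+ 2 + a' ^+ 2 + b' ^+ 2 by rewrite !addr_ge0 ?sqr_ge0.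
rewrite ler_norml; apply/andP; split; lra.
Qed.

(* The real part of the L^2 inner product: Hilbert space arguments are run over *)
(* R, and imaginary parts are recovered by testing against i g.                *)
Definition ip f g : R := \int[area]_(p in D) dot (f (to_cplx p)) (g (to_cplx p)).
Definition nsq f : R := \int[area]_(p in D) (cmodulus (f (to_cplx p)) ^+ 2).
Definition nrm f : R := Num.sqrt (nsq f).

Lemma ipE f : ip f f = nsq f.
Proof. by apply: eq_Rintegral => p _; rewrite dotzz. Qed.

Lemma nsq_ge0 f : 0 <= nsq f.
Proof. by apply: Rintegral_ge0 => p _; exact: sqr_ge0. Qed.

Lemma nrm_ge0 f : 0 <= nrm f. Proof. exact: sqrtr_ge0. Qed.

Lemma nrm_sqr f : nrm f ^+ 2 = nsq f.
Proof. by rewrite sqr_sqrtr// nsq_ge0. Qed.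

Lemma L2_sqnorm f : L2_disc f -> sqnorm_disc f = (nsq f)%:E.
Proof.
move=> [mf lf]; rewrite /nsq /Rintegral -/(sqnorm_disc f) fineK//.
by rewrite ge0_fin_numE// sqnorm_disc_ge0.
Qed.

Lemma L2_integrable f : L2_disc f ->
  area.-integrable D (EFin \o (fun p => cmodulus (f (to_cplx p)) ^+ 2)).
Proof.
move=> [mf lf]; apply/integrableP; split; first exact: measurable_sqr_cmodulus.
under eq_integral => p _ do rewrite /= ger0_norm ?sqr_ge0//.
exact: lf.
Qed.

Lemma L2_of_integrable f : measurable_disc f ->
  area.-integrable D (EFin \o (fun p => cmodulus (f (to_cplx p)) ^+ 2)) -> L2_disc f.
Proof.
move=> mf /integrableP[_]; under eq_integral => p _ do rewrite /= ger0_norm ?sqr_ge0//.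
by move=> h; split.
Qed.

Lemma measurable_dot f g : measurable_disc f -> measurable_disc g ->
  measurable_fun D (fun p => dot (f (to_cplx p)) (g (to_cplx p))).
Proof. by move=> [? ?] [? ?]; apply: measurable_funD; apply: measurable_funM. Qed.

Lemma ip_integrable f g : L2_disc f -> L2_disc g ->
  area.-integrable D (EFin \o (fun p => dot (f (to_cplx p)) (g (to_cplx p)))).
Proof.
move=> Lf Lg; have mD := @measurable_disc_coord R.
apply: (le_integrable mD _ _ (integrableD mD (L2_integrable Lf) (L2_integrable Lg))).
  by apply/measurable_EFinP; apply: measurable_dot; [case: Lf|case: Lg].
move=> p _ /=; rewrite lee_fin [leRHS]ger0_norm ?addr_ge0 ?sqr_ge0//.
exact: dot_le.
Qed.

Lemma ipC f g : ip f g = ip g f.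
Proof. by apply: eq_Rintegral => p _; rewrite dotC. Qed.

Lemma ipDl f g h : L2_disc f -> L2_disc g -> L2_disc h ->
  ip (fun z => f z + g z) h = ip f h + ip g h.
Proof.
move=> Lf Lg Lh; rewrite /ip -RintegralD; first last.
- exact: ip_integrable.
- exact: ip_integrable.
- exact: measurable_disc_coord.
by apply: eq_Rintegral => p _; rewrite dotDl.
Qed.

Lemma ipBl f g h : L2_disc f -> L2_disc g -> L2_disc h ->
  ip (fun z => f z - g z) h = ip f h - ip g h.
Proof.
move=> Lf Lg Lh; rewrite /ip -RintegralB; first last.
- exact: ip_integrable.
- exact: ip_integrable.
- exact: measurable_disc_coord.
by apply: eq_Rintegral => p _; rewrite dotBl.
Qed.

Lemma ipZl r f h : L2_disc f -> L2_disc h -> ip (fun z => r%:C * f z) h = r * ip f h.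
Proof.
move=> Lf Lh; rewrite /ip -RintegralZl; first last.
- exact: ip_integrable.
- exact: measurable_disc_coord.
by apply: eq_Rintegral => p _; rewrite dotZl.
Qed.

Lemma ipMl (a : C -> C) f h : ip (fun z => a z * f z) h = ip f (fun z => (a z)^* * h z).
Proof. by apply: eq_Rintegral => p _; rewrite dotMl. Qed.

Lemma L2D f g : L2_disc f -> L2_disc g -> L2_disc (fun z => f z + g z).
Proof.
move=> Lf Lg; have mD := @measurable_disc_coord R.
have mfg : measurable_disc (fun z => f z + g z) := measurable_discD Lf.1 Lg.1.
apply: L2_of_integrable => //.
have i2 := integrableZl mD 2 (integrableD mD (L2_integrable Lf) (L2_integrable Lg)).
apply: (le_integrable mD _ _ i2); first exact: (measurable_sqr_cmodulus mfg).
move=> p _ /=; rewrite lee_fin ger0_norm ?sqr_ge0// [leRHS]ger0_norm ?mulr_ge0 ?addr_ge0 ?sqr_ge0//.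
have h := cmodulusD (f (to_cplx p)) (g (to_cplx p)).
apply: (@le_trans _ _ ((cmodulus (f (to_cplx p)) + cmodulus (g (to_cplx p))) ^+ 2)).
  by rewrite ler_sqr ?nnegrE ?addr_ge0 ?cmodulus_ge0.
by have := sqr_ge0 (cmodulus (f (to_cplx p)) - cmodulus (g (to_cplx p))); lra.
Qed.

Lemma measurable_discM (a f : C -> C) : measurable_disc a -> measurable_disc f ->
  measurable_disc (fun z => a z * f z).
Proof.
move=> [ar ai] [fr fi]; split.
- rewrite (_ : (fun _ => _) = fun p => complex.Re (a (to_cplx p)) * complex.Re (f (to_cplx p)) -
      complex.Im (a (to_cplx p)) * complex.Im (f (to_cplx p))).
    by apply: measurable_funB; apply: measurable_funM.
  by apply/funext => p; case: (a _); case: (f _).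
- rewrite (_ : (fun _ => _) = fun p => complex.Re (a (to_cplx p)) * complex.Im (f (to_cplx p)) +
      complex.Im (a (to_cplx p)) * complex.Re (f (to_cplx p))).
    by apply: measurable_funD; apply: measurable_funM.
  by apply/funext => p; case: (a _); case: (f _).
Qed.

Lemma L2M (a f : C -> C) (k : R) : measurable_disc a ->
  (forall z, unit_disc z -> cmodulus (a z) <= k) -> L2_disc f ->
  L2_disc (fun z => a z * f z).
Proof.
move=> ma ak Lf; have mD := @measurable_disc_coord R.
have mf : measurable_disc f by case: Lf.
apply: L2_of_integrable; first exact: measurable_discM.
apply: (le_integrable mD _ _ (integrableZl mD (k ^+ 2) (L2_integrable Lf))).
  exact: (measurable_sqr_cmodulus (measurable_discM ma mf)).
move=> p Dp; have h : cmodulus (a (to_cplx p) * f (to_cplx p)) ^+ 2 <=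
    k ^+ 2 * cmodulus (f (to_cplx p)) ^+ 2.
  rewrite cmodulusM exprMn ler_wpM2r ?sqr_ge0// ler_sqr ?nnegrE ?cmodulus_ge0//; first exact: ak.
  exact: le_trans (cmodulus_ge0 _) (ak _ Dp).
by rewrite lee_fin ger0_norm ?sqr_ge0// ger0_norm// mulr_ge0 ?sqr_ge0.
Qed.

Lemma measurable_disc_cst c : measurable_disc (fun=> c).
Proof. by split; exact: measurable_cst. Qed.

Lemma L2Z c f : L2_disc f -> L2_disc (fun z => c * f z).
Proof. by apply: (@L2M _ _ (cmodulus c)) => //; exact: measurable_disc_cst. Qed.

Lemma L2N f : L2_disc f -> L2_disc (fun z => - f z).
Proof.
move=> Lf; rewrite (_ : (fun _ => _) = fun z => -1 * f z); first exact: L2Z.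
by apply/funext => z; rewrite mulN1r.
Qed.

Lemma L2B f g : L2_disc f -> L2_disc g -> L2_disc (fun z => f z - g z).
Proof. by move=> Lf Lg; apply: L2D => //; exact: L2N. Qed.

Lemma ip_CauchySchwarz f g : L2_disc f -> L2_disc g -> `|ip f g| <= nrm f * nrm g.
Proof.
move=> Lf Lg.
have Q r : 0 <= r ^+ 2 * nsq f - 2 * r * ip f g + nsq g.
  have Lh : L2_disc (fun z => r%:C * f z - g z) by apply: L2B => //; exact: L2Z.
  have := nsq_ge0 (fun z => r%:C * f z - g z); rewrite -ipE ipBl//; last exact: L2Z.
  rewrite ipZl// (ipC f) (ipC g) !ipBl//; [|exact: L2Z|exact: L2Z].
  by rewrite !ipZl// !ipE (ipC g f); lra.
rewrite -ler_sqr ?nnegrE ?mulr_ge0 ?nrm_ge0// real_normK ?num_real// exprMn !nrm_sqr.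
have f0 := nsq_ge0 f; have g0 := nsq_ge0 g.
move: (nsq f) (nsq g) (ip f g) Q f0 g0 => F G I Q F0 G0.
have [F1|F1] := eqVneq F 0.
  rewrite F1 mul0r; have [->|I0] := eqVneq I 0; first by rewrite expr0n.
  have := Q ((G + 1) / (2 * I)); rewrite F1.
  have -> : ((G + 1) / (2 * I)) ^+ 2 * 0 - 2 * ((G + 1) / (2 * I)) * I + G = -1.
    by field.
  by rewrite oppr_ge0 ler10.
have Fp : 0 < F by rewrite lt_neqAle eq_sym F1.
have := Q (I / F).
have -> : (I / F) ^+ 2 * F - 2 * (I / F) * I + G = (F * G - I ^+ 2) / F by field.
by rewrite pmulr_lge0 ?invr_gt0// subr_ge0.
Qed.

Lemma nrm_triangle f g : L2_disc f -> L2_disc g -> nrm (fun z => f z + g z) <= nrm f + nrm g.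
Proof.
move=> Lf Lg; rewrite -ler_sqr ?nnegrE ?addr_ge0 ?nrm_ge0// sqrrD !nrm_sqr.
have Lfg := L2D Lf Lg.
rewrite -!ipE ipDl// (ipC f) (ipC g) !ipDl//.
have := ip_CauchySchwarz Lf Lg; have := ler_norm (ip f g); rewrite (ipC g f) mulr2n; lra.
Qed.

Lemma nsqM_le (a f : C -> C) (k : R) : measurable_disc a ->
  (forall z, unit_disc z -> cmodulus (a z) <= k) -> L2_disc f ->
  nsq (fun z => a z * f z) <= k ^+ 2 * nsq f.
Proof.
move=> ma ak Lf; have mD := @measurable_disc_coord R.
rewrite /nsq -RintegralZl//; last exact: L2_integrable.
apply: le_Rintegral => //.
- exact: (L2_integrable (L2M ma ak Lf)).
- by have := integrableZl mD (k ^+ 2) (L2_integrable Lf); apply: eq_integrable.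
move=> p Dp; rewrite cmodulusM exprMn ler_wpM2r ?sqr_ge0// ler_sqr ?nnegrE ?cmodulus_ge0//.
  exact: ak.
exact: le_trans (cmodulus_ge0 _) (ak _ Dp).
Qed.

Lemma nsqZ c f : L2_disc f -> nsq (fun z => c * f z) = cmodulus c ^+ 2 * nsq f.
Proof.
move=> Lf; rewrite /nsq -RintegralZl//; [|exact: measurable_disc_coord|exact: L2_integrable].
by apply: eq_Rintegral => p _; rewrite cmodulusM exprMn.
Qed.

Lemma nrmZ c f : L2_disc f -> nrm (fun z => c * f z) = cmodulus c * nrm f.
Proof.
by move=> Lf; rewrite /nrm nsqZ// sqrtrM ?sqr_ge0// sqrtr_sqr ger0_norm// cmodulus_ge0.
Qed.

Definition cutoff E f z : C := if (complex.Re z, complex.Im z) \in E then f z else 0.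

Lemma cutoffE E f p : cutoff E f (to_cplx p) = if p \in E then f (to_cplx p) else 0.
Proof. by rewrite /cutoff -surjective_pairing. Qed.

Lemma cutoff_mul E f z : cutoff E f z = cutoff E (fun=> 1) z * f z.
Proof. by rewrite /cutoff; case: ifP; rewrite ?mul1r ?mul0r. Qed.

Lemma measurable_cutoff1 E c : measurable E -> measurable_disc (cutoff E (fun=> c)).
Proof.
move=> mE; split.
- rewrite (_ : (fun _ => _) = fun p => \1_E p * complex.Re c); first exact: measurable_funM.
  by apply/funext => p; rewrite cutoffE indicE; case: ifP; rewrite ?mul1r ?mul0r.
- rewrite (_ : (fun _ => _) = fun p => \1_E p * complex.Im c); first exact: measurable_funM.
  by apply/funext => p; rewrite cutoffE indicE; case: ifP; rewrite ?mul1r ?mul0r.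
Qed.

Lemma cmodulus_cutoff1 E z : cmodulus (cutoff E (fun=> 1) z) <= 1.
Proof. by rewrite /cutoff; case: ifP; rewrite ?cmodulus0// (cmodulusR 1) normr1. Qed.

Lemma L2_cutoff E f : measurable E -> L2_disc f -> L2_disc (cutoff E f).
Proof.
move=> mE Lf; rewrite (_ : cutoff E f = fun z => cutoff E (fun=> 1) z * f z).
  by apply: (@L2M _ _ 1) => //; [exact: measurable_cutoff1|move=> z _; exact: cmodulus_cutoff1].
by apply/funext => z; rewrite cutoff_mul.
Qed.

Lemma nsq_cutoff E f : measurable E -> E `<=` D ->
  nsq (cutoff E f) = \int[area]_(p in E) (cmodulus (f (to_cplx p)) ^+ 2).
Proof.
move=> mE ED; rewrite /nsq (Rintegral_support _ ED); last first.
  move=> p _ pE; rewrite cutoffE (_ : (p \in E) = false) ?cmodulus0 ?expr0n//.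
  by apply/negP; rewrite inE.
by apply: eq_Rintegral => p pE; rewrite cutoffE pE.
Qed.

Lemma nsq_cutoff_le E f : measurable E -> L2_disc f -> nsq (cutoff E f) <= nsq f.
Proof.
move=> mE Lf; rewrite (_ : cutoff E f = fun z => cutoff E (fun=> 1) z * f z).
  rewrite -[leRHS]mul1r -[1 in leRHS](expr1n _ 2).
  by apply: nsqM_le => //; [exact: measurable_cutoff1|move=> z _; exact: cmodulus_cutoff1].
by apply/funext => z; rewrite cutoff_mul.
Qed.

(* Cauchy--Schwarz against the indicator function of E. *)
Lemma Rintegral_le_nrm E f (s : R) : measurable E -> E `<=` D -> 0 <= s -> area E = (s ^+ 2)%:E ->
  L2_disc f -> \int[area]_(p in E) cmodulus (f (to_cplx p)) <= s * nrm (cutoff E f).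
Proof.
move=> mE ED s0 aE Lf; have Lc := L2_cutoff mE Lf.
pose g (z : C) : C := (cmodulus (cutoff E f z))%:C.
have gE z : cmodulus (g z) = cmodulus (cutoff E f z) by rewrite cmodulusR ger0_norm// cmodulus_ge0.
have mg : measurable_disc g.
  split; last exact: measurable_cst.
  by apply: measurable_cmodulus; case: Lc.
have Lg : L2_disc g.
  apply: L2_of_integrable => //; have := L2_integrable Lc; apply: eq_integrable.
    exact: measurable_disc_coord.
  by move=> p _ /=; rewrite gE.
have n1 : nsq (cutoff E (fun=> 1)) = s ^+ 2.
  rewrite nsq_cutoff// (@eq_Rintegral _ _ _ _ _ (fun=> 1)) => [|p _].
    by rewrite Rintegral_cst// aE mul1r.
  by rewrite (cmodulusR 1) normr1 expr1n.
have L1 : L2_disc (cutoff E (fun=> 1)).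
  split; first exact: measurable_cutoff1.
  rewrite /sqnorm_disc (eq_integral (fun p => (\1_E p)%:E)) => [|p _].
    rewrite integral_indic//; last exact: measurable_disc_coord.
    by rewrite setIidl// aE ltry.
  by rewrite cutoffE indicE; case: ifP => _; rewrite ?cmodulus0 ?(cmodulusR 1) ?normr1 ?expr1n ?expr0n.
have ns : nrm (cutoff E (fun=> 1)) = s by rewrite /nrm n1 sqrtr_sqr ger0_norm.
have := ip_CauchySchwarz L1 Lg; rewrite ns.
have -> : nrm g = nrm (cutoff E f).
  by rewrite /nrm /nsq; congr Num.sqrt; apply: eq_Rintegral => p _; rewrite gE.
move=> h; apply: (le_trans _ (le_trans (ler_norm _) h)).
rewrite /ip (Rintegral_support _ ED); last first.
  move=> p _ pE; rewrite cutoffE (_ : (p \in E) = false) ?/dot ?mul0r ?addr0//=.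
  by apply/negP; rewrite inE.
apply: le_of_eq; apply: eq_Rintegral => p pE.
by rewrite /g !cutoffE pE /dot /= mul1r mul0r addr0.
Qed.

End L2Layer.

Section Limits.
Context {R : realType}.
Local Notation C := (Cplx R).

Lemma real_seq_lim (s : nat -> R) :
  (forall e : R, 0 < e -> exists N, forall n m, (N <= n)%N -> (N <= m)%N -> `|s n - s m| <= e) ->
  exists l : R, forall e : R, 0 < e -> exists N, forall n, (N <= n)%N -> `|s n - l| <= e.
Proof.
move=> h; have /cvg_ex[/= l hl] : cvg (s @ \oo).
  apply: cauchy_cvg; apply: cauchy_exP => e e0.
  have [N hN] := h _ (divr_gt0 e0 (ltr0Sn _ 1)).
  exists (s N); exists N => // n /= Nn; rewrite -ball_normE/=.
  by apply: (le_lt_trans (hN _ _ (leqnn _) Nn)); rewrite ltr_pdivrMr// ltr_pMr// ltr1n.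
exists l => e e0; have /cvgrPdist_le/(_ _ e0)[N _ hN] := hl.
by exists N => n Nn; rewrite distrC; exact: hN.
Qed.

Lemma cplx_seq_lim (s : nat -> C) :
  (forall e : R, 0 < e -> exists N, forall n m, (N <= n)%N -> (N <= m)%N -> cmodulus (s n - s m) <= e) ->
  exists l : C, forall e : R, 0 < e -> exists N, forall n, (N <= n)%N -> cmodulus (s n - l) <= e.
Proof.
move=> h.
have ReB (u v : C) : complex.Re (u - v) = complex.Re u - complex.Re v by case: u; case: v.
have ImB (u v : C) : complex.Im (u - v) = complex.Im u - complex.Im v by case: u; case: v.
have [a ha] : exists l : R, forall e : R, 0 < e -> exists N, forall n, (N <= n)%N ->
    `|complex.Re (s n) - l| <= e.
  apply: real_seq_lim => e e0; have [N hN] := h _ e0; exists N => n m Nn Nm.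
  by rewrite -ReB; exact: le_trans (normRe_le _) (hN _ _ Nn Nm).
have [b hb] : exists l : R, forall e : R, 0 < e -> exists N, forall n, (N <= n)%N ->
    `|complex.Im (s n) - l| <= e.
  apply: real_seq_lim => e e0; have [N hN] := h _ e0; exists N => n m Nn Nm.
  by rewrite -ImB; exact: le_trans (normIm_le _) (hN _ _ Nn Nm).
exists (a +i* b) => e e0; have e2 : 0 < e / 2 by rewrite divr_gt0.
have [N1 h1] := ha _ e2; have [N2 h2] := hb _ e2; exists (maxn N1 N2) => n.
rewrite geq_max => /andP[n1 n2]; apply: (le_trans (cmodulus_le _)).
by rewrite ReB ImB /= (splitr e) lerD ?h1 ?h2.
Qed.

End Limits.

(** * Local bounds for Bergman functions *)

Section BergmanLocal.
Context {R : realType}.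
Local Notation plane := (measurableTypeR R * measurableTypeR R)%type.
Local Notation C := (Cplx R).
Local Notation D := (@disc_coord R).
Implicit Types (f g h : C -> C) (x y rho : R).

Lemma bergman_measurable f : bergman_function f -> measurable_cplx f.
Proof.
move=> [_ [[mr mi] _] f0]; have mD := @measurable_disc_coord R; split.
- move/(measurable_restrictT _ mD) : mr; congr measurable_fun; apply/funext => p.
  rewrite patchE; case: ifPn => [_|]; rewrite /repart -surjective_pairing//.
  by rewrite notin_setE => /f0 ->.
- move/(measurable_restrictT _ mD) : mi; congr measurable_fun; apply/funext => p.
  rewrite patchE; case: ifPn => [_|]; rewrite /impart -surjective_pairing//.
  by rewrite notin_setE => /f0 ->.
Qed.

(** Squares have finite area, and |t| <= m implies |t| <= 1 + m^2, so square integrability gives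
    integrability. *)
Lemma bergman_square_integrable f : bergman_function f -> square_integrable f.
Proof.
move=> bf; have [mr mi] := bergman_measurable bf; have [_ Lf f0] := bf.
have mD := @measurable_disc_coord R.
have i2 : area.-integrable setT (EFin \o (fun p : plane => cmodulus (f (to_cplx p)) ^+ 2)).
  have := L2_integrable Lf; move/(integrable_mkcond _ mD) => i3.
  have : area.-integrable setT ((EFin \o (fun p : plane => cmodulus (f (to_cplx p)) ^+ 2)) \_ D) by exact: i3.
  congr (_.-integrable _ _); apply/funext => p; rewrite patchE; case: ifPn => //.
  by rewrite notin_setE => /f0 /= ->; rewrite cmodulus0 expr0n.
move=> a c l; have mS := measurable_square a c l.
have fin : (area (square a c l) < +oo)%E.
  have [l0|l0] := leP 0 l; first by rewrite area_square// ltry.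
  have -> : square a c l = set0; last by rewrite measure0 ltry.
  rewrite /square (_ : `]a, a + l]%classic = set0) ?set0X//.
  by apply: set_itv_ge; rewrite -leNgt bnd_simp; lra.
have i1 : area.-integrable (square a c l) (EFin \o (fun=> 1 : R)).
  apply: measurable_bounded_integrable => //.
  by exists 1; split; [exact: num_real|move=> M kM z _; rewrite normr1 ltW].
have i3 : area.-integrable (square a c l) (EFin \o (fun p : plane => cmodulus (f (to_cplx p)) ^+ 2)).
  exact: (integrableS measurableT mS _ i2).
have le_sq (t m : R) : `|t| <= m -> `|t| <= 1 + m ^+ 2.
  by move=> h; apply: (le_trans h); have := sqr_ge0 (m - 1); have := sqr_ge0 m; lra.
split; apply: (le_integrable mS _ _ (integrableD mS i1 i3)).
- by apply/measurable_EFinP; exact: (@measurable_funS _ _ _ _ setT).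
- move=> p _; rewrite /= lee_fin [leRHS]ger0_norm ?addr_ge0 ?sqr_ge0//.
  by apply: le_sq; rewrite /repart -surjective_pairing; exact: normRe_le.
- by apply/measurable_EFinP; exact: (@measurable_funS _ _ _ _ setT).
- move=> p _; rewrite /= lee_fin [leRHS]ger0_norm ?addr_ge0 ?sqr_ge0//.
  by apply: le_sq; rewrite /impart -surjective_pairing; exact: normIm_le.
Qed.

Definition closed_square x0 y0 rho : set plane :=
  [set p | `|p.1 - x0| <= rho /\ `|p.2 - y0| <= rho].

Lemma square_sub_closed x0 y0 rho :
  square (x0 - rho) (y0 - rho) (rho + rho) `<=` closed_square x0 y0 rho.
Proof. by move=> p [/=]; rewrite !in_itv/= => h1 h2; split; rewrite ler_norml; lra. Qed.

(** The right-hand side keeps only the norm over the square; this locality is what lets such bounds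
    be added up over disjoint squares. *)
Lemma bergman_value f x0 y0 rho : bergman_function f -> 0 < rho ->
  closed_square x0 y0 rho `<=` D ->
  cmodulus (f (to_cplx (x0, y0))) <= 8%:R / rho *
    nrm (cutoff (square (x0 - rho) (y0 - rho) (rho + rho)) f).
Proof.
move=> bf rho0 SD; have [df Lf f0] := bf.
have rr0 : 0 <= rho + rho by rewrite addr_ge0 ?ltW.
have an x y : sqdist x0 y0 x y <= rho ^+ 2 -> conj_expands (repart f) (impart f) x y.
  move=> h; apply: derivable_conj_expands; apply: df.
  have K (c : R) : c ^+ 2 <= rho ^+ 2 -> `|c| <= rho.
    by rewrite -(real_normK (num_real c)) ler_pXn2r// nnegrE// ltW.
  apply: (SD (x, y)); split; apply: K; apply: le_trans h; rewrite /sqdist /=.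
    by rewrite lerDl sqr_ge0.
  by rewrite lerDr sqr_ge0.
apply: (le_trans (cvalue_bound rho0 an (bergman_square_integrable bf))).
have -> : 8%:R / rho * nrm (cutoff (square (x0 - rho) (y0 - rho) (rho + rho)) f) =
  4%:R * rho ^- 2 * ((rho + rho) * nrm (cutoff (square (x0 - rho) (y0 - rho) (rho + rho)) f)).
  by field; rewrite gt_eqF.
apply: ler_wpM2l; first by rewrite mulr_ge0 ?ler0n ?invr_ge0 ?exprn_ge0 ?ltW.
apply: Rintegral_le_nrm => //; [exact: measurable_square| |exact: area_square].
exact: subset_trans (@square_sub_closed _ _ _) SD.
Qed.

Lemma bergman_lip : exists2 K : R, 0 <= K & forall f x0 y0 rho x y,
  bergman_function f -> 0 < rho -> closed_square x0 y0 (2 * rho) `<=` D ->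
  `|x - x0| <= rho -> `|y - y0| <= rho ->
  cmodulus (f (to_cplx (x, y)) - f (to_cplx (x0, y0))) <=
  K / rho ^+ 2 * (`|x - x0| + `|y - y0|) *
    nrm (cutoff (square (x0 - 2 * rho) (y0 - 2 * rho) (4%:R * rho)) f).
Proof.
exists (3168%:R); first exact: ler0n.
move=> f x0 y0 rho x y bf rho0 SD hx hy; have [df Lf f0] := bf.
have r0 := ltW rho0.
have rr0 : 0 <= 4%:R * rho by rewrite mulr_ge0 ?ler0n.
have an p q : `|p - x0| <= 2 * rho -> `|q - y0| <= 2 * rho ->
    conj_expands (repart f) (impart f) p q.
  by move=> h1 h2; apply: derivable_conj_expands; apply: df; exact: (SD (p, q)).
have x00 : `|x0 - x0| <= rho by rewrite subrr normr0.
have y00 : `|y0 - y0| <= rho by rewrite subrr normr0.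
apply: (le_trans (cvalue_lip rho0 an (bergman_square_integrable bf) hx hy x00 y00)).
set S := square _ _ _; set d := `|x - x0| + `|y - y0|.
have -> : 3168%:R / rho ^+ 2 * d * nrm (cutoff S f) =
   792%:R * rho ^- 3 * d * (4%:R * rho * nrm (cutoff S f)) by field; rewrite gt_eqF.
have d0 : 0 <= d by rewrite addr_ge0.
have q0 : 0 <= rho ^- 3 by rewrite invr_ge0 exprn_ge0.
have k0 := mulr_ge0 (mulr_ge0 (ler0n R 792) q0) d0.
move: (792%:R * rho ^- 3 * d) k0 => k k0; apply: (ler_wpM2l k0).
apply: Rintegral_le_nrm => //; [exact: measurable_square| |exact: area_square].
apply: subset_trans SD => p [/=]; rewrite !in_itv/= => h1 h2.
by split; rewrite ler_norml; lra.
Qed.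

End BergmanLocal.

(** * Completeness of the Bergman space *)

Section Completeness.
Context {R : realType}.
Local Notation plane := (measurableTypeR R * measurableTypeR R)%type.
Local Notation C := (Cplx R).
Local Notation D := (@disc_coord R).
Implicit Types (f g h : bergman R) (x y rho e : R) (z : C).

Lemma bergman_normE f : `|f| = (nrm f)%:C.
Proof. by []. Qed.

Lemma bergmanL2 f : L2_disc f.
Proof. by have [_ ? _] := bergman_functionP f. Qed.

Lemma disc_closed_square z : unit_disc z -> exists2 rho : R, 0 < rho &
  closed_square (complex.Re z) (complex.Im z) rho `<=` D.
Proof.
rewrite /unit_disc/= -[1]/(1%:C : R[i]) -cmodulus_ltE => hz.
exists ((1 - cmodulus z) / 3%:R); first by rewrite divr_gt0 ?subr_gt0.
move=> p [h1 h2]; rewrite /disc_coord /unit_disc /= -[1]/(1%:C : R[i]) -cmodulus_ltE.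
have -> : to_cplx p = z + (to_cplx p - z) by rewrite addrC subrK.
apply: (le_lt_trans (cmodulusD _ _)).
apply: (@le_lt_trans _ _ (cmodulus z + (`|p.1 - complex.Re z| + `|p.2 - complex.Im z|))).
  by rewrite lerD2l; case: z {hz h1 h2} => a b; exact: (cmodulus_le (to_cplx p - (a +i* b))).
by lra.
Qed.

Lemma bergman_value_near f z rho w : 0 < rho ->
  closed_square (complex.Re z) (complex.Im z) (7%:R * rho) `<=` D ->
  `|complex.Re (w - z)| <= 6%:R * rho -> `|complex.Im (w - z)| <= 6%:R * rho ->
  cmodulus (f w) <= 8%:R / rho * nrm f.
Proof.
move=> rho0 SD.
have -> : complex.Re (w - z) = complex.Re w - complex.Re z by case: w; case: z {SD}.
have -> : complex.Im (w - z) = complex.Im w - complex.Im z by case: w; case: z {SD}.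
move=> h1 h2; have SDw : closed_square (complex.Re w) (complex.Im w) rho `<=` D.
  move=> p [h3 h4]; apply: SD; move: h1 h2 h3 h4.
  by rewrite /closed_square/= !ler_norml; split; lra.
have := bergman_value (bergman_functionP f) rho0 SDw; rewrite to_cplxK => /le_trans; apply.
apply: ler_wpM2l; first by rewrite divr_ge0// ltW.
rewrite ler_sqrt ?nsq_ge0//; apply: nsq_cutoff_le; last exact: bergmanL2.
exact: measurable_square.
Qed.

Lemma disc_bound z : unit_disc z -> exists2 k : R, 0 < k & forall f, cmodulus (f z) <= k * nrm f.
Proof.
move=> hz; have [r r0 hr] := disc_closed_square hz.
have r7 : 0 < r / 7%:R by rewrite divr_gt0.
exists (8%:R / (r / 7%:R)); first by rewrite divr_gt0.
move=> f; apply: (@bergman_value_near f z _ z r7); last 2 first.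
- by rewrite subrr normr0 mulr_ge0// ltW.
- by rewrite subrr normr0 mulr_ge0// ltW.
by rewrite mulrCA mulfV ?mulr1// pnatr_eq0.
Qed.

(** Point evaluations are bounded, so a Cauchy sequence converges pointwise; Fatou's lemma upgrades
    this to convergence in norm, and the uniform remainder of [taylor2] makes the limit analytic. *)
Lemma bergman_complete (u : nat -> bergman R) :
  (forall e, 0 < e -> exists N, forall n m, (N <= n)%N -> (N <= m)%N -> nrm (u n - u m) <= e) ->
  exists h, forall e, 0 < e -> exists N, forall n, (N <= n)%N -> nrm (u n - h) <= e.
Proof.
move=> cu.
have ptw z : exists l : C, forall e, 0 < e -> exists N, forall n, (N <= n)%N -> cmodulus (u n z - l) <= e.
  have [hz|hz] := pselect (unit_disc z); last first.
    exists 0 => e e0; exists 0%N => n _.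
    by have [_ _ ->//] := bergman_functionP (u n); rewrite subrr cmodulus0 ltW.
  have [k k0 hk] := disc_bound hz; apply: cplx_seq_lim => e e0.
  have [N hN] := cu _ (divr_gt0 e0 k0); exists N => n m Nn Nm.
  apply: (le_trans (hk (u n - u m))).
  by rewrite mulrC -ler_pdivlMr//; exact: hN.
have [h hh] := choice ptw.
have [N0 hN0] := cu 1 ltr01.
pose B0 := nrm (u N0) + 1.
have B00 : 0 <= B0 by rewrite addr_ge0 ?nrm_ge0.
have hB n : (N0 <= n)%N -> nrm (u n) <= B0.
  move=> Nn; have -> : (u n : C -> C) = (fun z => u N0 z + (u n - u N0) z).
    by apply/funext => z; rewrite addrC; exact: esym (subrK (u N0 z) (u n z)).
  apply: (le_trans (nrm_triangle (bergmanL2 _) (bergmanL2 _))).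
  by rewrite lerD2l; apply: hN0.
have cvgh (F : C -> R) z : (forall v w : C, `|F v - F w| <= cmodulus (v - w)) ->
    F (u n z) @[n --> \oo] --> F (h z).
  move=> hF; apply/cvgrPdist_le => e e0; have [N hN] := hh z e e0.
  by exists N => // n /= Nn; rewrite distrC; exact: le_trans (hF _ _) (hN _ Nn).
have ReB (v w : C) : `|complex.Re v - complex.Re w| <= cmodulus (v - w).
  by rewrite (_ : _ - _ = complex.Re (v - w)) ?normRe_le//; case: v; case: w.
have ImB (v w : C) : `|complex.Im v - complex.Im w| <= cmodulus (v - w).
  by rewrite (_ : _ - _ = complex.Im (v - w)) ?normIm_le//; case: v; case: w.
have mh : measurable_disc h.
  split.
    apply: (measurable_fun_cvg (h := fun n p => complex.Re (u n (to_cplx p)))) => [n|p _].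
      by case: (bergmanL2 (u n)) => -[].
    exact: (cvgh (fun w : C => complex.Re w) (to_cplx p) ReB).
  apply: (measurable_fun_cvg (h := fun n p => complex.Im (u n (to_cplx p)))) => [n|p _].
    by case: (bergmanL2 (u n)) => -[].
  exact: (cvgh (fun w : C => complex.Im w) (to_cplx p) ImB).
have mD := @measurable_disc_coord R.
have fat e : 0 < e -> exists N, forall n, (N <= n)%N ->
    (sqnorm_disc (fun z => u n z - h z)%R <= (e ^+ 2)%:E)%E.
  move=> e0; have [N hN] := cu e e0; exists N => n Nn.
  pose F m (p : plane) : \bar R := (cmodulus (u n (to_cplx p) - u (m + N)%N (to_cplx p)) ^+ 2)%:E.
  have mF m : measurable_fun D (F m).
    exact: (measurable_sqr_cmodulus (bergmanL2 (u n - u (m + N)%N)).1).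
  have F0 m p : D p -> (0 <= F m p)%E by move=> _; rewrite lee_fin sqr_ge0.
  have := fatou area mD mF F0.
  rewrite (eq_integral (fun p => (cmodulus (u n (to_cplx p) - h (to_cplx p)) ^+ 2)%:E)); last first.
    move=> p _; apply: (cvg_limn_einf_sup _).1; apply: cvg_EFin; first exact: nearW.
    have c1 : cmodulus (u n (to_cplx p) - u m (to_cplx p)) @[m --> \oo] -->
        cmodulus (u n (to_cplx p) - h (to_cplx p)).
      apply: (cvgh (fun w => cmodulus (u n (to_cplx p) - w))) => v w.
      have hab (a b : C) : cmodulus (a - v) <= cmodulus (a - w) + cmodulus (v - w).
        by rewrite [cmodulus (v - w)]cmodulusB -(subrKA w a) cmodulusD.
      have hba (a b : C) : cmodulus (a - w) <= cmodulus (a - v) + cmodulus (v - w).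
        by rewrite -(subrKA v a) cmodulusD.
      have := hab (u n (to_cplx p)) 0; have := hba (u n (to_cplx p)) 0.
      by rewrite ler_norml; lra.
    have c2 := cvgM c1 c1.
    rewrite -(cvg_shiftn N) -expr2 in c2.
    suff <- : [sequence (fun m => cmodulus (u n (to_cplx p) - u m (to_cplx p)) *
      cmodulus (u n (to_cplx p) - u m (to_cplx p))) (m + N)%N]_m = fine \o F^~ p by exact: c2.
    by apply/funext => m; rewrite /F /= expr2.
  move=> /le_trans; apply.
  have G m : (\int[area]_(p in D) F m p <= (e ^+ 2)%:E)%E.
    have -> : (\int[area]_(p in D) F m p)%E = sqnorm_disc (u n - u (m + N)%N : bergman R)%R by [].
    rewrite L2_sqnorm; last exact: bergmanL2.
    rewrite lee_fin -nrm_sqr ler_sqr ?nnegrE ?nrm_ge0 ?(ltW e0)//.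
    by apply: hN => //; exact: leq_addl.
  rewrite limn_einf_lim; apply: lime_le; first exact: is_cvg_einfs.
  apply: nearW => m; apply: le_trans (G m).
  by apply: ereal_inf_lbound; exists m => //=.
have Lh : L2_disc h.
  have [N hN] := fat 1 ltr01; have := hN N (leqnn N) => h1.
  have Ld : L2_disc (fun z => u N z - h z).
    split; last by apply: (le_lt_trans h1); rewrite ltry.
    have := measurable_discD (bergmanL2 (u N)).1 (measurable_discZ (-1) mh).
    congr measurable_disc; apply/funext => z.
    by rewrite addrfctE scalrfctE /GRing.scale/= mulN1r.
  have := L2B (bergmanL2 (u N)) Ld; congr L2_disc; apply/funext => z.
  by rewrite opprB addrC subrK.
have h0 z : ~ unit_disc z -> h z = 0.
  move=> hz; apply/eqP; rewrite -subr_eq0; apply/eqP/cmodulus_eq0/le_anti.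
  rewrite cmodulus_ge0 andbT; apply/ler_addgt0Pl => e e0; rewrite addr0.
  have [N hN] := hh z e e0; have := hN N (leqnn N).
  by have [_ _ ->//] := bergman_functionP (u N); rewrite sub0r subr0 cmodulusN.
have dh : analytic_disc h.
  move=> z hz; have [r r0 hr] := disc_closed_square hz.
  pose rho := r / 7%:R; have rho0 : 0 < rho by rewrite divr_gt0.
  have SD : closed_square (complex.Re z) (complex.Im z) (7%:R * rho) `<=` D.
    by rewrite /rho mulrCA mulfV ?mulr1// pnatr_eq0.
  have [K K0 tay] := @taylor2 R.
  pose B := 8%:R / rho * B0; have B_ge0 : 0 <= B by rewrite mulr_ge0// divr_ge0// ltW.
  pose c := K ^+ 2 * B / rho ^+ 2.
  have c0 : 0 <= c by apply: divr_ge0; [apply: mulr_ge0 => //; exact: exprn_ge0|rewrite exprn_ge0// ltW].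
  have inD w : `|complex.Re (w - z)| <= 6%:R * rho -> `|complex.Im (w - z)| <= 6%:R * rho -> unit_disc w.
    case: w => a b; case: z {hz hr hh} SD => a' b' SD h1 h2.
    apply: (SD (a, b)); move: h1 h2; rewrite /closed_square /= !ler_norml; split; lra.
  (* From [N0] on, all [u n] share the bound [B] near [z], hence the same remainder constant [c]. *)
  have hy n : exists a : C, (N0 <= n)%N -> forall k, cmodulus k <= rho ->
      cmodulus (u n (z + k) - u n z - a * k) <= c * cmodulus k ^+ 2.
    have [Nn|Nn] := leqP N0 n; last by exists 0.
    have [|a ha] := tay (u n) z rho B rho0 B_ge0 (bergman_measurable (bergman_functionP (u n))).
    - move=> w h1 h2; split; first by have [df _ _] := bergman_functionP (u n); apply: df; exact: inD.
      apply: (le_trans (bergman_value_near (u n) rho0 SD h1 h2)).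
      by apply: ler_wpM2l; [rewrite divr_ge0// ltW|exact: hB].
    - by exists a.
  have [a ha] := choice hy.
  have cp : 0 < c + 1 by rewrite ltr_wpDl.
  (* The derivatives at [z] form a Cauchy sequence: with an increment of size [s], the difference of
     two of them times [s] is at most two remainders of e s / 4 plus four value errors of e s /
     16. *)
  have [al hal] : exists l : C, forall e, 0 < e -> exists N, forall n, (N <= n)%N -> cmodulus (a n - l) <= e.
    apply: cplx_seq_lim => e e0.
    pose s := Num.min rho (e / (4%:R * (c + 1))).
    have s0 : 0 < s by rewrite lt_min rho0; apply: divr_gt0 => //; rewrite mulr_gt0.
    have es : 0 < e * s / 16%:R by rewrite divr_gt0// mulr_gt0.
    pose k : C := s%:C; have ck : cmodulus k = s by rewrite cmodulusR gtr0_norm.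
    have [N1 h1] := hh z _ es; have [N2 h2] := hh (z + k) _ es.
    exists (maxn N0 (maxn N1 N2)) => n m; rewrite !geq_max.
    move=> /and3P[n0 n1 n2] /and3P[m0 m1 m2].
    have kr : cmodulus k <= rho by rewrite ck ge_min lexx.
    have a1 := ha n n0 k kr; have a2 := ha m m0 k kr.
    have b1 := h1 _ n1; have b2 := h2 _ n2; have b3 := h1 _ m1; have b4 := h2 _ m2.
    rewrite -(ler_pM2r s0) -[X in _ * X]ck -cmodulusM.
    have -> : (a n - a m) * k = - (u n (z + k) - u n z - a n * k) + (u m (z + k) - u m z - a m * k) +
       (u n (z + k) - h (z + k)) - (u m (z + k) - h (z + k)) - (u n z - h z) + (u m z - h z) by ring.
    apply: (@le_trans _ _ (c * s ^+ 2 + c * s ^+ 2 + e * s / 16%:R + e * s / 16%:R + e * s / 16%:R + e * s / 16%:R)).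
      rewrite ck in a1 a2.
      do 5 (apply: (le_trans (cmodulusD _ _)); apply: lerD; last by rewrite ?cmodulusN).
      by rewrite cmodulusN.
    have cs : c * s <= e / 4%:R.
      apply: (@le_trans _ _ ((c + 1) * s)); first by rewrite ler_pM2r// lerDl.
      have : s <= e / (4%:R * (c + 1)) by rewrite ge_min lexx orbT.
      by rewrite !ler_pdivlMr ?mulr_gt0//; lra.
    have := ler_wpM2r (ltW s0) cs; rewrite expr2; lra.
  apply: (@expand_derivable R _ _ al) => e e0.
  exists (Num.min rho (e / (c + 1))).
    by rewrite lt_min rho0; apply: divr_gt0.
  move=> k; rewrite le_min => /andP[kr ke].
  apply: (@le_trans _ _ (c * cmodulus k ^+ 2)); last first.
    rewrite expr2 mulrA; apply: ler_wpM2r; first exact: cmodulus_ge0.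
    move: ke; rewrite ler_pdivlMr// => ke; have := cmodulus_ge0 k; lra.
  apply/ler_addgt0Pl => e' e'0.
  have k1 : 0 < cmodulus k + 2 by rewrite ltr_wpDl ?cmodulus_ge0.
  have e1 : 0 < e' / (cmodulus k + 2) by rewrite divr_gt0.
  have [N1 h1] := hh z _ e1; have [N2 h2] := hh (z + k) _ e1; have [N3 h3] := hal _ e1.
  pose n := maxn (maxn N0 N1) (maxn N2 N3).
  have n0 : (N0 <= n)%N by rewrite !leq_max leqnn.
  have n1 : (N1 <= n)%N by rewrite !leq_max leqnn ?orbT.
  have n2 : (N2 <= n)%N by rewrite !leq_max leqnn ?orbT.
  have n3 : (N3 <= n)%N by rewrite !leq_max leqnn ?orbT.
  have -> : h (z + k) - h z - al * k = (u n (z + k) - u n z - a n * k) -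
     (u n (z + k) - h (z + k)) + (u n z - h z) + (a n - al) * k by ring.
  have b1 := h1 _ n1; have b2 := h2 _ n2; have b3 := h3 _ n3; have b4 := ha n n0 k kr.
  have b5 : cmodulus ((a n - al) * k) <= e' / (cmodulus k + 2) * cmodulus k.
    by rewrite cmodulusM ler_wpM2r ?cmodulus_ge0.
  apply: (@le_trans _ _ (c * cmodulus k ^+ 2 + e' / (cmodulus k + 2) + e' / (cmodulus k + 2) +
     e' / (cmodulus k + 2) * cmodulus k)).
    do 3 (apply: (le_trans (cmodulusD _ _)); apply: lerD; last by rewrite ?cmodulusN).
    exact: b4.
  apply: le_of_eq; field.
  by rewrite gt_eqF.
have bh : h \in bergman_pred by rewrite inE; split.
exists (Bergman bh) => e e0; have [N hN] := fat e e0; exists N => n Nn.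
have := hN n Nn.
have -> : (fun z => u n z - h z) = (u n - Bergman bh : bergman R) by [].
rewrite L2_sqnorm; last exact: bergmanL2.
by rewrite lee_fin -nrm_sqr ler_sqr// ?nnegrE ?nrm_ge0// ltW.
Qed.

End Completeness.

(** * Riesz representation and the Bergman projection *)

Section Projection.
Context {R : realType}.
Local Notation C := (Cplx R).
Implicit Types (f g h k : bergman R) (r e : R) (c : C).

Lemma bipDl f g h : ip (f + g) h = ip f h + ip g h.
Proof. exact: (ipDl (bergmanL2 f) (bergmanL2 g) (bergmanL2 h)). Qed.

Lemma bipBl f g h : ip (f - g) h = ip f h - ip g h.
Proof. exact: (ipBl (bergmanL2 f) (bergmanL2 g) (bergmanL2 h)). Qed.

Lemma bipZl r f h : ip (r%:C *: f) h = r * ip f h.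
Proof. exact: (ipZl r (bergmanL2 f) (bergmanL2 h)). Qed.

Lemma bipMl c f (h : C -> C) : ip (c *: f) h = ip f (fun z => c^* * h z).
Proof. exact: (ipMl (fun=> c) f h). Qed.

Lemma bipDr f g h : ip h (f + g) = ip h f + ip h g.
Proof. by rewrite ipC bipDl !(ipC h). Qed.

Lemma bipBr f g h : ip h (f - g) = ip h f - ip h g.
Proof. by rewrite ipC bipBl !(ipC h). Qed.

Lemma bipZr r f h : ip h (r%:C *: f) = r * ip h f.
Proof. by rewrite ipC bipZl (ipC h). Qed.

Lemma bCS f g : `|ip f g| <= nrm f * nrm g.
Proof. exact: (ip_CauchySchwarz (bergmanL2 f) (bergmanL2 g)). Qed.

Lemma bnrmZ c f : nrm (c *: f) = cmodulus c * nrm f.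
Proof. exact: (nrmZ c (bergmanL2 f)). Qed.

Lemma bnrmD f g : nrm (f + g) <= nrm f + nrm g.
Proof. exact: (nrm_triangle (bergmanL2 f) (bergmanL2 g)). Qed.

Lemma bnrmN f : nrm (- f) = nrm f.
Proof. by rewrite -scaleN1r bnrmZ cmodulusN (cmodulusR 1) normr1 mul1r. Qed.

Lemma bnrmB f g : nrm (f - g) <= nrm f + nrm g.
Proof. by rewrite -(bnrmN g) bnrmD. Qed.

Lemma bnrm_eq0 f : nrm f = 0 -> f = 0.
Proof. by move=> h; apply: normr0_eq0; rewrite bergman_normE h. Qed.

Lemma ip_inj f g : (forall k, ip f k = ip g k) -> f = g.
Proof.
move=> h; apply/eqP; rewrite -subr_eq0; apply/eqP/bnrm_eq0.
by rewrite /nrm -ipE bipBl h subrr sqrtr0.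
Qed.

(** The functional J f = |f|^2 - 2 l(f) is bounded below. The parallelogram identity makes a
    minimising sequence Cauchy, and the first variation of J shows that its limit represents [l]. *)
Lemma Riesz (l : bergman R -> R) (M : R) :
  (forall f g, l (f + g) = l f + l g) -> (forall r f, l (r%:C *: f) = r * l f) ->
  (forall f, `|l f| <= M * nrm f) ->
  exists h, forall k, ip h k = l k.
Proof.
move=> lD lZ lM.
pose J f := nsq f - 2 * l f.
have J_lb f : - M ^+ 2 <= J f.
  have := lM f; rewrite ler_norml /J -nrm_sqr => /andP[_ h].
  have := sqr_ge0 (nrm f - M); rewrite sqrrB mulr2n; lra.
pose m := inf (range J).
have hasm : has_inf (range J) by split; [exists (J 0), 0|exists (- M ^+ 2) => _ [f _ <-]].
have Jm f : m <= J f by apply: ge_inf; [exact: hasm.2|exists f].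
have seq n : exists f, J f <= m + n.+1%:R^-1.
  have n0 : 0 < (n.+1%:R^-1 : R) by rewrite invr_gt0.
  by have [_ [f _ <-] /ltW hf] := inf_adherent n0 hasm; exists f.
have [u hu] := choice seq.
have JE f k r : J (f + r%:C *: k) = J f + 2 * r * (ip f k - l k) + r ^+ 2 * nsq k.
  rewrite /J -!ipE bipDl !bipDr !bipZl !bipZr lD lZ (ipC k f); ring.
(* On the line through [u n] in direction [k] the values of [J] drop by at most 1/(n+1) below
   [J (u n)]; for a quadratic in r this bounds the linear coefficient. *)
have key n k : (ip (u n) k - l k) ^+ 2 <= nsq k * n.+1%:R^-1.
  have Q r : 0 <= r ^+ 2 * nsq k + 2 * r * (ip (u n) k - l k) + n.+1%:R^-1.
    have := Jm (u n + r%:C *: k); rewrite JE; have := hu n.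
    move: (J (u n)) (n.+1%:R^-1) (ip (u n) k - l k) (nsq k) => j e i q h1 h2; lra.
  move: (ip (u n) k - l k) (nsq k) (n.+1%:R^-1) (nsq_ge0 k) Q => I G e G0 Q.
  have [G1|G1] := eqVneq G 0.
    rewrite G1 mul0r; have [->|I0] := eqVneq I 0; first by rewrite expr0n.
    have := Q (- (e + 1) / (2 * I)); rewrite G1.
    have -> : (- (e + 1) / (2 * I)) ^+ 2 * 0 + 2 * (- (e + 1) / (2 * I)) * I + e = -1 by field.
    by rewrite oppr_ge0 ler10.
  have Gp : 0 < G by rewrite lt_neqAle eq_sym G1.
  have := Q (- I / G).
  have -> : (- I / G) ^+ 2 * G + 2 * (- I / G) * I + e = (G * e - I ^+ 2) / G by field.
  by rewrite pmulr_lge0 ?invr_gt0// subr_ge0.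
have par f g : nsq (f - g) = 2 * J f + 2 * J g - 4%:R * J ((2^-1)%:C *: (f + g)).
  rewrite /J -!ipE bipBl !bipBr bipZl bipZr bipDl !bipDr lZ lD (ipC g f).
  by move: (ip f f) (ip g g) (ip f g) (l f) (l g) => a b c d e; field.
have arch e : 0 < e -> exists N : nat, forall n, (N <= n)%N -> n.+1%:R^-1 <= e.
  move=> e0; exists (Num.truncn e^-1) => n Nn.
  rewrite -[leRHS]invrK lef_pV2 ?posrE ?invr_gt0//.
  by apply: (le_trans (ltW (truncnS_gt _))); rewrite ler_nat ltnS.
have [h hh] : exists h, forall e, 0 < e -> exists N, forall n, (N <= n)%N -> nrm (u n - h) <= e.
  apply: bergman_complete => e e0.
  have [N hN] := arch (e ^+ 2 / 4%:R) ltac:(by rewrite divr_gt0// exprn_gt0).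
  exists N => n p Nn Np; rewrite -ler_sqr ?nnegrE ?nrm_ge0 ?(ltW e0)// nrm_sqr par.
  have := Jm ((2^-1)%:C *: (u n + u p)); have := hu n; have := hu p.
  have := hN n Nn; have := hN p Np.
  move: (J ((2^-1)%:C *: (u n + u p))) (J (u n)) (J (u p)) (n.+1%:R^-1) (p.+1%:R^-1) (e ^+ 2).
  by move=> j1 j2 j3 e1 e2 e3 h1 h2 h3 h4 h5; lra.
exists h => k; apply/eqP; rewrite -subr_eq0 -normr_eq0; apply/eqP/le_anti.
rewrite normr_ge0 andbT; apply/ler_addgt0Pl => e e0; rewrite addr0.
have k1 : 0 < nrm k + 1 by rewrite ltr_wpDl ?nrm_ge0.
have k0 : 0 < nsq k + 1 by rewrite ltr_wpDl ?nsq_ge0.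
have e1 : 0 < e / 2 / (nrm k + 1) by rewrite !divr_gt0.
have e2 : 0 < (e / 2) ^+ 2 / (nsq k + 1) by rewrite divr_gt0// exprn_gt0// divr_gt0.
have [N1 h1] := hh _ e1; have [N2 h2] := arch _ e2.
pose n := maxn N1 N2.
have b1 := h1 n (leq_maxl _ _); have b2 := h2 n (leq_maxr _ _).
have -> : ip h k - l k = - ip (u n - h) k + (ip (u n) k - l k) by rewrite bipBl; ring.
apply: (le_trans (ler_normD _ _)); rewrite (splitr e) normrN; apply: lerD.
  apply: (le_trans (bCS _ _)); apply: (le_trans (ler_wpM2r (nrm_ge0 _) b1)).
  by rewrite mulrAC ler_pdivrMr// ler_pM2l ?divr_gt0// lerDl.
rewrite -ler_sqr ?nnegrE ?(ltW (divr_gt0 e0 _))// real_normK ?num_real//.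
apply: (le_trans (key n k)); apply: (le_trans (ler_wpM2l (nsq_ge0 _) b2)).
by rewrite mulrCA ler_piMr ?sqr_ge0// ler_pdivrMr// mul1r lerDl.
Qed.

Lemma inner_discE (f : C -> C) k : inner_disc f k = ip f k +i* ip f (fun z => (0 +i* 1) * k z).
Proof.
rewrite /inner_disc /integral_disc; congr (_ +i* _); apply: eq_Rintegral => p _; rewrite /dot.
  by case: (f _) => a b; case: (k _) => a' b' /=; ring.
by case: (f _) => a b; case: (k _) => a' b' /=; ring.
Qed.

(** Riesz for the pairing with [g] gives an element whose difference from [g] is orthogonal to the
    space for the real product, and, on testing against i k, for the complex one. So the [xget] in
    [bergman_proj] does not fall back on its default. *)
Lemma bergman_projP (g : C -> C) : L2_disc g -> forall k, ip (bergman_proj g) k = ip g k.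
Proof.
move=> Lg; have [h hh] := Riesz (l := fun k => ip g k) (M := nrm g)
  (fun f k => etrans (ipC _ _) (etrans (ipDl (bergmanL2 f) (bergmanL2 k) Lg)
     (congr2 _ (ipC _ _) (ipC _ _))))
  (fun r f => etrans (ipC _ _) (etrans (ipZl r (bergmanL2 f) Lg) (congr1 _ (ipC _ _))))
  (fun f => ip_CauchySchwarz Lg (bergmanL2 f)).
have hB k' (k : bergman R) : ip (g - (k' : bergman R) : C -> C) k = ip g k - ip k' k.
  exact: (ipBl Lg (bergmanL2 k') (bergmanL2 k)).
have hP : [set h : bergman R | forall k : bergman R, inner_disc (g - (h : C -> C)) k = 0] h.
  move=> k; rewrite inner_discE hB hh subrr.
  have := hB h ((0 +i* 1 : C) *: k); rewrite hh subrr => E.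
  by rewrite [X in _ +i* X]E.
have := @xgetPex _ 0 _ (ex_intro _ h hP); rewrite -/(bergman_proj g) => P k.
have := P k; rewrite inner_discE hB => -[/eqP + _].
by rewrite subr_eq0 => /eqP.
Qed.

End Projection.

(** * Toeplitz operators with bounded symbols *)

Section Toeplitz.
Context {R : realType}.
Local Notation C := (Cplx R).
Implicit Types (f g h k : bergman R) (r e M : R) (c : C) (a b : C -> C).

Definition bounded_symbol a M := measurable_disc a /\ forall z, unit_disc z -> cmodulus (a z) <= M.

Lemma L2_symbol a M f : bounded_symbol a M -> L2_disc (fun z => a z * f z).
Proof. by move=> [ma aM]; exact: (L2M ma aM (bergmanL2 f)). Qed.

Lemma toeplitzP a M f k : bounded_symbol a M -> ip (toeplitz a f) k = ip (fun z => a z * f z) k.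
Proof. by move=> sa; apply: bergman_projP; exact: L2_symbol sa. Qed.

Lemma bounded_symbol_ge0 a M : bounded_symbol a M -> 0 <= M.
Proof.
move=> [_ h]; apply: (le_trans (cmodulus_ge0 (a 0))); apply: h.
by rewrite /unit_disc/= normr0 ltr01.
Qed.

Lemma toeplitzD a M f g : bounded_symbol a M -> toeplitz a (f + g) = toeplitz a f + toeplitz a g.
Proof.
move=> sa; apply: ip_inj => k; rewrite bipDl.
apply: (etrans (toeplitzP (f + g) k sa)).
apply: (etrans _ (esym (congr2 +%R (toeplitzP f k sa) (toeplitzP g k sa)))).
have -> : (fun z => a z * (f + g) z) = (fun z => a z * f z + a z * g z).
  by apply/funext => z; exact: (mulrDr (a z) (f z) (g z)).
exact: (ipDl (L2_symbol f sa) (L2_symbol g sa) (bergmanL2 k)).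
Qed.

Lemma toeplitzZ a M c f : bounded_symbol a M -> toeplitz a (c *: f) = c *: toeplitz a f.
Proof.
move=> sa; apply: ip_inj => k; rewrite (toeplitzP _ _ sa) bipMl.
have -> : (fun z => c^* * k z) = (c^* *: k : bergman R) by [].
rewrite (toeplitzP f _ sa) -[RHS](ipMl (fun=> c)).
have -> // : (fun z => a z * (c *: f) z) = (fun z => c * (a z * f z)).
by apply/funext => z; exact: (mulrCA (a z) c (f z)).
Qed.

Lemma toeplitzB a M f g : bounded_symbol a M -> toeplitz a (f - g) = toeplitz a f - toeplitz a g.
Proof. by move=> sa; rewrite (toeplitzD _ _ sa) -scaleN1r (toeplitzZ _ _ sa) scaleN1r. Qed.

Lemma nrm_toeplitz a M f : bounded_symbol a M -> nrm (toeplitz a f) <= M * nrm f.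
Proof.
move=> sa; have M0 := bounded_symbol_ge0 sa.
have [->|h] := eqVneq (nrm (toeplitz a f)) 0; first by rewrite mulr_ge0 ?nrm_ge0.
have hp : 0 < nrm (toeplitz a f) by rewrite lt_neqAle eq_sym h nrm_ge0.
rewrite -(ler_pM2r hp) -expr2 nrm_sqr -ipE (toeplitzP _ _ sa).
apply: (le_trans (ler_norm _)); apply: (le_trans (ip_CauchySchwarz (L2_symbol f sa) (bergmanL2 _))).
rewrite ler_pM2r// -ler_sqr ?nnegrE ?mulr_ge0 ?nrm_ge0// exprMn !nrm_sqr.
by case: sa => ma aM; exact: (nsqM_le ma aM (bergmanL2 f)).
Qed.

Lemma toeplitz_adj a M f g : bounded_symbol a M ->
  ip (toeplitz a f) g = ip f (toeplitz (fun z => (a z)^*) g).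
Proof.
move=> sa; rewrite (toeplitzP _ _ sa) ipMl [RHS]ipC.
have sc : bounded_symbol (fun z => (a z)^* : C) M.
  case: sa => [[mr mi] aM]; split; last by move=> z /aM; rewrite cmodulus_conj.
  split.
    by move: mr; congr measurable_fun; apply/funext => p; case: (a _).
  rewrite (_ : (fun _ => _) = (fun p => - complex.Im (a (to_cplx p)))).
    exact: measurableT_comp.
  by apply/funext => p; case: (a _).
by rewrite (toeplitzP _ _ sc) ipC.
Qed.

Lemma toeplitz_symD a b M M' f : bounded_symbol a M -> bounded_symbol b M' ->
  toeplitz (fun z => a z + b z) f = toeplitz a f + toeplitz b f.
Proof.
move=> sa sb; have sab : bounded_symbol (fun z => a z + b z) (M + M').
  split; first exact: (measurable_discD sa.1 sb.1).
  by move=> z hz; apply: (le_trans (cmodulusD _ _)); rewrite lerD ?sa.2 ?sb.2.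
apply: ip_inj => k; rewrite bipDl.
apply: (etrans (toeplitzP f k sab)).
apply: (etrans _ (esym (congr2 +%R (toeplitzP f k sa) (toeplitzP f k sb)))).
have -> : (fun z => (a z + b z) * f z) = (fun z => a z * f z + b z * f z).
  by apply/funext => z; exact: (mulrDl (a z) (b z) (f z)).
exact: (ipDl (L2_symbol f sa) (L2_symbol f sb) (bergmanL2 k)).
Qed.

Lemma bounded_symbol_cst c : bounded_symbol (fun=> c) (cmodulus c).
Proof. by split=> //; exact: measurable_disc_cst. Qed.

Lemma toeplitz_cst c f : toeplitz (fun=> c) f = c *: f.
Proof. by apply: ip_inj => k; rewrite (toeplitzP _ _ (bounded_symbol_cst c)). Qed.

Lemma toeplitz_bounded a M : bounded_symbol a M -> bounded_operator (toeplitz a).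
Proof.
move=> sa; split; first by move=> c f g; rewrite (toeplitzD _ _ sa) (toeplitzZ _ _ sa).
exists (M%:C) => f; rewrite !bergman_normE -rmorphM lecR.
exact: (nrm_toeplitz f sa).
Qed.

Lemma evaluation_kernel (z : C) : unit_disc z -> exists k, forall f, ip f k = complex.Re (f z).
Proof.
move=> hz; have [M M0 hM] := disc_bound hz.
have [||f|h hh] := @Riesz R (fun f => complex.Re (f z)) M.
- move=> f g; rewrite (_ : (f + g : bergman R) z = f z + g z)//.
  by case: (f z) => ? ?; case: (g z).
- move=> r f; rewrite (_ : (r%:C *: f : bergman R) z = r%:C * f z)//.
  by case: (f z) => x y /=; ring.
- exact: le_trans (normRe_le _) (hM f).
by exists h => f; rewrite ipC hh.
Qed.

End Toeplitz.

(** * Bergman functions near small squares *)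

Section TestFunction.
Context {R : realType}.
Local Notation mu := (@lebesgue_measure R).
Local Notation plane := (measurableTypeR R * measurableTypeR R)%type.
Local Notation C := (Cplx R).
Local Notation D := (@disc_coord R).
Implicit Types (x y a b c t rho : R).

Lemma lorentz_gt0 t c y : 0 < t -> 0 < t ^+ 2 + (y - c) ^+ 2.
Proof. by move=> t0; rewrite ltr_pwDl ?exprn_gt0// sqr_ge0. Qed.

Lemma lorentz_continuous t c : 0 < t -> continuous (fun y : R => (t ^+ 2 + (y - c) ^+ 2)^-1).
Proof.
move=> t0 y; apply: cvgV; first by rewrite gt_eqF// lorentz_gt0.
have -> : (fun y : R => t ^+ 2 + (y - c) ^+ 2) = (fun y => t ^+ 2 + (y - c) * (y - c)).
  by apply/funext => z; rewrite (expr2 (z - c)).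
rewrite (expr2 (y - c)); apply: cvgD; first exact: cvg_cst.
by apply: cvgM; apply: cvgB; (exact: cvg_id || exact: cvg_cst).
Qed.

Lemma lorentz_primitive t c y : 0 < t ->
  is_derive y 1 (fun y => t^-1 * atan (t^-1 * (y - c))) (t ^+ 2 + (y - c) ^+ 2)^-1.
Proof.
move=> t0.
have d1 : is_derive y 1 (fun y : R => t^-1 * (y - c)) t^-1.
  have := is_deriveZ t^-1 (is_deriveB (is_derive_id y (1 : R)) (is_derive_cst c y (1 : R))).
  by move=> /is_derive_eq; apply; rewrite subr0 /GRing.scale/= mulr1.
have d2 := is_deriveZ t^-1 (@is_derive1_comp R (@atan R) (fun y => t^-1 * (y - c)) y _ _ (is_derive1_atan (t^-1 * (y - c))) d1).
have E : (t^-1 *: ((1 + (t^-1 * (y - c)) ^+ 2)^-1 * t^-1)) = (t ^+ 2 + (y - c) ^+ 2)^-1.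
  rewrite /GRing.scale/= -!invfM; congr (_^-1).
  by field; rewrite gt_eqF.
exact: (is_derive_eq d2 E).
Qed.

Lemma lorentz_integral t c a b : 0 < t -> a < b ->
  (\int[mu]_(y in `[a, b]) ((t ^+ 2 + (y - c) ^+ 2)^-1)%:E <= (pi / t)%:E)%E.
Proof.
move=> t0 ab; pose F y : R := t^-1 * atan (t^-1 * (y - c)).
have dF y : derivable F y 1 by have [] := lorentz_primitive c y t0.
have cF : continuous F.
  by move=> y; apply: differentiable_continuous; apply/derivable1_diffP.
rewrite (@continuous_FTC2 R _ F a b ab); first last.
- by move=> y _; rewrite derive1E; have [_ h] := lorentz_primitive c y t0; exact: h.
- split.
  + by move=> y _.
  + exact: cvg_at_right_filter (cF a).
  + exact: cvg_at_left_filter (cF b).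
- by apply: continuous_subspaceT; exact: lorentz_continuous.
rewrite -EFinB lee_fin /F -mulrBr [leRHS]mulrC ler_pM2l ?invr_gt0//.
have := atan_ltpi2 (t^-1 * (b - c)); have := atan_gtNpi2 (t^-1 * (a - c)); lra.
Qed.

Lemma derivable_local (f g : C -> C) z (d : R) : 0 < d ->
  (forall k : C, cmodulus k <= d -> f (z + k) = g (z + k)) -> derivable f z 1 -> derivable g z 1.
Proof.
move=> d0 fg /derivable_expand[a ha]; apply: (@expand_derivable R _ _ a) => e e0.
have [d1 d10 hd] := ha e e0; exists (Num.min d d1); first by rewrite lt_min d0.
have fgz : f z = g z by rewrite -[z]addr0; apply: fg; rewrite cmodulus0 ltW.
by move=> k; rewrite le_min => /andP[k1 k2]; rewrite -(fg k k1) -fgz; exact: hd.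
Qed.

(** Up to a constant factor, the Bergman kernel at the real point [rho]. *)
Definition peak (rho : R) (z : C) : C :=
  if cmodulus z < 1 then (1 - rho%:C * z)^-1 ^+ 2 else 0.

Lemma one_sub_mul_norm rho x y : cmodulus (1 - rho%:C * to_cplx (x, y) : C) ^+ 2 =
  (1 - rho * x) ^+ 2 + (rho * y) ^+ 2.
Proof. by rewrite cmodulus_sqr /=; ring. Qed.

Lemma unit_discE (z : C) : unit_disc z = (cmodulus z < 1) :> Prop.
Proof. by rewrite /unit_disc/= -[1 in LHS]/(1%:C : R[i]) -cmodulus_ltE. Qed.

Lemma one_sub_mul_neq0 rho (z : C) : 0 < rho -> rho < 1 -> cmodulus z < 1 -> 1 - rho%:C * z != 0.
Proof.
move=> r0 r1 z1; rewrite subr_eq0; apply/eqP => E.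
have : cmodulus (rho%:C * z : C) = 1 by rewrite -E (cmodulusR 1) normr1.
rewrite cmodulusM cmodulusR gtr0_norm// => h.
have : rho * cmodulus z < 1.
  apply: (@le_lt_trans _ _ rho) => //; rewrite ler_piMr ?(ltW r0)// ltW//.
by rewrite h ltxx.
Qed.

Lemma peak_analytic rho : 0 < rho -> rho < 1 -> analytic_disc (peak rho).
Proof.
move=> r0 r1 z; rewrite unit_discE => z1.
have d0 : 0 < (1 - cmodulus z) / 2 by rewrite divr_gt0// subr_gt0.
apply: (@derivable_local (fun z : C => ((1 - rho%:C * z)^-1 : C) * (1 - rho%:C * z)^-1) _ z _ d0).
  move=> k hk; rewrite /peak ifT ?expr2//.
  apply: (le_lt_trans (cmodulusD _ _)); lra.
have dv : derivable (fun z : C => (1 - rho%:C * z)^-1 : C) z 1.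
  apply: derivableV; first exact: one_sub_mul_neq0.
  apply: (@expand_derivable R _ _ (- rho%:C)) => e e0; exists 1 => // k _.
  have -> : 1 - rho%:C * (z + k) - (1 - rho%:C * z) - - rho%:C * k = 0 by ring.
  by rewrite cmodulus0 mulr_ge0 ?cmodulus_ge0// ltW.
exact: derivableM.
Qed.

Lemma peak_norm rho x y : cmodulus (to_cplx (x, y)) < 1 ->
  cmodulus (peak rho (to_cplx (x, y))) ^+ 2 = (((1 - rho * x) ^+ 2 + (rho * y) ^+ 2)^-1) ^+ 2.
Proof.
move=> h; rewrite /peak h [X in cmodulus X]expr2 cmodulusM cmodulusV -one_sub_mul_norm.
by congr (_ ^+ 2); rewrite [in RHS]expr2 invfM.
Qed.

Lemma peak_measurable rho : measurable_disc (peak rho).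
Proof.
have mD := @measurable_disc_coord R.
pose v (p : plane) : R := (1 - rho * p.1) ^+ 2 + (rho * p.2) ^+ 2.
have mx : measurable_fun D (fun p : plane => 1 - rho * p.1).
  apply: measurable_funB => //; apply: measurable_funM => //.
  by apply: (@measurable_funS _ _ _ _ setT) => //; exact: measurable_fst.
have my : measurable_fun D (fun p : plane => rho * p.2).
  apply: measurable_funM => //.
  by apply: (@measurable_funS _ _ _ _ setT) => //; exact: measurable_snd.
have mv : measurable_fun D v by apply: measurable_funD; apply: measurable_funX.
have mi : measurable_fun D (fun p => (v p)^-1).
  rewrite (_ : (fun p => _) = (fun r : R => r `^ (-1)) \o v).
    by apply: measurableT_comp => //; exact: measurable_powR.
  by apply/funext => p /=; rewrite powR_inv1// addr_ge0 ?sqr_ge0.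
have E (p : plane) : D p -> peak rho (to_cplx p) =
    (((1 - rho * p.1) ^+ 2 - (rho * p.2) ^+ 2) * (v p)^-1 ^+ 2) +i*
    (2 * ((1 - rho * p.1) * (rho * p.2)) * (v p)^-1 ^+ 2).
  rewrite /disc_coord /preimage /= unit_discE => h; rewrite /peak h.
  have -> : (1 - rho%:C * to_cplx p : C)^-1 = ((1 - rho * p.1) * (v p)^-1) +i* ((rho * p.2) * (v p)^-1).
    have -> : (1 - rho%:C * to_cplx p : C) = (1 - rho * p.1) +i* (- (rho * p.2)).
      by apply/eqP; rewrite eq_complex /=; apply/andP; split; apply/eqP; ring.
    apply/eqP; rewrite eq_complex /= /v !sqrrN mulNr opprK.
    by apply/andP; split; apply/eqP.
  by apply/eqP; rewrite eq_complex expr2 /=; apply/andP; split; apply/eqP; ring.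
split.
- apply: (eq_measurable_fun (fun p : plane => ((1 - rho * p.1) ^+ 2 - (rho * p.2) ^+ 2) * (v p)^-1 ^+ 2)).
    by move=> p /set_mem Dp; rewrite E.
  by apply: measurable_funM; [apply: measurable_funB; apply: measurable_funX|exact: measurable_funX].
- apply: (eq_measurable_fun (fun p : plane => 2 * ((1 - rho * p.1) * (rho * p.2)) * (v p)^-1 ^+ 2)).
    by move=> p /set_mem Dp; rewrite E.
  apply: measurable_funM; last exact: measurable_funX.
  by apply: measurable_funM => //; exact: measurable_funM.
Qed.

(** Put S = t^2 + (x - 1)^2 + y^2. Then S <= 4 |1 - (1 - t) z|^2, and S^2 dominates the product of
    t^2 + (x - 1)^2 and t^2 + y^2. So the integrand is at most 16 times a product of two Lorentz
    profiles, each of integral at most pi / t, and Tonelli applies. *)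
Lemma peak_sqnorm t : 0 < t -> t <= 4^-1 ->
  (sqnorm_disc (peak (1 - t)) <= (16%:R * (pi / t) * (pi / t))%:E)%E.
Proof.
move=> t0 t4; pose A c y : R := ((t ^+ 2 + (y - c) ^+ 2)^-1) * \1_(`[-1, 1]%classic) y.
have mA c : measurable_fun [set: measurableTypeR R] (A c).
  by apply: measurable_funM => //; apply: continuous_measurable_fun; exact: lorentz_continuous.
have A0 c y : 0 <= A c y.
  by rewrite mulr_ge0// invr_ge0 ltW// lorentz_gt0.
have IA c : (\int[mu]_y (A c y)%:E <= (pi / t)%:E)%E.
  apply: le_trans (lorentz_integral c t0 (_ : -1 < 1)); last by lra.
  rewrite [leRHS]integral_mkcond; apply: ge0_le_integral => //.
  - by move=> y _; rewrite lee_fin.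
  - exact/measurable_EFinP.
  - apply/(measurable_restrictT _ (measurable_itv _)); apply/measurable_EFinP.
    apply: (@measurable_funS _ _ _ _ setT) => //.
    by apply: continuous_measurable_fun; exact: lorentz_continuous.
  - by move=> y _; rewrite /A patchE indicE; case: ifP => _; rewrite ?mulr1 ?mulr0.
pose F (p : plane) : \bar R := (16%:R * A 1 p.1 * A 0 p.2)%:E.
have mF : measurable_fun [set: plane] F.
  apply/measurable_EFinP; apply: measurable_funM; first apply: measurable_funM => //.
    exact: (measurableT_comp (mA 1) measurable_fst).
  exact: (measurableT_comp (mA 0) measurable_snd).
have F0 p : (0 <= F p)%E.
  by rewrite lee_fin; exact: (mulr_ge0 (mulr_ge0 (ler0n R 16) (A0 1 _)) (A0 0 _)).
have mD := @measurable_disc_coord R.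
apply: (@le_trans _ _ (\int[area]_p F p)%E).
  apply: (@le_trans _ _ (\int[area]_(p in D) F p)%E); last first.
    by apply: ge0_subset_integral.
  apply: ge0_le_integral => //.
  - by move=> p _; rewrite lee_fin sqr_ge0.
  - exact: (measurable_sqr_cmodulus (peak_measurable _)).
  - exact: (@measurable_funS _ _ _ _ setT).
  move=> [x y]; rewrite {1}/disc_coord /preimage /= unit_discE => h; rewrite lee_fin peak_norm//.
  have x1 : `|x| <= 1 by apply: (le_trans (normRe_le (to_cplx (x, y)))); exact: ltW.
  have y1 : `|y| <= 1 by apply: (le_trans (normIm_le (to_cplx (x, y)))); exact: ltW.
  rewrite /A !indicE !mem_set; [|by rewrite /= in_itv /= -ler_norml..].
  rewrite !mulr1 -mulrA -invfM exprVn -[16%:R]invrK -invfM.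
  have := lorentz_gt0 1 x t0; have := lorentz_gt0 0 y t0.
  set P := t ^+ 2 + (x - 1) ^+ 2; set Q := t ^+ 2 + (y - 0) ^+ 2 => Q0 P0.
  have PQ : 0 < 16%:R^-1 * (P * Q) by rewrite !mulr_gt0// invr_gt0.
  set V := (1 - (1 - t) * x) ^+ 2 + ((1 - t) * y) ^+ 2.
  have hV : t ^+ 2 + (x - 1) ^+ 2 + y ^+ 2 <= 4%:R * V.
    move: x1 y1; rewrite !ler_norml => /andP[x1 x2] /andP[y1 y2].
    have VE : V = t ^+ 2 + 2 * (t * ((1 - t) * (1 - x))) + (1 - t) ^+ 2 * (1 - x) ^+ 2 +
      (1 - t) ^+ 2 * y ^+ 2 by rewrite /V; ring.
    have r1 : 3%:R / 4%:R <= 1 - t by lra.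
    have s0 : 0 <= 1 - x by lra.
    have q1 : (3%:R / 4%:R) ^+ 2 <= (1 - t) ^+ 2 by rewrite ler_sqr ?nnegrE; lra.
    have q2 := ler_wpM2r (sqr_ge0 y) q1.
    have q3 := ler_wpM2r (sqr_ge0 (1 - x)) q1.
    have q4 : 0 <= t * ((1 - t) * (1 - x)) by rewrite !mulr_ge0//; lra.
    have := sqr_ge0 y; have := sqr_ge0 (1 - x); have := sqr_ge0 t.
    move: q2 q3; rewrite VE expr_div_n.
    rewrite (_ : (x - 1) ^+ 2 = (1 - x) ^+ 2); last by ring.
    move: (t * ((1 - t) * (1 - x))) q4 ((1 - t) ^+ 2 * y ^+ 2) ((1 - t) ^+ 2 * (1 - x) ^+ 2) (y ^+ 2) ((1 - x) ^+ 2) (t ^+ 2).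
    by move=> e1 e2 e3 e4 e5 e6 e7 h1 h2 h3 h4 h5; lra.
  have V0 : 0 < V.
    have : 0 < t ^+ 2 + (x - 1) ^+ 2 + y ^+ 2 by rewrite ltr_wpDr ?sqr_ge0.
    by move=> k; lra.
  rewrite lef_pV2 ?posrE ?exprn_gt0//.
  have PQ2 : P * Q <= (t ^+ 2 + (x - 1) ^+ 2 + y ^+ 2) ^+ 2.
    rewrite /P /Q subr0; have := sqr_ge0 t; have := sqr_ge0 (x - 1); have := sqr_ge0 y.
    move: (t ^+ 2) ((x - 1) ^+ 2) (y ^+ 2) => e1 e2 e3 h3 h2 h1; nra.
  have V2 : (t ^+ 2 + (x - 1) ^+ 2 + y ^+ 2) ^+ 2 <= (4%:R * V) ^+ 2.
    rewrite ler_sqr ?nnegrE ?mulr_ge0 ?(ltW V0)//.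
    by rewrite !addr_ge0 ?sqr_ge0.
  by rewrite exprMn in V2; lra.
rewrite fubini_tonelli1//.
have inner x : fubini_F mu F x = ((16%:R * A 1 x)%:E * \int[mu]_y (A 0 y)%:E)%E.
  rewrite /fubini_F /F /=; under eq_integral do rewrite EFinM.
  rewrite ge0_integralZl_EFin//.
  - by move=> y _; rewrite lee_fin.
  - exact/measurable_EFinP.
  - by rewrite mulr_ge0.
apply: (@le_trans _ _ (\int[mu]_x ((16%:R * A 1 x)%:E * \int[mu]_y (A 0 y)%:E))%E).
  by rewrite le_eqVlt; apply/orP; left; apply/eqP; apply: eq_integral => x _; exact: inner.
rewrite ge0_integralZr//; first last.
- by apply: integral_ge0 => y _; rewrite lee_fin.
- by move=> x _; rewrite lee_fin mulr_ge0.
- by apply/measurable_EFinP; exact: measurable_funM.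
under eq_integral do rewrite EFinM.
rewrite ge0_integralZl_EFin//; first last.
- exact/measurable_EFinP.
- by move=> x _; rewrite lee_fin.
rewrite (EFinM (16%:R * (pi / t))) (EFinM 16%:R); apply: lee_pmul => //.
- by rewrite mule_ge0// integral_ge0// => x _; rewrite lee_fin.
- by apply: integral_ge0 => x _; rewrite lee_fin.
- by apply: lee_pmul => //; apply: integral_ge0 => x _; rewrite lee_fin.
Qed.

Lemma peak_bergman t : 0 < t -> t <= 4^-1 -> bergman_function (peak (1 - t)).
Proof.
move=> t0 t4; split.
- by apply: peak_analytic; lra.
- split; first exact: peak_measurable.
  by apply: (le_lt_trans (peak_sqnorm t0 t4)); rewrite ltry.
- by move=> z; rewrite unit_discE /peak; case: ifP.
Qed.

Lemma peak_lower t x y : 0 < t -> t <= 4^-1 -> cmodulus (to_cplx (x, y)) < 1 ->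
  `|x - (1 - t)| <= t / 2 -> `|y| <= t / 2 ->
  (100%:R * t ^+ 4)^-1 <= cmodulus (peak (1 - t) (to_cplx (x, y))) ^+ 2.
Proof.
move=> t0 t4 h; rewrite !ler_norml => /andP[x1 x2] /andP[y1 y2].
have V0 : 0 < (1 - (1 - t) * x) ^+ 2 + ((1 - t) * y) ^+ 2.
  have h1 : 0 < 1 - (1 - t) * x by nra.
  by rewrite ltr_pwDl ?sqr_ge0// exprn_gt0.
have L0 : 0 < 100%:R * t ^+ 4 by rewrite mulr_gt0 ?exprn_gt0.
rewrite peak_norm// exprVn lef_pV2 ?posrE ?(exprn_gt0 _ V0)//.
have h1 : 0 <= 1 - (1 - t) * x <= 3%:R * t by apply/andP; split; nra.
have h2 : ((1 - t) * y) ^+ 2 <= t ^+ 2.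
  rewrite -(real_normK (num_real ((1 - t) * y))) ler_sqr ?nnegrE ?(ltW t0)//.
  by rewrite ler_norml; apply/andP; split; nra.
have h3 : (1 - (1 - t) * x) ^+ 2 <= (3%:R * t) ^+ 2.
  by case/andP: h1 => h1 h1'; rewrite ler_sqr ?nnegrE// mulr_ge0// ltW.
have -> : 100%:R * t ^+ 4 = (10%:R * t ^+ 2) ^+ 2 by ring.
have T0 : 0 <= 10%:R * t ^+ 2 by rewrite mulr_ge0 ?sqr_ge0.
have VT : (1 - (1 - t) * x) ^+ 2 + ((1 - t) * y) ^+ 2 <= 10%:R * t ^+ 2.
  by rewrite exprMn in h3; lra.
by rewrite ler_sqr ?nnegrE ?(ltW V0).
Qed.

End TestFunction.

(** * Pairs of squares and the normalised mass *)

Section LocalModel.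
Context {R : realType}.
Local Notation plane := (measurableTypeR R * measurableTypeR R)%type.
Local Notation C := (Cplx R).
Local Notation D := (@disc_coord R).
Implicit Types (x y a b c e eta : R) (f g k : bergman R) (m n : nat).

Lemma nsq_cutoff_mono (E E' : set plane) (f : C -> C) : measurable E -> measurable E' ->
  E `<=` E' -> L2_disc f -> nsq (cutoff E f) <= nsq (cutoff E' f).
Proof.
move=> mE mE' EE' Lf.
have -> : cutoff E f = cutoff E (cutoff E' f).
  apply/funext => z; rewrite /cutoff; case: ifPn => // h.
  by rewrite ifT//; move: h; rewrite !inE; exact: EE'.
by apply: nsq_cutoff_le => //; exact: L2_cutoff.
Qed.

Lemma nsq_cutoff_bound (E : set plane) (f : C -> C) (s c : R) : measurable E -> E `<=` D ->
  area E = s%:E -> L2_disc f -> (forall p, E p -> cmodulus (f (to_cplx p)) ^+ 2 <= c) ->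
  nsq (cutoff E f) <= c * s.
Proof.
move=> mE ED aE Lf fc; rewrite nsq_cutoff//.
have := @Rintegral_near_cst R _ _ area E (fun p => cmodulus (f (to_cplx p)) ^+ 2) 0 c s mE aE.
rewrite mul0r subr0 => h; apply: (le_trans (ler_norm _)); apply: h.
  by apply: (integrableS _ _ ED (L2_integrable Lf)) => //; exact: measurable_disc_coord.
by move=> p Ep; rewrite subr0 ger0_norm ?sqr_ge0 ?fc.
Qed.

Lemma nsq_cutoff_lower (E : set plane) (f : C -> C) (s c : R) : measurable E -> E `<=` D ->
  area E = s%:E -> L2_disc f -> (forall p, E p -> c <= cmodulus (f (to_cplx p)) ^+ 2) ->
  c * s <= nsq (cutoff E f).
Proof.
move=> mE ED aE Lf fc; rewrite nsq_cutoff//.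
have <- : \int[area]_(p in E) c = c * s by rewrite Rintegral_cst// aE.
apply: le_Rintegral => //.
  apply/integrableP; split; first exact: measurable_cst.
  by rewrite (integral_cst area mE `|c%:E|%E) aE -EFinM ltry.
by apply: (integrableS _ _ ED (L2_integrable Lf)) => //; exact: measurable_disc_coord.
Qed.

(* 1 - scale m is the centre of the m-th pair of squares; the outer square has  *)
(* half side (scale m) / 2 and the inner one eta * scale m.                     *)
Definition scale m : R := 4%:R ^- m.+1.
Definition site_center m : C := to_cplx (1 - scale m, 0).
Definition outer m : set plane :=
  square ((1 - scale m) - 2 * (scale m / 4%:R)) (0 - 2 * (scale m / 4%:R)) (4%:R * (scale m / 4%:R)).
Definition inner eta m : set plane :=
  square ((1 - scale m) - eta * scale m) (0 - eta * scale m) (eta * scale m + eta * scale m).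

Lemma scale_gt0 m : 0 < scale m.
Proof. by rewrite invr_gt0 exprn_gt0. Qed.

Lemma scale_le m : scale m <= 4^-1.
Proof.
rewrite /scale exprS invfM ler_piMr ?invr_ge0// invf_le1 ?exprn_gt0//.
by rewrite exprn_ege1// ler1n.
Qed.

Lemma measurable_outer m : measurable (outer m).
Proof. exact: measurable_square. Qed.

Lemma measurable_inner eta m : measurable (inner eta m).
Proof. exact: measurable_square. Qed.

Lemma closed_outer_sub m : closed_square (1 - scale m) 0 (2 * (scale m / 4%:R)) `<=` D.
Proof.
have t0 := scale_gt0 m; have t4 := scale_le m.
move=> [x y] [/=]; rewrite subr0 => hx hy.
rewrite /disc_coord /preimage /= unit_discE -(expr_lt1 (n := 2)) ?cmodulus_ge0// cmodulus_sqr /=.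
move: hx hy; move: (scale m) t0 t4 => t t0 t4; rewrite !ler_norml => /andP[h1 h2] /andP[h3 h4].
have hx : x ^+ 2 <= (1 - t / 2) ^+ 2.
  rewrite -(real_normK (num_real x)) ler_sqr ?nnegrE//; last lra.
  by rewrite ler_norml; apply/andP; split; lra.
have hy : y ^+ 2 <= (t / 2) ^+ 2.
  rewrite -(real_normK (num_real y)) ler_sqr ?nnegrE//; last lra.
  by rewrite ler_norml; apply/andP; split; lra.
nra.
Qed.

Lemma outer_sub m : outer m `<=` D.
Proof.
apply: subset_trans (@closed_outer_sub m) => p [/=]; rewrite !in_itv/= => h1 h2.
by split; rewrite ler_norml; lra.
Qed.

Lemma inner_sub_outer eta m : 0 < eta -> eta <= 8%:R^-1 -> inner eta m `<=` outer m.
Proof.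
move=> e0 e8; have t0 := scale_gt0 m; have et : eta * scale m <= scale m / 8%:R.
  by rewrite mulrC ler_pM2l.
have et0 : 0 < eta * scale m by rewrite mulr_gt0.
move=> p [/=]; rewrite /inner /outer !in_itv/= => /andP[h1 h2] /andP[h3 h4].
by split; rewrite /= in_itv/=; apply/andP; split; lra.
Qed.

Lemma inner_sub eta m : 0 < eta -> eta <= 8%:R^-1 -> inner eta m `<=` D.
Proof. by move=> e0 e8; apply: subset_trans (inner_sub_outer e0 e8) (@outer_sub m). Qed.

Lemma inner_close eta m (p : plane) : inner eta m p ->
  `|p.1 - (1 - scale m)| <= eta * scale m /\ `|p.2 - 0| <= eta * scale m.
Proof.
move=> [/=]; rewrite !in_itv/= => /andP[h1 h2] /andP[h3 h4].
by rewrite !ler_norml; split; apply/andP; split; lra.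
Qed.

Lemma outer_disjoint m n : (m < n)%N -> outer m `&` outer n = set0.
Proof.
move=> mn; have tn : scale n <= scale m / 4%:R.
  rewrite /scale -invfM mulrC -exprS lef_pV2 ?posrE ?exprn_gt0//.
  by rewrite ler_weXn2l// ler1n.
have t0 := scale_gt0 m; apply/seteqP; split => // p [[/= h1 _] [/= h2 _]].
move: h1 h2; rewrite !in_itv/= => /andP[h1 h2] /andP[h3 h4]; lra.
Qed.

Lemma area_inner eta m : 0 < eta -> area (inner eta m) = ((2 * (eta * scale m)) ^+ 2)%:E.
Proof.
move=> e0; rewrite area_square; last by rewrite addr_ge0// mulr_ge0 ?ltW ?scale_gt0.
by congr EFin; ring.
Qed.

Lemma outer_value f m x y : `|x - (1 - scale m)| <= scale m / 4%:R -> `|y| <= scale m / 4%:R ->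
  cmodulus (f (to_cplx (x, y))) ^+ 2 <= 64%:R ^+ 2 / scale m ^+ 2 * nsq (cutoff (outer m) f).
Proof.
have t0 := scale_gt0 m; move=> hx hy.
have r0 : 0 < scale m / 8%:R by rewrite divr_gt0.
have CS : closed_square x y (scale m / 8%:R) `<=` D.
  apply: subset_trans (@closed_outer_sub m) => p [h1 h2]; move: hx hy h1 h2.
  rewrite /closed_square/= subr0 !ler_norml => /andP[? ?] /andP[? ?] /andP[? ?] /andP[? ?].
  by split; apply/andP; split; lra.
have QS : square (x - scale m / 8%:R) (y - scale m / 8%:R) (scale m / 8%:R + scale m / 8%:R) `<=` outer m.
  move: hx hy; rewrite !ler_norml => /andP[? ?] /andP[? ?].
  move=> p [/=]; rewrite !in_itv/= => /andP[? ?] /andP[? ?].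
  by split; rewrite /= in_itv/=; apply/andP; split; lra.
have h := bergman_value (bergman_functionP f) r0 CS.
apply: (@le_trans _ _ ((8%:R / (scale m / 8%:R) * nrm (cutoff (outer m) f)) ^+ 2)).
  have v0 : 0 <= 8%:R / (scale m / 8%:R) * nrm (cutoff (outer m) f).
    exact: (mulr_ge0 (divr_ge0 (ler0n R 8) (ltW r0)) (nrm_ge0 _)).
  apply: lerXn2r; [exact: cmodulus_ge0|exact: v0|].
  apply: (le_trans h); apply: ler_wpM2l; first by rewrite divr_ge0// ltW.
  rewrite ler_sqrt ?nsq_ge0//; apply: nsq_cutoff_mono => //; last exact: bergmanL2.
    exact: measurable_square.
  exact: measurable_outer.
rewrite exprMn nrm_sqr; apply: le_of_eq; congr (_ * _).
by field; rewrite gt_eqF.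
Qed.

Lemma center_value f m :
  cmodulus (f (site_center m)) ^+ 2 <= 64%:R ^+ 2 / scale m ^+ 2 * nsq (cutoff (outer m) f).
Proof.
by apply: outer_value; rewrite ?subrr normr0 divr_ge0// ltW// scale_gt0.
Qed.

(** The factor [eta ^+ 2] gained over [outer_value] is where the smallness of the later errors comes
    from. *)
Lemma inner_osc : exists2 K : R, 0 <= K & forall f eta m p, 0 < eta -> eta <= 8%:R^-1 ->
  inner eta m p -> cmodulus (f (to_cplx p) - f (site_center m)) ^+ 2 <=
    K ^+ 2 * eta ^+ 2 / scale m ^+ 2 * nsq (cutoff (outer m) f).
Proof.
have [K K0 lip] := @bergman_lip R; exists (32%:R * K); first by rewrite mulr_ge0.
move=> f eta m [x y] e0 e8 /inner_close[/= hx hy]; have t0 := scale_gt0 m.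
have et : eta * scale m <= scale m / 8%:R by rewrite mulrC ler_pM2l.
have t40 : 0 < scale m / 4%:R by rewrite divr_gt0.
have hx' : `|x - (1 - scale m)| <= scale m / 4%:R by lra.
have hy' : `|y - 0| <= scale m / 4%:R by lra.
have h := lip f (1 - scale m) 0 (scale m / 4%:R) x y (bergman_functionP f) t40 (@closed_outer_sub m) hx' hy'.
have n0 := nrm_ge0 (cutoff (outer m) f).
have k0 : 0 <= K / (scale m / 4%:R) ^+ 2 by rewrite divr_ge0// exprn_ge0// ltW.
apply: (@le_trans _ _ ((K / (scale m / 4%:R) ^+ 2 * (2 * (eta * scale m)) * nrm (cutoff (outer m) f)) ^+ 2)).
  rewrite ler_sqr ?nnegrE ?cmodulus_ge0//; last first.
    by rewrite mulr_ge0// mulr_ge0// mulr_ge0// mulr_ge0// ltW.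
  apply: (le_trans h); apply: ler_wpM2r => //; apply: ler_wpM2l => //; lra.
rewrite exprMn nrm_sqr; apply: le_of_eq; congr (_ * _).
by field; rewrite gt_eqF.
Qed.

Definition mass eta m (f : C -> C) : R := nsq (cutoff (inner eta m) f).
(* height normalises the norm of the localised operator to 1, and weight_at is  *)
(* the height times the area of the inner square.                               *)
Definition top eta m : R := sup [set r | exists2 f : bergman R, nsq f <= 1 & r = mass eta m f].
Definition height eta m : R := (top eta m)^-1.
Definition weight_at eta m : R := (2 * (eta * scale m)) ^+ 2 * height eta m.

Lemma mass_ge0 eta m f : 0 <= mass eta m f. Proof. exact: nsq_ge0. Qed.

Lemma mass_le_outer eta m f : 0 < eta -> eta <= 8%:R^-1 ->
  mass eta m f <= 64%:R ^+ 2 / scale m ^+ 2 * nsq (cutoff (outer m) f) * (2 * (eta * scale m)) ^+ 2.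
Proof.
move=> e0 e8; have t0 := scale_gt0 m.
apply: nsq_cutoff_bound; [exact: measurable_inner|exact: inner_sub|exact: area_inner|exact: bergmanL2|].
move=> p /inner_close[h1 h2]; rewrite [to_cplx p]/(to_cplx (p.1, p.2)).
have et : eta * scale m <= scale m / 8%:R by rewrite mulrC ler_pM2l.
by rewrite subr0 in h2; apply: (@outer_value f m p.1 p.2); lra.
Qed.

Lemma mass_ubound eta m : 0 < eta -> eta <= 8%:R^-1 ->
  has_sup [set r | exists2 f : bergman R, nsq f <= 1 & r = mass eta m f].
Proof.
move=> e0 e8; split.
  exists (mass eta m (0 : bergman R)), 0 => //.
  by rewrite (_ : nsq _ = 0)// -ipE /ip -[RHS](mul0r (fine (area D))) -Rintegral_cst;
    [apply: eq_Rintegral => p _; rewrite /dot /= !mul0r addr0|exact: measurable_disc_coord].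
exists (64%:R ^+ 2 / scale m ^+ 2 * 1 * (2 * (eta * scale m)) ^+ 2) => _ [f f1 ->].
apply: (le_trans (mass_le_outer m f e0 e8)); apply: ler_wpM2r; first exact: sqr_ge0.
apply: ler_wpM2l; first by rewrite divr_ge0 ?sqr_ge0.
apply: le_trans f1; apply: nsq_cutoff_le; [exact: measurable_outer|exact: bergmanL2].
Qed.

Lemma massZ eta m c f : mass eta m (c%:C *: f) = c ^+ 2 * mass eta m f.
Proof.
rewrite /mass -[c ^+ 2](_ : cmodulus (c%:C : C) ^+ 2 = _); last first.
  by rewrite cmodulusR real_normK ?num_real.
rewrite -nsqZ; last by apply: L2_cutoff; [exact: measurable_inner|exact: bergmanL2].
by congr nsq; apply/funext => z; rewrite /cutoff; case: ifP => _ //; rewrite mulr0.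
Qed.

Lemma mass_le_top eta m f : 0 < eta -> eta <= 8%:R^-1 -> mass eta m f <= top eta m * nsq f.
Proof.
move=> e0 e8; have hs := mass_ubound m e0 e8.
have [f0|f0] := eqVneq (nrm f) 0.
  have -> : mass eta m f = 0.
    apply/le_anti; rewrite mass_ge0 andbT.
    apply: le_trans (_ : nsq f <= 0); last by rewrite -nrm_sqr f0 expr0n.
    by apply: nsq_cutoff_le; [exact: measurable_inner|exact: bergmanL2].
  by rewrite -nrm_sqr f0 expr0n mulr0.
have n0 : 0 < nrm f by rewrite lt_neqAle eq_sym f0 nrm_ge0.
have : mass eta m (((nrm f)^-1)%:C *: f) <= top eta m.
  apply: (sup_upper_bound hs); exists (((nrm f)^-1)%:C *: f) => //.
  rewrite -nrm_sqr bnrmZ cmodulusR ger0_norm ?invr_ge0 ?nrm_ge0//.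
  by rewrite mulVf// expr1n.
by rewrite massZ exprVn nrm_sqr mulrC ler_pdivrMr// -nrm_sqr exprn_gt0.
Qed.

(** The product of 16 pi^2 from [peak_sqnorm] and 100 from [peak_lower]. *)
Definition weight_cst : R := (40%:R * pi) ^+ 2.

(** Tested on the peak at the centre of the square: its squared norm is at most 16 pi^2 / scale^2,
    while its squared modulus on the inner square is at least 1 / (100 scale^4). The scale cancels,
    so [height] is O(eta^-2) uniformly in [m]. *)
Lemma top_lower eta m : 0 < eta -> eta <= 8%:R^-1 ->
  4%:R * eta ^+ 2 <= top eta m * weight_cst.
Proof.
move=> e0 e8; have t0 := scale_gt0 m; have t4 := scale_le m.
have bp : peak (1 - scale m) \in bergman_pred.
  by rewrite inE; exact: peak_bergman.
have h1 := mass_le_top m (Bergman bp) e0 e8.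
have h2 : (100%:R * scale m ^+ 4)^-1 * (2 * (eta * scale m)) ^+ 2 <= mass eta m (Bergman bp).
  apply: nsq_cutoff_lower; [exact: measurable_inner|exact: inner_sub|exact: area_inner|exact: bergmanL2|].
  move=> p ip; have [h3 h4] := inner_close ip.
  have et : eta * scale m <= scale m / 8%:R by rewrite mulrC ler_pM2l.
  have Dp : cmodulus (to_cplx (p.1, p.2)) < 1.
    by have := inner_sub e0 e8 ip; rewrite /disc_coord /preimage /= unit_discE.
  rewrite subr0 in h4; apply: (peak_lower t0 t4 Dp); lra.
have h3 : nsq (Bergman bp) <= 16%:R * (pi / scale m) * (pi / scale m).
  rewrite -lee_fin -L2_sqnorm; last exact: bergmanL2.
  exact: peak_sqnorm.
have tp0 : 0 <= top eta m.
  apply: le_trans (mass_ge0 eta m 0) _; apply: (sup_upper_bound (mass_ubound m e0 e8)).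
  exists 0 => //; rewrite (_ : nsq _ = 0)// -ipE /ip -[RHS](mul0r (fine (area D))) -Rintegral_cst;
    [apply: eq_Rintegral => p _; rewrite /dot /= !mul0r addr0|exact: measurable_disc_coord] => //.
have h4 := le_trans h2 (le_trans h1 (ler_wpM2l tp0 h3)).
rewrite /weight_cst; move: h4; move: (scale m) t0 (top eta m) => t t0 T h4.
have k0 : 0 < 100%:R * t ^+ 2 by rewrite mulr_gt0 ?exprn_gt0.
rewrite -(ler_pM2l (_ : 0 < (100%:R * t ^+ 2)^-1)) ?invr_gt0//.
have -> : (100%:R * t ^+ 2)^-1 * (4%:R * eta ^+ 2) = (100%:R * t ^+ 4)^-1 * (2 * (eta * t)) ^+ 2.
  by field; rewrite gt_eqF.
apply: (le_trans h4); apply: le_of_eq.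
by field; rewrite gt_eqF.
Qed.

End LocalModel.

(** * The rank one model at one site *)

Section LocalFacts.
Context {R : realType}.
Local Notation plane := (measurableTypeR R * measurableTypeR R)%type.
Local Notation C := (Cplx R).
Local Notation D := (@disc_coord R).
Implicit Types (x y a b c e eta : R) (f g k : bergman R) (m n : nat).

Lemma weight_cst_gt0 : 0 < @weight_cst R.
Proof. by rewrite exprn_gt0// mulr_gt0 ?pi_gt0. Qed.

Lemma top_gt0 eta m : 0 < eta -> eta <= 8%:R^-1 -> 0 < top eta m.
Proof.
move=> e0 e8; rewrite -(pmulr_lgt0 _ weight_cst_gt0).
by apply: lt_le_trans (top_lower m e0 e8); rewrite mulr_gt0// exprn_gt0.
Qed.

Lemma height_gt0 eta m : 0 < eta -> eta <= 8%:R^-1 -> 0 < height eta m.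
Proof. by move=> e0 e8; rewrite invr_gt0 top_gt0. Qed.

Lemma weight_at_ge0 eta m : 0 < eta -> eta <= 8%:R^-1 -> 0 <= weight_at eta m.
Proof. by move=> e0 e8; rewrite mulr_ge0 ?sqr_ge0// ltW// height_gt0. Qed.

(** Area times [top_lower]; [eta] cancels, and so the constants of [mass_outer] and [center_outer]
    do not depend on it. *)
Lemma weight_at_le eta m : 0 < eta -> eta <= 8%:R^-1 ->
  weight_at eta m <= weight_cst * scale m ^+ 2.
Proof.
move=> e0 e8; rewrite /weight_at /height ler_pdivrMr ?top_gt0//.
have := ler_wpM2r (sqr_ge0 (scale m)) (top_lower m e0 e8).
by move: weight_cst (top eta m) (scale m) => P T s h; lra.
Qed.

Lemma height_le eta m : 0 < eta -> eta <= 8%:R^-1 -> height eta m <= weight_cst / eta ^+ 2.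
Proof.
move=> e0 e8; rewrite /height -[leLHS]mul1r ler_pdivrMr ?top_gt0// mulrAC ler_pdivlMr ?exprn_gt0//.
have := top_lower m e0 e8; rewrite mul1r [top _ _ * _]mulrC; have := sqr_ge0 eta; lra.
Qed.

Lemma mass_normalized eta m f : 0 < eta -> eta <= 8%:R^-1 -> height eta m * mass eta m f <= nsq f.
Proof.
move=> e0 e8; rewrite /height mulrC ler_pdivrMr ?top_gt0// mulrC; exact: mass_le_top.
Qed.

Lemma near_maximizer eta m e : 0 < eta -> eta <= 8%:R^-1 -> 0 < e ->
  exists2 f : bergman R, nsq f <= 1 & 1 - e <= height eta m * mass eta m f.
Proof.
move=> e0 e8 ep; have t0 := top_gt0 m e0 e8.
have et : 0 < e * top eta m by rewrite mulr_gt0.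
have [_ [f f1 ->] h] := sup_adherent et (mass_ubound m e0 e8).
exists f => //; rewrite /height mulrC ler_pdivlMr// mulrBl mul1r.
exact: ltW.
Qed.

Lemma mass_outer eta m f : 0 < eta -> eta <= 8%:R^-1 ->
  height eta m * mass eta m f <= 64%:R ^+ 2 * weight_cst * nsq (cutoff (outer m) f).
Proof.
move=> e0 e8; have t0 := @scale_gt0 R m.
apply: (le_trans (ler_wpM2l (ltW (height_gt0 m e0 e8)) (mass_le_outer m f e0 e8))).
have -> : height eta m * (64%:R ^+ 2 / scale m ^+ 2 * nsq (cutoff (outer m) f) * (2 * (eta * scale m)) ^+ 2) =
  weight_at eta m * (64%:R ^+ 2 / scale m ^+ 2 * nsq (cutoff (outer m) f)) by rewrite /weight_at; ring.
apply: (le_trans (ler_wpM2r _ (weight_at_le m e0 e8))).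
  by rewrite mulr_ge0 ?nsq_ge0// divr_ge0 ?sqr_ge0.
apply: le_of_eq; move: t0; move: (scale m) (@weight_cst R) (nsq _) => t P q t0.
by field; rewrite (gt_eqF t0).
Qed.

Lemma center_outer eta m f : 0 < eta -> eta <= 8%:R^-1 ->
  weight_at eta m * cmodulus (f (site_center m)) ^+ 2 <=
  64%:R ^+ 2 * weight_cst * nsq (cutoff (outer m) f).
Proof.
move=> e0 e8; have t0 := @scale_gt0 R m.
apply: (le_trans (ler_wpM2l (weight_at_ge0 m e0 e8) (center_value f m))).
apply: (le_trans (ler_wpM2r _ (weight_at_le m e0 e8))).
  by rewrite mulr_ge0 ?nsq_ge0// divr_ge0 ?sqr_ge0.
apply: le_of_eq; move: t0; move: (scale m) (@weight_cst R) (nsq _) => t P q t0.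
by field; rewrite (gt_eqF t0).
Qed.

(** By [inner_osc], on the inner square f differs from its central value by O(eta) times the outer
    norm over the scale. So the quadratic form of the localised operator is, up to O(eta), the rank
    one form of evaluation at the centre. *)
Lemma mass_center : exists2 K : R, 0 <= K & forall f eta m, 0 < eta -> eta <= 8%:R^-1 ->
  `|height eta m * mass eta m f - weight_at eta m * cmodulus (f (site_center m)) ^+ 2| <=
  K * eta * nsq (cutoff (outer m) f).
Proof.
have [K K0 osc] := @inner_osc R; exists (128%:R * K * weight_cst).
  exact: (mulr_ge0 (mulr_ge0 (ler0n R 128) K0) (ltW weight_cst_gt0)).
move=> f eta m e0 e8; have t0 := @scale_gt0 R m.
set n := nrm (cutoff (outer m) f); have n0 : 0 <= n by exact: nrm_ge0.
have nn : nsq (cutoff (outer m) f) = n ^+ 2 by rewrite nrm_sqr.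
have sqle (a b : R) : 0 <= a -> 0 <= b -> a ^+ 2 <= b ^+ 2 -> a <= b.
  by move=> a0 b0; rewrite ler_sqr.
have v64 : 0 <= 64%:R / scale m * n by rewrite mulr_ge0// divr_ge0// ltW.
have Bc : cmodulus (f (site_center m)) <= 64%:R / scale m * n.
  apply: sqle => //; first exact: cmodulus_ge0.
  by rewrite !exprMn exprVn -nn; exact: center_value.
have et : eta * scale m <= scale m / 8%:R by rewrite mulrC ler_pM2l.
have pt (p : plane) : inner eta m p -> `|cmodulus (f (to_cplx p)) ^+ 2 - cmodulus (f (site_center m)) ^+ 2| <=
    K * eta / scale m * n * (128%:R / scale m * n).
  move=> ip; have [h1 h2] := inner_close ip; rewrite subr0 in h2.
  have Bp : cmodulus (f (to_cplx p)) <= 64%:R / scale m * n.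
    apply: sqle => //; first exact: cmodulus_ge0.
    rewrite !exprMn exprVn -nn [to_cplx p]/(to_cplx (p.1, p.2)).
    by apply: outer_value; lra.
  have Bd : cmodulus (f (to_cplx p) - f (site_center m)) <= K * eta / scale m * n.
    apply: sqle; [exact: cmodulus_ge0|by rewrite mulr_ge0// divr_ge0 ?mulr_ge0// ltW|].
    by rewrite !exprMn exprVn -nn; exact: osc.
  rewrite subr_sqr normrM; apply: ler_pM => //.
    apply: le_trans Bd; rewrite ler_norml; apply/andP; split.
      have := cmodulusD (f (site_center m) - f (to_cplx p)) (f (to_cplx p)); rewrite subrK cmodulusB; lra.
    by have := cmodulusD (f (to_cplx p) - f (site_center m)) (f (site_center m)); rewrite subrK; lra.
  rewrite ger0_norm ?addr_ge0 ?cmodulus_ge0//.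
  by move: Bp Bc; move: (scale m)^-1 => u; lra.
have := @Rintegral_near_cst R _ _ area (inner eta m) (fun p => cmodulus (f (to_cplx p)) ^+ 2)
  (cmodulus (f (site_center m)) ^+ 2) (K * eta / scale m * n * (128%:R / scale m * n))
  ((2 * (eta * scale m)) ^+ 2) (measurable_inner eta m) (area_inner m e0) _ pt.
rewrite -nsq_cutoff; [|exact: measurable_inner|exact: inner_sub].
rewrite -/(mass eta m f) => h.
have ih : area.-integrable (inner eta m) (EFin \o (fun p => cmodulus (f (to_cplx p)) ^+ 2)).
  apply: (integrableS _ _ (inner_sub (m:=m) e0 e8) (L2_integrable (bergmanL2 f))).
    exact: measurable_disc_coord.
  exact: measurable_inner.
have {}h := h ih; have hg := height_gt0 m e0 e8.
have -> : height eta m * mass eta m f - weight_at eta m * cmodulus (f (site_center m)) ^+ 2 =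
  height eta m * (mass eta m f - cmodulus (f (site_center m)) ^+ 2 * (2 * (eta * scale m)) ^+ 2).
  by rewrite /weight_at; ring.
rewrite normrM gtr0_norm//; apply: (le_trans (ler_wpM2l (ltW hg) h)).
have -> : height eta m * (K * eta / scale m * n * (128%:R / scale m * n) * (2 * (eta * scale m)) ^+ 2) =
  weight_at eta m * (K * eta / scale m * n * (128%:R / scale m * n)) by rewrite /weight_at; ring.
apply: (le_trans (ler_wpM2r _ (weight_at_le m e0 e8))).
  apply: mulr_ge0; first by rewrite mulr_ge0// divr_ge0 ?mulr_ge0// ltW.
  by rewrite mulr_ge0// divr_ge0// ltW.
rewrite nn; apply: le_of_eq; move: t0 {h n0 nn v64 Bc pt}; move: (scale m) (@weight_cst R) n => t P n t0.
by field; rewrite (gt_eqF t0).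
Qed.

Lemma unit_disc_center m : unit_disc (site_center m : C).
Proof.
have t0 := @scale_gt0 R m.
have : closed_square (1 - scale m) 0 (2 * (scale m / 4%:R)) (1 - scale m, 0 : R).
  by split; rewrite /= subrr normr0 mulr_ge0// divr_ge0// ltW.
by move/(@closed_outer_sub R m).
Qed.

(** Scaled by the square root of [weight_at], the kernel is nearly a unit vector. Lower bound: a
    near maximiser has normalised mass close to 1, which [mass_center] converts into a central
    value, and the kernel dominates central values. Upper bound: [mass_center] for the kernel
    itself, whose normalised mass is at most its squared norm. *)
Lemma kernel_center : exists2 K : R, 0 <= K & forall eta m, 0 < eta -> eta <= 8%:R^-1 ->
  exists k : bergman R, [/\ forall f, ip f k = complex.Re (f (site_center m)), k (site_center m) = (nsq k)%:C &
    `|weight_at eta m * nsq k - 1| <= K * eta].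
Proof.
have [K K0 hK] := mass_center; exists K => // eta m e0 e8.
have [k hk] := evaluation_kernel (unit_disc_center m); exists k.
have kE : k (site_center m) = (nsq k)%:C.
  have re : complex.Re (k (site_center m)) = nsq k by rewrite -hk ipE.
  have im : complex.Im (k (site_center m)) = 0.
    have hi : ip ((0 +i* 1 : C) *: k) k = - complex.Im (k (site_center m)).
      rewrite hk (_ : ((0 +i* 1 : C) *: k) (site_center m) = (0 +i* 1) * k (site_center m))//.
      by case: (k _) => a b /=; ring.
    have h2 : ip ((0 +i* 1 : C) *: k) k = 0.
      rewrite /ip -[RHS](mul0r (fine (area D))) -Rintegral_cst; last exact: measurable_disc_coord.
      apply: eq_Rintegral => p _; rewrite /dot (_ : ((0 +i* 1 : C) *: k) (to_cplx p) = (0 +i* 1) * k (to_cplx p))//.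
      by case: (k _) => a b /=; ring.
    by apply/eqP; rewrite -oppr_eq0 -hi h2.
  by case: (k _) re im => a b /= -> ->.
split => //.
have q0 := nsq_ge0 k; have w0 := weight_at_ge0 m e0 e8.
(* Multiplying f by the conjugate of its central value makes that value real, so that the real
   reproducing property bounds the full modulus. *)
have cf f : cmodulus (f (site_center m)) ^+ 2 <= nsq k * nsq f.
  have [->|fc] := eqVneq (f (site_center m)) 0; first by rewrite cmodulus0 expr0n mulr_ge0 ?nsq_ge0.
  pose c : C := (f (site_center m))^*.
  have : ip (c *: f) k = cmodulus (f (site_center m)) ^+ 2.
    rewrite hk (_ : (c *: f) (site_center m) = c * f (site_center m))// cmodulus_sqr /c.
    by case: (f _) => a b /=; ring.
  have := bCS (c *: f) k => h h2; rewrite h2 bnrmZ in h.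
  have cc : cmodulus c = cmodulus (f (site_center m)) by rewrite cmodulus_conj.
  rewrite cc ger0_norm ?sqr_ge0// expr2 -mulrA in h.
  have cp : 0 < cmodulus (f (site_center m)).
    rewrite lt_neqAle cmodulus_ge0 andbT eq_sym.
    by apply: contra fc => /eqP/cmodulus_eq0/eqP.
  rewrite ler_pM2l// in h.
  rewrite -!nrm_sqr -exprMn ler_sqr ?nnegrE ?mulr_ge0 ?nrm_ge0 ?cmodulus_ge0//.
  by rewrite mulrC.
have cut_le f : nsq (cutoff (outer m) f) <= nsq f.
  by apply: nsq_cutoff_le; [exact: measurable_outer|exact: bergmanL2].
rewrite ler_norml; apply/andP; split.
  rewrite lerBrDr -subr_ge0; apply/ler_addgt0Pl => e'; set e : R := e' => ep.
  have [f f1 hf] := near_maximizer m e0 e8 ep.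
  have := hK f eta m e0 e8; rewrite ler_norml => /andP[_ h].
  have h2 : K * eta * nsq (cutoff (outer m) f) <= K * eta.
    by rewrite ler_piMr ?mulr_ge0 ?(ltW e0)//; exact: le_trans (cut_le f) f1.
  have h3 : weight_at eta m * cmodulus (f (site_center m)) ^+ 2 <= weight_at eta m * nsq k.
    apply: ler_wpM2l => //; apply: (le_trans (cf f)); rewrite -[leRHS]mulr1.
    exact: ler_wpM2l.
  lra.
have [k0|k0] := eqVneq (nsq k) 0.
  by rewrite k0 mulr0 sub0r (le_trans (_ : _ <= 0))// ?oppr_le0// mulr_ge0// ltW.
have kp : 0 < nsq k by rewrite lt_neqAle eq_sym k0.
have := hK k eta m e0 e8; rewrite ler_norml kE cmodulusR ger0_norm// => /andP[h _].
have h2 := mass_normalized m k e0 e8.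
have h3 : K * eta * nsq (cutoff (outer m) k) <= K * eta * nsq k.
  by apply: ler_wpM2l; [rewrite mulr_ge0// ltW|exact: cut_le].
rewrite -(ler_pM2r kp) mulrBl mul1r.
rewrite expr2 mulrA in h.
move: h h2 h3; set u1 := height _ _ * _; set u2 := weight_at _ _ * _ * _; set u3 := K * eta * nsq (cutoff _ _); set u4 := K * eta * nsq k; set u5 := nsq k.
by clearbody u1 u2 u3 u4 u5 => h1 h2 h3; lra.
Qed.

End LocalFacts.

(** * Multipliers carried by disjoint squares *)

Section Multipliers.
Context {R : realType}.
Local Notation plane := (measurableTypeR R * measurableTypeR R)%type.
Local Notation C := (Cplx R).
Local Notation D := (@disc_coord R).
Implicit Types (f g : C -> C) (E : nat -> set plane) (t s : nat -> C).

Lemma nsqD f g : L2_disc f -> L2_disc g ->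
  nsq (fun z => f z + g z) = nsq f + nsq g + 2 * ip f g.
Proof.
move=> Lf Lg; have Lfg := L2D Lf Lg.
by rewrite -!ipE ipDl// (ipC f) (ipC g) !ipDl// (ipC g f); ring.
Qed.

Lemma ip_eq0 f g : (forall p, D p -> dot (f (to_cplx p)) (g (to_cplx p)) = 0) -> ip f g = 0.
Proof.
move=> h; rewrite /ip -[RHS](mul0r (fine (area D))) -Rintegral_cst; last exact: measurable_disc_coord.
by apply: eq_Rintegral => p /set_mem Dp; rewrite h.
Qed.

Lemma nsq_split (S : set plane) f : measurable S -> L2_disc f ->
  nsq f = nsq (cutoff S f) + nsq (cutoff (~` S) f).
Proof.
move=> mS Lf; have mS' : measurable (~` S) by exact: measurableC.
rewrite -[LHS]/(nsq (fun z => f z)) (_ : (fun z => f z) = fun z => cutoff S f z + cutoff (~` S) f z).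
  rewrite nsqD; [|exact: L2_cutoff..].
  rewrite ip_eq0 ?mulr0 ?addr0// => p _; rewrite !cutoffE in_setC /dot.
  by case: (p \in S) => /=; rewrite ?mul0r ?mulr0 addr0.
by apply/funext => z; rewrite /cutoff in_setC; case: (_ \in S); rewrite /= ?addr0 ?add0r.
Qed.

Lemma sum_cutoff_le E f n : (forall i, measurable (E i)) ->
  (forall i j, (i < j)%N -> E i `&` E j = set0) -> L2_disc f ->
  \sum_(i < n) nsq (cutoff (E i) f) <= nsq f.
Proof.
move=> mE dE; elim: n f => [|n IH] f Lf; first by rewrite big_ord0 nsq_ge0.
rewrite big_ord_recr /= (nsq_split (mE n) Lf) addrC lerD2l.
have mC : measurable (~` E n) by exact: measurableC.
apply: le_trans (IH _ (L2_cutoff mC Lf)); apply: ler_sum => i _.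
rewrite (_ : cutoff (E i) (cutoff _ f) = cutoff (E i) f)//.
apply/funext => z; rewrite /cutoff; case: ifPn => // /set_mem Ei; rewrite ifT//.
by rewrite inE => En; have : (E i `&` E n) (complex.Re z, complex.Im z) by []; rewrite dE.
Qed.

Lemma terms_vanish (u : nat -> R) (M : R) : (forall n, 0 <= u n) ->
  (forall n, \sum_(i < n) u i <= M) ->
  forall e : R, 0 < e -> exists N, forall n, (N <= n)%N -> u n <= e.
Proof.
move=> u0 uM e e0.
have cu : cvgn (series u).
  apply: nondecreasing_is_cvgn.
    by apply/nondecreasing_seqP => n; rewrite /series /= big_nat_recr//= lerDl.
  by exists M => _ [n _ <-]; rewrite /series /= big_mkord.
have /cvgrPdist_le/(_ e e0)[N _ hN] := cvg_series_cvg_0 cu.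
by exists N => n Nn; have := hN n Nn; rewrite /= sub0r normrN ger0_norm.
Qed.

(* The function equal to t j on E j and to 0 off the union of the E j.          *)
(* Off the union xget returns the default index 0, and the cutoff gives 0.      *)
Definition mult E t (z : C) : C :=
  let j := xget 0%N [set j | E j (complex.Re z, complex.Im z)] in
  cutoff (E j) (fun=> t j) z.

Definition disjoint_family E := forall i j, (i < j)%N -> E i `&` E j = set0.

Lemma disjoint_uniq E i j p : disjoint_family E -> E i p -> E j p -> i = j.
Proof.
move=> dE Ei Ej; case: (ltngtP i j) => // ij.
  by have : (E i `&` E j) p by []; rewrite dE.
by have : (E j `&` E i) p by []; rewrite dE.
Qed.

Lemma mult_in E t j p : disjoint_family E -> E j p -> mult E t (to_cplx p) = t j.
Proof.
move=> dE Ej; rewrite /mult -surjective_pairing.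
have h : E (xget 0%N [set j | E j p]) p by exact: (@xgetI _ 0%N [set j | E j p] j).
by rewrite cutoffE mem_set// (disjoint_uniq dE h Ej).
Qed.

Lemma mult_out E t p : ~ (\bigcup_i E i) p -> mult E t (to_cplx p) = 0.
Proof.
move=> h; rewrite /mult cutoffE; case: ifPn => // /set_mem Ej.
by case: h; eexists; last exact: Ej.
Qed.

Lemma measurable_mult E t : disjoint_family E -> (forall i, measurable (E i)) ->
  measurable_disc (mult E t).
Proof.
move=> dE mE.
have key (F : C -> R) : F 0 = 0 ->
    measurable_fun D (fun p : plane => F (mult E t (to_cplx p))).
  move=> F0; apply: (@measurable_funS _ _ _ _ setT) => //.
  move=> _ Y mY; rewrite setTI.
  rewrite (_ : _ @^-1` Y = (\bigcup_(i in [set i | Y (F (t i))]) E i) `|`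
      (if 0 \in Y then ~` (\bigcup_i E i) else set0)).
    apply: measurableU.
      by apply: bigcup_measurable => i _.
    by case: ifP => _ //; apply: measurableC; apply: bigcup_measurable => i _.
  apply/seteqP; split => p /=.
    have [[j _ Ej]|nE] := pselect ((\bigcup_i E i) p).
      by rewrite (mult_in t dE Ej) => Yj; left; exists j.
    by rewrite (mult_out t nE) F0 => Y0; right; rewrite mem_set.
  case=> [[j /= Yj Ej]|]; first by rewrite (mult_in t dE Ej).
  by case: ifPn => // /set_mem Y0 nE; rewrite (mult_out t nE) F0.
by split; exact: key.
Qed.

Lemma mult_case (P : C -> Prop) E t : disjoint_family E -> P 0 -> (forall j, P (t j)) ->
  forall z, P (mult E t z).
Proof.
move=> dE P0 Pt z; have -> : z = to_cplx (complex.Re z, complex.Im z) by case: z.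
have [[j _ Ej]|nE] := pselect ((\bigcup_i E i) (complex.Re z, complex.Im z)).
  by rewrite (mult_in t dE Ej).
by rewrite (mult_out t nE).
Qed.

Lemma bounded_mult E t (M : R) : disjoint_family E -> (forall i, measurable (E i)) ->
  (forall j, cmodulus (t j) <= M) -> bounded_symbol (mult E t) M.
Proof.
move=> dE mE tM; split; first exact: measurable_mult.
move=> z _; apply: (@mult_case (fun w => cmodulus w <= M)) => //.
by rewrite cmodulus0; exact: le_trans (cmodulus_ge0 _) (tM 0%N).
Qed.

(** Pointwise operations act on the coefficients; [F 0 0 = 0] takes care of the points off the
    union. *)
Lemma mult_comp E t s (F : C -> C -> C) z : disjoint_family E -> F 0 0 = 0 ->
  F (mult E t z) (mult E s z) = mult E (fun j => F (t j) (s j)) z.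
Proof.
move=> dE F0; have -> : z = to_cplx (complex.Re z, complex.Im z) by case: z.
have [[j _ Ej]|nE] := pselect ((\bigcup_i E i) (complex.Re z, complex.Im z)).
  by rewrite !(mult_in _ dE Ej).
by rewrite !(mult_out _ nE).
Qed.

(** Countable additivity of the integral over the union reduces the bound to partial sums, which is
    the form in which site-by-site estimates come. *)
Lemma nsq_mult_le E t f (X : R) : disjoint_family E -> (forall i, measurable (E i)) ->
  (forall i, E i `<=` D) -> L2_disc f -> L2_disc (fun z => mult E t z * f z) ->
  (forall n, \sum_(i < n) cmodulus (t i) ^+ 2 * nsq (cutoff (E i) f) <= X) ->
  nsq (fun z => mult E t z * f z) <= X.
Proof.
move=> dE mE ED Lf Lt hX.
have UD : \bigcup_i E i `<=` D by apply: bigcup_sub => i _.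
have mU : measurable (\bigcup_i E i) by apply: bigcup_measurable => i _.
rewrite -lee_fin -L2_sqnorm// /sqnorm_disc.
have -> : (\int[area]_(p in D) (cmodulus (mult E t (to_cplx p) * f (to_cplx p)) ^+ 2)%:E =
    \int[area]_(p in \bigcup_i E i) (cmodulus (mult E t (to_cplx p) * f (to_cplx p)) ^+ 2)%:E)%E.
  rewrite [LHS]integral_mkcond [RHS]integral_mkcond; apply: eq_integral => p _.
  rewrite !patchE; case: ifPn => [/set_mem Dp|nD]; case: ifPn => [Up|nU] //.
    rewrite mult_out ?mul0r ?cmodulus0 ?expr0n//.
    by move=> Up; move: nU; rewrite mem_set.
  by move: nD; rewrite mem_set//; apply: UD; exact: set_mem Up.
rewrite ge0_integral_bigcup//; first last.
- by apply/trivIsetP => i j _ _ /eqP; case: (ltngtP i j) => // ij _; [exact: dE|rewrite setIC; exact: dE].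
- by move=> p _; rewrite lee_fin sqr_ge0.
- exact: (measurable_funS (@measurable_disc_coord R) UD (measurable_sqr_cmodulus Lt.1)).
have Ei i : (\int[area]_(p in E i) (cmodulus (mult E t (to_cplx p) * f (to_cplx p)) ^+ 2)%:E =
    (cmodulus (t i) ^+ 2 * nsq (cutoff (E i) f))%:E)%E.
  rewrite (eq_integral (fun p => ((cmodulus (t i) ^+ 2)%:E * (cmodulus (f (to_cplx p)) ^+ 2)%:E)%E)); last first.
    by move=> p /set_mem Ep; rewrite (mult_in t dE Ep) cmodulusM exprMn EFinM.
  have iE : area.-integrable (E i) (EFin \o (fun p => cmodulus (f (to_cplx p)) ^+ 2)).
    by apply: (integrableS _ _ (ED i) (L2_integrable Lf)) => //; exact: measurable_disc_coord.
  rewrite ge0_integralZl_EFin//; first last.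
  - exact: sqr_ge0.
  - by case/integrableP: iE.
  - by move=> p _; rewrite lee_fin sqr_ge0.
  by rewrite nsq_cutoff// (EFinM (cmodulus (t i) ^+ 2)) /Rintegral fineK//; exact: integrable_fin_num.
under eq_eseriesr do rewrite Ei.
apply: lime_le; first by apply: is_cvg_nneseries => n _ _; rewrite lee_fin mulr_ge0 ?sqr_ge0 ?nsq_ge0.
by apply: nearW => n; rewrite /= sumEFin lee_fin big_mkord.
Qed.

End Multipliers.

(** * Kernels and maximisers along sparse squares *)

(** Recursive choice: each [phi j] is taken beyond a threshold that serves all [a] up to the
    previous value of [phi] at once, hence all earlier indices. *)
Lemma select_subsequence (Q : nat -> nat -> Prop) (P : nat -> nat -> nat -> Prop) :
  (forall l, exists N, forall m, (N <= m)%N -> Q l m) ->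
  (forall l a, exists N, forall m, (N <= m)%N -> P l a m) ->
  exists phi : nat -> nat, [/\ forall i j, (i < j)%N -> (phi i < phi j)%N,
    forall l, Q l (phi l) & forall i j, (i < j)%N -> P j (phi i) (phi j)].
Proof.
move=> /choice[N1 hQ] hP.
have /choice[N2 hN2] : forall lM : nat * nat, exists N, forall a m, (a <= lM.2)%N -> (N <= m)%N -> P lM.1 a m.
  move=> [l M] /=; elim: M => [|M [N IH]].
    by have [N hN] := hP l 0%N; exists N => a m; rewrite leqn0 => /eqP ->; exact: hN.
  have [N' hN'] := hP l M.+1; exists (maxn N N') => a m; rewrite leq_eqVlt geq_max => + /andP[Nm N'm].
  by case/orP => [/eqP ->|aM]; [exact: hN'|exact: IH].
pose phi := fix phi l := if l is l'.+1 then
  maxn (phi l').+1 (maxn (N1 l) (N2 (l, phi l'))) else N1 0%N.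
have lt1 l : (phi l < phi l.+1)%N by rewrite /= leq_max leqnn.
have inc : forall i j, (i < j)%N -> (phi i < phi j)%N.
  move=> i; elim => // j IH; rewrite ltnS leq_eqVlt => /orP[/eqP ->//|ij].
  exact: ltn_trans (IH ij) (lt1 j).
exists phi; split => //.
  by case=> [|l]; apply: hQ => //=; rewrite !leq_max leqnn orbT.
move=> i [//|j]; rewrite ltnS => ij; apply: (hN2 (j.+1, phi j)) => /=.
  by move: ij; rewrite leq_eqVlt => /orP[/eqP ->//|/inc/ltnW].
by rewrite !leq_max leqnn !orbT.
Qed.

Section WeaklyNull.
Context {R : realType}.
Local Notation plane := (measurableTypeR R * measurableTypeR R)%type.
Local Notation C := (Cplx R).
Local Notation D := (@disc_coord R).
Implicit Types (f g : bergman R) (u : nat -> bergman R) (m n i j : nat) (e eta : R).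

Definition weakly_null u := forall g e, 0 < e -> exists N, forall m, (N <= m)%N -> `|ip (u m) g| <= e.

Lemma outer_family : disjoint_family (@outer R).
Proof. by move=> i j; exact: outer_disjoint. Qed.

Lemma outer_tail (f : C -> C) e : L2_disc f -> 0 < e ->
  exists N, forall m, (N <= m)%N -> nsq (cutoff (outer m) f) <= e.
Proof.
move=> Lf; apply: (@terms_vanish _ (fun m => nsq (cutoff (outer m) f)) (nsq f)).
  by move=> n; exact: nsq_ge0.
by move=> n; apply: sum_cutoff_le => //; [exact: measurable_outer|exact: outer_family].
Qed.

Lemma ip_turn f g : ip ((0 +i* 1 : C) *: f) g = ip f ((0 -i* 1 : C) *: g).
Proof.
rewrite bipMl; apply: eq_Rintegral => p _; congr dot.
Qed.

(** Pairing with the evaluation kernel gives the real part of the value, and pairing with -i times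
    the kernel the imaginary part. *)
Lemma weakly_null_pointwise u z e : weakly_null u -> unit_disc z -> 0 < e ->
  exists N, forall m, (N <= m)%N -> cmodulus (u m z) <= e.
Proof.
move=> wu Dz ep; have [k hk] := evaluation_kernel Dz.
have e2 : 0 < e / 2 by rewrite divr_gt0.
have [N1 h1] := wu k _ e2; have [N2 h2] := wu ((0 -i* 1 : C) *: k) _ e2.
exists (maxn N1 N2) => m; rewrite geq_max => /andP[/h1 {}h1 /h2 {}h2].
rewrite -ip_turn hk in h2; rewrite hk in h1.
apply: (le_trans (cmodulus_le _)).
have E : complex.Re (((0 +i* 1 : C) *: u m) z) = - complex.Im (u m z).
  rewrite (_ : ((0 +i* 1 : C) *: u m) z = (0 +i* 1 : C) * u m z)//.
  by case: (u m z) => a b /=; ring.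
by rewrite E normrN in h2; lra.
Qed.

(** Dominated convergence on the inner square: values tend to 0 pointwise and are uniformly bounded
    there by [outer_value]. *)
Lemma weakly_null_mass u eta i e : 0 < eta -> eta <= 8%:R^-1 -> weakly_null u ->
  (forall m, nsq (u m) <= 2) -> 0 < e -> exists N, forall m, (N <= m)%N -> mass eta i (u m) <= e.
Proof.
move=> e0 e8 wu u2 ep; have mB := @measurable_inner R eta i.
have BD := @inner_sub R eta i e0 e8.
pose F m (p : plane) := ((cmodulus (u m (to_cplx p)) ^+ 2)%:E : \bar R).
have mF m : measurable_fun (inner eta i) (F m).
  exact: (measurable_funS (@measurable_disc_coord R) BD (measurable_sqr_cmodulus (bergmanL2 (u m)).1)).
pose M : R := 64%:R ^+ 2 / scale i ^+ 2 * 2.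
have M0 : 0 <= M by rewrite mulr_ge0// divr_ge0 ?sqr_ge0.
have FM m p : inner eta i p -> cmodulus (u m (to_cplx p)) ^+ 2 <= M.
  move=> /inner_close[h1 h2]; rewrite subr0 in h2.
  have et : eta * scale i <= scale i / 8%:R by rewrite mulrC ler_pM2l ?scale_gt0.
  have t0 := @scale_gt0 R i.
  rewrite [to_cplx p]/(to_cplx (p.1, p.2)).
  apply: (le_trans (@outer_value R (u m) i p.1 p.2 _ _)); try lra.
  apply: ler_wpM2l; first by rewrite divr_ge0 ?sqr_ge0.
  apply: le_trans (u2 m); apply: nsq_cutoff_le; [exact: measurable_outer|exact: bergmanL2].
have iM : area.-integrable (inner eta i) (fun=> M%:E).
  apply/integrableP; split; first exact: measurable_cst.
  by rewrite (integral_cst area mB `|M%:E|%E) area_inner// -EFinM ltry.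
have [||_ _] := @dominated_convergence _ _ R area _ mB F (fun=> 0%E) (fun=> M%:E) mF (measurable_cst _) _ iM _.
- apply: aeW => p Bp; apply: cvg_EFin; first by apply: nearW.
  apply/cvgrPdist_le => d d0.
  have d1 : 0 < Num.sqrt d by rewrite sqrtr_gt0.
  have [N hN] := weakly_null_pointwise wu (BD _ Bp) d1.
  exists N => // m /= Nm; rewrite sub0r normrN ger0_norm ?sqr_ge0//.
  rewrite -[leRHS]sqr_sqrtr ?(ltW d0)// ler_sqr ?nnegrE ?cmodulus_ge0 ?sqrtr_ge0//.
  exact: hN.
- apply: aeW => p m Bp; rewrite /F lee_fin ger0_norm ?sqr_ge0//; exact: FM.
rewrite integral0 => h.
have h2 : (fun m => fine (\int[area]_(p in inner eta i) F m p)%E) x @[x --> \oo] --> (0 : R).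
  exact: (fine_cvg h).
have /cvgrPdist_le/(_ e ep)[N _ hN] := h2.
exists N => m Nm; have := hN m Nm; rewrite /= sub0r normrN => h3.
apply: le_trans h3; rewrite /mass nsq_cutoff//; exact: ler_norm.
Qed.

End WeaklyNull.

(** * Localised operators, kernels and maximisers *)

Section TestFunctions.
Context {R : realType}.
Local Notation plane := (measurableTypeR R * measurableTypeR R)%type.
Local Notation C := (Cplx R).
Local Notation D := (@disc_coord R).
Implicit Types (f g : bergman R) (u : nat -> bergman R) (m n i j : nat) (e eta : R).

Definition site_symbol eta m : C -> C := cutoff (inner eta m) (fun=> (height eta m)%:C).

Lemma site_symbol_bounded eta m : 0 < eta -> eta <= 8%:R^-1 ->
  bounded_symbol (site_symbol eta m) (height eta m).
Proof.
move=> e0 e8; split; first by apply: measurable_cutoff1; exact: measurable_inner.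
move=> z _; rewrite /site_symbol /cutoff; case: ifP => _.
  by rewrite cmodulusR ger0_norm// ltW// height_gt0.
by rewrite cmodulus0 ltW// height_gt0.
Qed.

Lemma ip_site eta m f g : 0 < eta -> eta <= 8%:R^-1 -> ip (toeplitz (site_symbol eta m) f) g =
  height eta m * ip (cutoff (inner eta m) f) (cutoff (inner eta m) g).
Proof.
move=> e0 e8; have mB := @measurable_inner R eta m.
rewrite (toeplitzP _ _ (site_symbol_bounded m e0 e8)) -ipZl; [|exact: L2_cutoff (bergmanL2 _)..].
apply: eq_Rintegral => p _; rewrite /site_symbol !cutoffE; case: ifP => // _.
by rewrite mul0r mulr0 /dot /= !mul0r.
Qed.

Lemma ip_site_le eta m f g : 0 < eta -> eta <= 8%:R^-1 ->
  `|ip (toeplitz (site_symbol eta m) f) g| <=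
  Num.sqrt (height eta m * mass eta m f) * Num.sqrt (height eta m * mass eta m g).
Proof.
move=> e0 e8; have h0 := ltW (height_gt0 m e0 e8); rewrite ip_site// normrM ger0_norm//.
rewrite !sqrtrM// mulrACA -expr2 sqr_sqrtr//; apply: ler_wpM2l => //.
by apply: ip_CauchySchwarz; apply: L2_cutoff (bergmanL2 _); exact: measurable_inner.
Qed.

(** The localised operator A satisfies 0 <= A <= 1 as a form, so |A f|^2 <= <A f, f>; expanding |A f
    - f|^2 gives the bound. *)
Lemma site_defect eta m f : 0 < eta -> eta <= 8%:R^-1 ->
  nsq (toeplitz (site_symbol eta m) f - f) <= nsq f - height eta m * mass eta m f.
Proof.
move=> e0 e8; have h0 := ltW (height_gt0 m e0 e8); set Af := toeplitz _ f.
have m0 : 0 <= height eta m * mass eta m f by rewrite mulr_ge0// mass_ge0.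
have AA : nsq Af <= height eta m * mass eta m f.
  have [n0|n0] := eqVneq (nrm Af) 0; first by rewrite -nrm_sqr n0 expr0n.
  have np : 0 < nrm Af by rewrite lt_neqAle eq_sym n0 nrm_ge0.
  have := ip_site_le m f Af e0 e8; rewrite -/Af ipE ger0_norm ?nsq_ge0// => h.
  have h2 : Num.sqrt (height eta m * mass eta m Af) <= nrm Af.
    by apply: ler_wsqrtr; exact: mass_normalized.
  have h3 : nrm Af ^+ 2 <= Num.sqrt (height eta m * mass eta m f) * nrm Af.
    rewrite nrm_sqr; apply: (le_trans h); apply: ler_wpM2l => //; exact: sqrtr_ge0.
  rewrite expr2 ler_pM2r// in h3.
  by rewrite -nrm_sqr -[leRHS]sqr_sqrtr// ler_sqr ?nnegrE ?sqrtr_ge0 ?nrm_ge0.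
have E : ip Af f = height eta m * mass eta m f by rewrite /Af ip_site// ipE.
have -> : nsq (Af - f) = nsq Af + nsq f - 2 * ip Af f.
  by rewrite -!ipE bipBl !bipBr (ipC f Af); ring.
by rewrite E; lra.
Qed.

(** The outer masses of a fixed [g] are summable, hence tend to 0, and they dominate the squares of
    both quantities. *)
Lemma center_vanish g e : 0 < e -> forall eta, 0 < eta -> eta <= 8%:R^-1 ->
  exists N, forall m, (N <= m)%N -> Num.sqrt (height eta m * mass eta m g) <= e /\
    Num.sqrt (weight_at eta m) * cmodulus (g (site_center m)) <= e.
Proof.
move=> ep eta e0 e8; pose K : R := 64%:R ^+ 2 * weight_cst.
have K0 : 0 < K by rewrite mulr_gt0 ?weight_cst_gt0 ?exprn_gt0.
have d0 : 0 < e ^+ 2 / K by rewrite divr_gt0 ?exprn_gt0.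
have [N hN] := outer_tail (bergmanL2 g) d0; exists N => m /hN h.
have h2 : K * nsq (cutoff (outer m) g) <= e ^+ 2 by rewrite mulrC -ler_pdivlMr.
have sle (a : R) : a <= K * nsq (cutoff (outer m) g) -> Num.sqrt a <= e.
  by move=> ha; rewrite -[e]ger0_norm ?(ltW ep)// -sqrtr_sqr ler_wsqrtr// (le_trans ha).
split; first by apply: sle; exact: mass_outer.
rewrite -[cmodulus _]ger0_norm ?cmodulus_ge0// -sqrtr_sqr -sqrtrM ?weight_at_ge0//.
by apply: sle; exact: center_outer.
Qed.

(** This makes [k] the evaluation kernel at the centre, normalised as in [kernel_center]. *)
Definition site_kernel eta m (k : bergman R) :=
  forall f, ip f k = Num.sqrt (weight_at eta m) * complex.Re (f (site_center m)).

Lemma site_kernels : exists2 K : R, 0 <= K & forall eta, 0 < eta -> eta <= 8%:R^-1 ->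
  exists kap : nat -> bergman R,
    forall m, site_kernel eta m (kap m) /\ `|nsq (kap m) - 1| <= K * eta.
Proof.
have [K K0 hK] := @kernel_center R; exists K => // eta e0 e8.
have /choice[kap hkap] m : exists k, site_kernel eta m k /\ `|nsq k - 1| <= K * eta.
  have [k [k1 k2 k3]] := hK eta m e0 e8.
  have w0 := weight_at_ge0 m e0 e8.
  exists ((Num.sqrt (weight_at eta m))%:C *: k); split; first by move=> f; rewrite bipZr k1.
  by rewrite -nrm_sqr bnrmZ cmodulusR exprMn real_normK ?num_real// sqr_sqrtr// nrm_sqr.
by exists kap.
Qed.

Lemma kernels_weakly_null eta (kap : nat -> bergman R) : 0 < eta -> eta <= 8%:R^-1 ->
  (forall m, site_kernel eta m (kap m)) -> weakly_null kap.
Proof.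
move=> e0 e8 hk g e ep; have [N hN] := center_vanish g ep e0 e8.
exists N => m /hN[_ h]; rewrite ipC hk normrM ger0_norm ?sqrtr_ge0//.
by apply: le_trans h; apply: ler_wpM2l; [exact: sqrtr_ge0|exact: normRe_le].
Qed.

Lemma half_pow_vanish e : 0 < e -> exists N, forall m, (N <= m)%N -> (2^-1 : R) ^+ m <= e.
Proof.
move=> ep; have l1 : `|2^-1 : R| < 1 by rewrite ger0_norm ?invr_ge0// invf_lt1// ltr1n.
have /cvgrPdist_le/(_ e ep)[N _ hN] := cvg_expr l1.
by exists N => m Nm; have := hN m Nm; rewrite /= sub0r normrN ger0_norm ?exprn_ge0 ?invr_ge0.
Qed.

(** Approximate eigenvectors of one localised operator for the eigenvalue 1. The error tends to 0
    with [m] while [eta] is fixed, which is why each x_n itself ends up in the essential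
    spectrum. *)
Definition maximizing eta m (e : bergman R) :=
  [/\ nsq e <= 1, 2^-1 <= nsq e & nrm (toeplitz (site_symbol eta m) e - e) <= 2^-1 ^+ m].

Lemma maximizers eta : 0 < eta -> eta <= 8%:R^-1 ->
  exists ee : nat -> bergman R, forall m, maximizing eta m (ee m).
Proof.
move=> e0 e8.
have /choice[ee he] m : exists f, maximizing eta m f; last by exists ee.
have q0 : 0 < (4^-1 : R) ^+ m.+1 by rewrite exprn_gt0.
have q2 : (4^-1 : R) ^+ m.+1 <= 2^-1.
  rewrite exprS; apply: (@le_trans _ _ (4^-1 * 1)); last by lra.
  by rewrite ler_wpM2l// exprn_ile1// invf_le1// ler1n.
(* The tolerance 4^-(m+1) becomes the error 2^-m after the square root taken through
   [site_defect]. *)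
have [f f1 hf] := near_maximizer m e0 e8 q0; exists f; split => //.
  by have := mass_normalized m f e0 e8; lra.
have h := site_defect m f e0 e8.
rewrite -[leRHS]ger0_norm ?exprn_ge0// -sqrtr_sqr ler_wsqrtr//.
apply: (le_trans h); apply: (@le_trans _ _ ((4^-1 : R) ^+ m.+1)); first by lra.
rewrite -exprM mulnC exprM (_ : 2^-1 ^+ 2 = 4^-1 :> R); last by field.
by rewrite exprS ler_piMl// ?exprn_ge0// invf_le1// ler1n.
Qed.

(** Up to a vanishing error [ee m] is its own image under the localised operator, and the pairing of
    that image with [g] is controlled by the mass of [g] on the m-th square. *)
Lemma maximizers_weakly_null eta (ee : nat -> bergman R) : 0 < eta -> eta <= 8%:R^-1 ->
  (forall m, maximizing eta m (ee m)) -> weakly_null ee.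
Proof.
move=> e0 e8 he g e ep; have e2 : 0 < e / 2 by rewrite divr_gt0.
have [N1 h1] := center_vanish g e2 e0 e8.
have d0 : 0 < e / 2 / (nrm g + 1) by rewrite divr_gt0// ltr_wpDl ?nrm_ge0.
have [N2 h2] := half_pow_vanish d0.
exists (maxn N1 N2) => m; rewrite geq_max => /andP[/h1[{}h1 _] /h2 {}h2].
have [n1 _ n2] := he m.
have -> : ip (ee m) g = ip (toeplitz (site_symbol eta m) (ee m)) g -
    ip (toeplitz (site_symbol eta m) (ee m) - ee m) g by rewrite bipBl; ring.
apply: (le_trans (ler_normB _ _)); rewrite (splitr e); apply: lerD.
  apply: (le_trans (ip_site_le m _ g e0 e8)); apply: le_trans h1.
  rewrite ler_piMl ?sqrtr_ge0// -[leRHS]sqrtr1 ler_wsqrtr//.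
  exact: le_trans (mass_normalized _ _ e0 e8) n1.
apply: (le_trans (bCS _ _)).
apply: (@le_trans _ _ (e / 2 / (nrm g + 1) * (nrm g + 1))).
  apply: ler_pM; rewrite ?nrm_ge0//; last by rewrite lerDl.
  exact: le_trans n2 h2.
by rewrite divfK// gt_eqF// ltr_wpDl ?nrm_ge0.
Qed.

Definition decoupled eta (site : nat -> nat) u (d : R) := forall i j, i != j ->
  height eta (site j) * mass eta (site j) (u i) <= d * (2^-1 ^+ i.+1 * 2^-1 ^+ j.+1).

(** For i < j, the j-th function has little mass on the i-th square by weak nullity, and the i-th
    function has little mass on the j-th square by [center_vanish]. The threshold d 4^-(j+1) lies
    below d 2^-(i+1) 2^-(j+1), which stays summable in either index. *)
Lemma sparse_sites eta (kap ee : nat -> bergman R) (d : R) : 0 < eta -> eta <= 8%:R^-1 -> 0 < d ->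
  weakly_null kap -> weakly_null ee -> (forall m, nsq (kap m) <= 2) -> (forall m, nsq (ee m) <= 2) ->
  exists site : nat -> nat, [/\ forall i j, (i < j)%N -> (site i < site j)%N,
    decoupled eta site (kap \o site) d & decoupled eta site (ee \o site) d].
Proof.
move=> e0 e8 d0 wk we k2 e2.
pose c l : R := d * 4^-1 ^+ l.+1.
have c0 l : 0 < c l by rewrite mulr_gt0// exprn_gt0.
pose good u l a m := height eta a * mass eta a (u m) <= c l /\ height eta m * mass eta m (u a) <= c l.
have ev u : weakly_null u -> (forall m, nsq (u m) <= 2) ->
    forall l a, exists N, forall m, (N <= m)%N -> good u l a m.
  move=> wu u2 l a; have ha := height_gt0 a e0 e8.
  have [N1 h1] := weakly_null_mass a e0 e8 wu u2 (divr_gt0 (c0 l) ha).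
  have sc : 0 < Num.sqrt (c l) by rewrite sqrtr_gt0.
  have [N2 h2] := center_vanish (u a) sc e0 e8.
  exists (maxn N1 N2) => m; rewrite geq_max => /andP[/h1 {}h1 /h2[{}h2 _]].
  split; first by rewrite mulrC -ler_pdivlMr.
  by move: h2; rewrite ler_sqrt // ltW.
have [|l a|site [inc _ hs]] := @select_subsequence (fun _ _ => True)
    (fun l a m => good kap l a m /\ good ee l a m).
- by move=> l; exists 0%N.
- have [N1 h1] := ev _ wk k2 l a; have [N2 h2] := ev _ we e2 l a.
  exists (maxn N1 N2) => m; rewrite geq_max => /andP[/h1 {}h1 /h2 {}h2]; by split.
have cle i j : (i < j)%N -> c j <= d * (2^-1 ^+ i.+1 * 2^-1 ^+ j.+1) /\
    c j <= d * (2^-1 ^+ j.+1 * 2^-1 ^+ i.+1).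
  move=> ij; rewrite [_ * 2^-1 ^+ i.+1]mulrC.
  have h : 4^-1 ^+ j.+1 <= 2^-1 ^+ i.+1 * 2^-1 ^+ j.+1 :> R.
    rewrite (_ : 4^-1 = 2^-1 * 2^-1 :> R); last by field.
    rewrite exprMn; apply: ler_wpM2r; first by rewrite exprn_ge0.
    by apply: ler_wiXn2l; rewrite ?invr_ge0// ?invf_le1// ?ler1n// ltnS ltnW.
  by split; apply: ler_wpM2l => //; exact: ltW.
have dec u : (forall i j, (i < j)%N -> good u j (site i) (site j)) -> decoupled eta site (u \o site) d.
  move=> hu i j; case: (ltngtP i j) => // ij _; have [h1 h2] := hu _ _ ij; have [c1 c2] := cle _ _ ij.
    exact: le_trans h2 c1.
  exact: le_trans h1 c2.
exists site; split => //; apply: dec => i j ij; by have [] := hs i j ij.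
Qed.

Lemma sum_half_pow n : \sum_(i < n) (2^-1 : R) ^+ i.+1 <= 1.
Proof.
rewrite (_ : \sum_(i < n) _ = 1 - 2^-1 ^+ n); first by rewrite gerBl exprn_ge0.
elim: n => [|n IH]; first by rewrite big_ord0 expr0 subrr.
by rewrite big_ord_recr /= IH exprS; field.
Qed.

End TestFunctions.

(** * Almost multiplicativity *)

Section Polarization.
Context {R : realType}.
Local Notation plane := (measurableTypeR R * measurableTypeR R)%type.
Local Notation C := (Cplx R).
Implicit Types (f g : bergman R) (m n i j : nat) (e eta t : R).

Lemma nsqB (f g : C -> C) : L2_disc f -> L2_disc g ->
  nsq (fun z => f z - g z) = nsq f + nsq g - 2 * ip f g.
Proof.
move=> Lf Lg; have Lfg := L2B Lf Lg.
by rewrite -!ipE ipBl// (ipC f) (ipC g) !ipBl// (ipC g f); ring.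
Qed.

Lemma cmodulus_sqrD (z w : C) : cmodulus (z + w) ^+ 2 = cmodulus z ^+ 2 + cmodulus w ^+ 2 + 2 * dot z w.
Proof. by rewrite !cmodulus_sqr /dot; case: z => a b; case: w => c d /=; ring. Qed.

Lemma cmodulus_sqrB (z w : C) : cmodulus (z - w) ^+ 2 = cmodulus z ^+ 2 + cmodulus w ^+ 2 - 2 * dot z w.
Proof. by rewrite !cmodulus_sqr /dot; case: z => a b; case: w => c d /=; ring. Qed.

Lemma nsq_cutoffD (S : set plane) f g : measurable S ->
  nsq (cutoff S (f + g)) = nsq (cutoff S f) + nsq (cutoff S g) + 2 * ip (cutoff S f) (cutoff S g).
Proof.
move=> mS; rewrite -nsqD; [|exact: L2_cutoff (bergmanL2 _)..].
by congr nsq; apply/funext => z; rewrite /cutoff; case: ifP; rewrite ?addr0.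
Qed.

Lemma nsq_cutoffB (S : set plane) f g : measurable S ->
  nsq (cutoff S (f - g)) = nsq (cutoff S f) + nsq (cutoff S g) - 2 * ip (cutoff S f) (cutoff S g).
Proof.
move=> mS; rewrite -nsqB; [|exact: L2_cutoff (bergmanL2 _)..].
by congr nsq; apply/funext => z; rewrite /cutoff; case: ifP; rewrite ?subr0.
Qed.

Lemma nsq_cutoffZ (S : set plane) (c : C) f : measurable S ->
  nsq (cutoff S (c *: f)) = cmodulus c ^+ 2 * nsq (cutoff S f).
Proof.
move=> mS; rewrite -nsqZ; last exact: L2_cutoff (bergmanL2 _).
by congr nsq; apply/funext => z; rewrite /cutoff; case: ifP; rewrite ?mulr0.
Qed.

(** The error of the rank one model as a bilinear form; [mass_center] bounds its diagonal. *)
Definition site_form eta m f g : R := height eta m * ip (cutoff (inner eta m) f) (cutoff (inner eta m) g) -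
  weight_at eta m * dot (f (site_center m)) (g (site_center m)).

(** Take t = N; if N = 0, let t tend to 0. *)
Lemma scaled_bound (B A N : R) : 0 <= A -> 0 <= N ->
  (forall t, 0 < t -> t * B <= A * (N ^+ 2 + t ^+ 2)) -> B <= 2 * A * N.
Proof.
move=> A0 N0 h; have [NE|Nn] := eqVneq N 0; last first.
  have Np : 0 < N by rewrite lt_neqAle eq_sym Nn.
  by rewrite -(ler_pM2l Np); apply: (le_trans (h N Np)); apply: le_of_eq; ring.
have h0 (t : R) : 0 < t -> B <= A * t.
  by move=> t0; rewrite -(ler_pM2l t0); apply: (le_trans (h t t0)); rewrite NE; apply: le_of_eq; ring.
rewrite NE mulr0; apply/ler_addgt0Pl => e e_gt0; rewrite addr0.
have A1 : 0 < A + 1 by rewrite ltr_wpDl.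
apply: (le_trans (h0 _ (divr_gt0 e_gt0 A1))).
by rewrite mulrCA ler_piMr ?(ltW e_gt0)// ler_pdivrMr// mul1r lerDl.
Qed.

(** Polarising [mass_center] bounds the form by a sum of squared outer norms; replacing [g] by its
    real multiples and optimising, as in [scaled_bound], makes the bound linear in the outer norm of
    [f]. *)
Lemma site_form_le : exists2 K : R, 0 <= K & forall f g eta m, 0 < eta -> eta <= 8%:R^-1 ->
  nsq g <= 2 -> `|site_form eta m f g| <= K * eta * nrm (cutoff (outer m) f).
Proof.
have [K K0 hK] := @mass_center R; exists (2 * K); first by rewrite mulr_ge0.
move=> f g eta m e0 e8 g2.
have mI := @measurable_inner R eta m; have mO := @measurable_outer R m.
set N := nrm (cutoff (outer m) f); have N0 : 0 <= N by exact: nrm_ge0.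
have A0 : 0 <= K * eta by rewrite mulr_ge0// ltW.
have polar f' g' : 4 * site_form eta m f' g' <=
    K * eta * (2 * nsq (cutoff (outer m) f') + 2 * nsq (cutoff (outer m) g')).
  have := hK (f' + g') eta m e0 e8; have := hK (f' - g') eta m e0 e8.
  rewrite /mass (nsq_cutoffB f' g' mI) (nsq_cutoffB f' g' mO) (nsq_cutoffD f' g' mI) (nsq_cutoffD f' g' mO).
  rewrite (_ : (f' + g') (site_center m) = f' (site_center m) + g' (site_center m))//.
  rewrite (_ : (f' - g') (site_center m) = f' (site_center m) - g' (site_center m))//.
  rewrite cmodulus_sqrB cmodulus_sqrD /site_form !ler_norml => /andP[h1 _] /andP[_ h2].
  have := lerD h1 h2; rewrite -subr_ge0 => h; rewrite -subr_ge0.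
  apply: (le_trans h); apply: le_of_eq; ring.
have scaled (r : R) : 0 < `|r| -> r * site_form eta m f g <= K * eta * (N ^+ 2 + `|r| ^+ 2).
  move=> r0; have := polar f (r%:C *: g).
  have -> : site_form eta m f (r%:C *: g) = r * site_form eta m f g.
    rewrite /site_form mulrBr; congr (_ - _).
      rewrite mulrCA; congr (_ * _); rewrite ipC [in RHS]ipC -ipZl; [|exact: L2_cutoff (bergmanL2 _)..].
      apply: eq_Rintegral => p _; congr dot; rewrite /cutoff; case: ifP; rewrite ?mulr0//.
    rewrite (_ : (r%:C *: g) (site_center m) = r%:C * g (site_center m))// [dot (f _) _]dotC dotZl dotC; ring.
  rewrite nsq_cutoffZ// cmodulusR -/N -(nrm_sqr (cutoff (outer m) f)) -/N => h.
  have h2 : nsq (cutoff (outer m) g) <= 2.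
    by apply: le_trans g2; apply: nsq_cutoff_le => //; exact: bergmanL2.
  have h3 := ler_wpM2l (sqr_ge0 `|r|) h2.
  have h4 : K * eta * (2 * N ^+ 2 + 2 * (`|r| ^+ 2 * nsq (cutoff (outer m) g))) <=
      K * eta * (4 * (N ^+ 2 + `|r| ^+ 2)).
    by apply: ler_wpM2l => //; have := sqr_ge0 N; lra.
  have := le_trans h h4; rewrite (mulrCA _ 4) ler_pM2l//.
rewrite ler_norml; apply/andP; split.
  rewrite lerNl (_ : 2 * K * eta * N = 2 * (K * eta) * N); last by ring.
  apply: scaled_bound => // t t0; have := scaled (- t); rewrite normrN gtr0_norm//.
  by rewrite mulrN mulNr; exact.
rewrite (_ : 2 * K * eta * N = 2 * (K * eta) * N); last by ring.
by apply: scaled_bound => // t t0; have := scaled t; rewrite gtr0_norm//; exact.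
Qed.

End Polarization.

(** * Symbols carried by a sequence of sites *)

Section SiteSymbols.
Context {R : realType} (eta : R) (e0 : 0 < eta) (e8 : eta <= 8%:R^-1).
Context (site : nat -> nat) (site_inc : forall i j, (i < j)%N -> (site i < site j)%N).
Local Notation plane := (measurableTypeR R * measurableTypeR R)%type.
Local Notation C := (Cplx R).
Local Notation D := (@disc_coord R).
Local Notation E := (fun j => inner eta (site j)).
Local Notation h := (fun j => height eta (site j)).
Implicit Types (f g : bergman R) (i j n : nat) (t s al be : nat -> C) (M X : R).

Definition mass_cst : R := 64%:R ^+ 2 * weight_cst.

Lemma mass_cst_ge0 : 0 <= mass_cst.
Proof. by rewrite mulr_ge0 ?sqr_ge0// ltW// weight_cst_gt0. Qed.

Lemma site_disjoint : disjoint_family E.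
Proof.
move=> i j ij; apply/seteqP; split => // p [Ei Ej].
by rewrite -(outer_disjoint (site_inc ij)); split; exact: (inner_sub_outer e0 e8).
Qed.

Let mE i : measurable (E i). Proof. exact: measurable_inner. Qed.
Let ED i : E i `<=` D. Proof. exact: inner_sub. Qed.

Lemma sum_outer_le n (f : C -> C) : L2_disc f ->
  \sum_(i < n) nsq (cutoff (outer (site i)) f) <= nsq f.
Proof.
move=> Lf; apply: (@sum_cutoff_le R (fun i => outer (site i))) => //.
  by move=> i; exact: measurable_outer.
by move=> i j ij; apply: outer_disjoint; exact: site_inc.
Qed.

Definition sym al : C -> C := mult E (fun j => al j * (h j)%:C).

Lemma height_bound j : `|h j| <= weight_cst / eta ^+ 2.
Proof. by rewrite gtr0_norm ?height_gt0// height_le. Qed.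

Lemma L2_mult t M (u : C -> C) : (forall j, cmodulus (t j) <= M) -> L2_disc u ->
  L2_disc (fun z => mult E t z * u z).
Proof.
move=> tM Lu; have [mt bt] := bounded_mult site_disjoint mE tM.
exact: (L2M mt bt).
Qed.

Lemma sym_coef al M j : (forall j, cmodulus (al j) <= M) ->
  cmodulus (al j * (h j)%:C) <= M * (weight_cst / eta ^+ 2).
Proof.
move=> aM; rewrite cmodulusM cmodulusR; apply: ler_pM => //; first exact: cmodulus_ge0.
exact: height_bound.
Qed.

Lemma sym_bounded al M : (forall j, cmodulus (al j) <= M) ->
  bounded_symbol (sym al) (M * (weight_cst / eta ^+ 2)).
Proof. by move=> aM; apply: (bounded_mult site_disjoint mE) => j; exact: sym_coef. Qed.

Lemma root_coef t X j : 0 <= X -> (forall j, cmodulus (t j) ^+ 2 <= X ^+ 2 * h j) ->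
  cmodulus (t j) <= X * Num.sqrt (weight_cst / eta ^+ 2).
Proof.
move=> X0 tX; rewrite -[leLHS]ger0_norm ?cmodulus_ge0// -sqrtr_sqr.
rewrite -[X in X * _]ger0_norm// -[`|X|]sqrtr_sqr -sqrtrM ?sqr_ge0//; apply: ler_wsqrtr.
by apply: (le_trans (tX j)); apply: ler_wpM2l; [exact: sqr_ge0|exact: height_le].
Qed.

(* A Carleson embedding. *)
Lemma nsq_root_le t X f : 0 <= X -> (forall j, cmodulus (t j) ^+ 2 <= X ^+ 2 * h j) ->
  nsq (fun z => mult E t z * f z) <= X ^+ 2 * mass_cst * nsq f.
Proof.
move=> X0 tX; apply: (nsq_mult_le site_disjoint mE ED (bergmanL2 f)).
  exact: (L2_mult (fun j => root_coef j X0 tX) (bergmanL2 f)).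
move=> n; apply: (@le_trans _ _ (\sum_(i < n) X ^+ 2 * mass_cst * nsq (cutoff (outer (site i)) f))).
  apply: ler_sum => i _.
  apply: (@le_trans _ _ (X ^+ 2 * (h i * mass eta (site i) f))).
    by rewrite mulrA; apply: ler_wpM2r; [exact: nsq_ge0|exact: tX].
  by rewrite -mulrA; apply: ler_wpM2l; [exact: sqr_ge0|exact: mass_outer].
rewrite -mulr_sumr; apply: ler_wpM2l; last exact: sum_outer_le (bergmanL2 f).
by rewrite mulr_ge0 ?sqr_ge0 ?mass_cst_ge0.
Qed.

Lemma nrm_root_le t X f : 0 <= X -> (forall j, cmodulus (t j) ^+ 2 <= X ^+ 2 * h j) ->
  nrm (fun z => mult E t z * f z) <= X * Num.sqrt mass_cst * nrm f.
Proof.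
move=> X0 tX; apply: (le_trans (ler_wsqrtr (nsq_root_le f X0 tX))).
have XX := sqr_ge0 X; rewrite (sqrtrM _ (mulr_ge0 XX mass_cst_ge0)) (sqrtrM _ XX).
by rewrite sqrtr_sqr ger0_norm.
Qed.

(** Splitting the coefficient as t s lets each factor be measured against its own function. *)
Lemma ip_mult_le t s M X (u v : C -> C) : (forall j, cmodulus (t j) <= M) -> (forall j, cmodulus (s j) <= X) ->
  L2_disc u -> L2_disc v ->
  `|ip (fun z => mult E (fun j => t j * s j) z * u z) v| <=
  nrm (fun z => mult E t z * u z) * nrm (fun z => mult E (fun j => (s j)^*) z * v z).
Proof.
move=> tM sX Lu Lv.
have -> : ip (fun z => mult E (fun j => t j * s j) z * u z) v =
    ip (fun z => mult E t z * u z) (fun z => mult E (fun j => (s j)^*) z * v z).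
  have -> : (fun z => mult E (fun j => t j * s j) z * u z) = fun z => mult E s z * (mult E t z * u z).
    apply/funext => z; rewrite -(mult_comp t s (F := fun a b => a * b)) ?mulr0//; last exact: site_disjoint.
    by rewrite [mult E t z * _]mulrC mulrA.
  rewrite ipMl; congr ip; apply/funext => z; congr (_ * _).
  apply: (@mult_comp R E s s (fun a _ => a^*) z site_disjoint); exact: conjc0.
apply: ip_CauchySchwarz; [exact: L2_mult tM Lu|].
by apply: (@L2_mult _ X) => // j; rewrite cmodulus_conj.
Qed.

End SiteSymbols.

Section AlmostMultiplicative.
Context {R : realType} (eta : R) (e0 : 0 < eta) (e8 : eta <= 8%:R^-1).
Context (site : nat -> nat) (site_inc : forall i j, (i < j)%N -> (site i < site j)%N).
Local Notation plane := (measurableTypeR R * measurableTypeR R)%type.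
Local Notation C := (Cplx R).
Local Notation D := (@disc_coord R).
Local Notation E := (fun j => inner eta (site j)).
Local Notation h := (fun j => height eta (site j)).
Local Notation T al := (toeplitz (sym eta site al)).
Local Notation W := (@mass_cst R).
Implicit Types (f g : bergman R) (i j n : nat) (t s al be : nat -> C) (M X : R).

Let dE := site_disjoint e0 e8 site_inc.
Let mE i : measurable (E i). Proof. exact: measurable_inner. Qed.
Let ED i : E i `<=` D. Proof. exact: inner_sub. Qed.
Let h0 i : 0 <= h i. Proof. by rewrite ltW// height_gt0. Qed.
Let W0 : 0 <= W := mass_cst_ge0.

(** Half of the height goes to each side of a pairing. The available bound on the height grows like
    eta^-2, but by [nsq_root_le] multiplication by the roots is bounded on Bergman functions
    uniformly in [eta]. *)
Definition root j : C := (Num.sqrt (h j))%:C.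

Lemma root_sqr j : cmodulus (root j) ^+ 2 = h j.
Proof. by rewrite cmodulusR real_normK ?num_real// sqr_sqrtr. Qed.

Lemma root_coef1 j : cmodulus (root j) ^+ 2 <= 1 ^+ 2 * h j.
Proof. by rewrite root_sqr expr1n mul1r. Qed.

Lemma root_coefM al M j : (forall j, cmodulus (al j) <= M) ->
  cmodulus (al j * root j) ^+ 2 <= M ^+ 2 * h j.
Proof.
move=> aM; rewrite cmodulusM exprMn root_sqr; apply: ler_wpM2r => //.
rewrite ler_sqr ?nnegrE ?cmodulus_ge0 ?aM//; exact: le_trans (cmodulus_ge0 _) (aM j).
Qed.

Lemma root_root j : root j * root j = (h j)%:C.
Proof. by rewrite /root -rmorphM /= -expr2 sqr_sqrtr. Qed.

Lemma symE al : sym eta site al = mult E (fun j => al j * root j * root j).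
Proof.
rewrite /sym; congr mult; apply/funext => j.
by rewrite -mulrA root_root.
Qed.

Let bound_ge0 al M : (forall j, cmodulus (al j) <= M) -> 0 <= M.
Proof. by move=> aM; exact: le_trans (cmodulus_ge0 _) (aM 0%N). Qed.

Let root1 j := root_coef e0 e8 j ler01 root_coef1.

Lemma ip_sym_le al M (u v : C -> C) : (forall j, cmodulus (al j) <= M) -> L2_disc u -> L2_disc v ->
  `|ip (fun z => sym eta site al z * u z) v| <=
  nrm (fun z => mult E (fun j => al j * root j) z * u z) * nrm (fun z => mult E root z * v z).
Proof.
move=> aM Lu Lv; rewrite symE.
have := ip_mult_le e0 e8 site_inc (fun j => root_coef e0 e8 j (bound_ge0 aM) (fun j => root_coefM j aM)) root1 Lu Lv.
by rewrite (_ : (fun j => (root j)^*) = root)//; apply/funext => j; exact: conjc_real.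
Qed.

Lemma nrm_toeplitz_sym al M f : (forall j, cmodulus (al j) <= M) ->
  nrm (T al f) <= M * W * nrm f.
Proof.
move=> aM; have M0 := bound_ge0 aM.
have [->|n0] := eqVneq (nrm (T al f)) 0; first exact: (mulr_ge0 (mulr_ge0 M0 W0) (nrm_ge0 f)).
have np : 0 < nrm (T al f) by rewrite lt_neqAle eq_sym n0 nrm_ge0.
rewrite -(ler_pM2r np) -expr2 nrm_sqr -ipE.
rewrite (toeplitzP _ _ (sym_bounded e0 e8 site_inc aM)).
apply: (le_trans (ler_norm _)); apply: (le_trans (ip_sym_le aM (bergmanL2 _) (bergmanL2 _))).
have h1 := nrm_root_le e0 e8 site_inc f M0 (fun j => root_coefM j aM).
have h2 := nrm_root_le e0 e8 site_inc (T al f) ler01 root_coef1.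
apply: (le_trans (ler_pM (nrm_ge0 _) (nrm_ge0 _) h1 h2)).
apply: le_of_eq.
rewrite -[W in RHS](sqr_sqrtr W0); ring.
Qed.

Lemma offsite_root i j : cmodulus (if j == i then 0 else root j) ^+ 2 <= 1 ^+ 2 * h j.
Proof. by case: ifP => _; [rewrite cmodulus0 expr0n expr1n mul1r|exact: root_coef1]. Qed.

Lemma offsite_mass (d : R) f i : 0 < d -> (forall j, i != j ->
    h j * mass eta (site j) f <= d * (2^-1 ^+ i.+1 * 2^-1 ^+ j.+1)) ->
  nrm (fun z => mult E (fun j => if j == i then 0 else root j) z * f z) <=
  Num.sqrt (d * 2^-1 ^+ i.+1).
Proof.
move=> d0 fd; have c1 := offsite_root i.
apply: ler_wsqrtr; apply: (nsq_mult_le dE mE ED (bergmanL2 _)).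
  exact: (L2_mult e0 e8 site_inc (fun j => root_coef e0 e8 j ler01 c1) (bergmanL2 _)).
move=> n; apply: (@le_trans _ _ (\sum_(j < n) d * 2^-1 ^+ i.+1 * 2^-1 ^+ j.+1)).
  apply: ler_sum => j _; case: ifPn => ji.
    by rewrite cmodulus0 expr0n mul0r !mulr_ge0 ?exprn_ge0 ?invr_ge0// ltW.
  by rewrite root_sqr -mulrA; apply: fd; rewrite eq_sym.
rewrite -mulr_sumr ler_piMr ?sum_half_pow//.
by rewrite mulr_ge0 ?exprn_ge0 ?invr_ge0// ltW.
Qed.

Definition offsite be i j : C := if j == i then 0 else be j * (h j)%:C.

Lemma offsite_split be M f g i : (forall j, cmodulus (be j) <= M) ->
  ip (T be f) g = ip (toeplitz (site_symbol eta (site i)) (be i *: f)) g +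
    ip (fun z => mult E (offsite be i) z * f z) g.
Proof.
move=> bM; set F := be i *: f.
have Lb : L2_disc (fun z => mult E (offsite be i) z * f z).
  apply: (@L2_mult _ _ e0 e8 _ site_inc _ (M * (weight_cst / eta ^+ 2))); last exact: bergmanL2.
  move=> j; rewrite /offsite; case: ifP => _; last exact: sym_coef.
  by rewrite cmodulus0; exact: le_trans (cmodulus_ge0 _) (sym_coef e0 e8 site 0%N bM).
rewrite (toeplitzP _ _ (sym_bounded e0 e8 site_inc bM)).
rewrite (toeplitzP _ _ (site_symbol_bounded (site i) e0 e8)) -ipDl//; last exact: bergmanL2.
  congr ip; apply/funext => z; rewrite /sym.
  have -> : z = to_cplx (complex.Re z, complex.Im z) by case: z.
  rewrite (_ : F _ = be i * f (to_cplx (complex.Re z, complex.Im z)))// /site_symbol cutoffE.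
  have [[j _ Ej]|nE] := pselect ((\bigcup_i E i) (complex.Re z, complex.Im z)).
    rewrite !(mult_in _ dE Ej) /offsite; have [ji|ji] := eqVneq j i.
      by rewrite -ji mem_set// mul0r addr0 mulrA [be j * _]mulrC.
    rewrite (_ : (_ \in _) = false) ?mul0r ?add0r//.
    apply/negP => /set_mem Ei; move/eqP: ji; apply; exact: (disjoint_uniq dE Ej Ei).
  rewrite !(mult_out _ nE) (_ : (_ \in _) = false) ?mul0r ?add0r//.
  by apply/negP => /set_mem Ei; apply: nE; exists i.
exact: (L2_symbol F (site_symbol_bounded (site i) e0 e8)).
Qed.

(** The difference is the action of the squares other than the i-th, on which [f] has little mass;
    it is estimated by pairing it with itself. *)
Lemma offsite_image be M (d : R) f i : 0 < d -> (forall j, cmodulus (be j) <= M) ->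
  (forall j, i != j -> h j * mass eta (site j) f <= d * (2^-1 ^+ i.+1 * 2^-1 ^+ j.+1)) ->
  nrm (T be f - toeplitz (site_symbol eta (site i)) (be i *: f)) <=
  M * Num.sqrt W * Num.sqrt (d * 2^-1 ^+ i.+1).
Proof.
move=> d0 bM fd; have M0 := bound_ge0 bM; set g := _ - _.
have gg : nsq g = ip (fun z => mult E (offsite be i) z * f z) g.
  by rewrite -ipE {1}/g bipBl (offsite_split f g i bM) addrC addKr.
have [n0|n0] := eqVneq (nrm g) 0; first by rewrite n0 !mulr_ge0 ?sqrtr_ge0.
have np : 0 < nrm g by rewrite lt_neqAle eq_sym n0 nrm_ge0.
rewrite -(ler_pM2r np) -expr2 nrm_sqr gg; apply: (le_trans (ler_norm _)).
have -> : offsite be i = fun j => (if j == i then 0 else root j) * (be j * root j).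
  by apply/funext => j; rewrite /offsite; case: ifP; rewrite ?mul0r// mulrCA root_root.
have h5 := ip_mult_le e0 e8 site_inc (fun j => root_coef e0 e8 j ler01 (offsite_root i))
  (fun j => root_coef e0 e8 j M0 (fun j => root_coefM j bM)) (bergmanL2 f) (bergmanL2 g).
apply: (le_trans h5); rewrite [leRHS]mulrAC mulrC; apply: ler_pM; rewrite ?nrm_ge0//.
  apply: (nrm_root_le e0 e8 site_inc g M0) => j; rewrite cmodulus_conj; exact: root_coefM.
exact: offsite_mass.
Qed.

Context (kap : nat -> bergman R) (K1 K2 d : R) (K10 : 0 <= K1) (K20 : 0 <= K2) (d0 : 0 < d).
Context (form_le : forall f g eta m, 0 < eta -> eta <= 8%:R^-1 ->
  nsq g <= 2 -> `|site_form eta m f g| <= K1 * eta * nrm (cutoff (outer m) f)).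
Context (kap_kernel : forall i, site_kernel eta (site i) (kap i)).
Context (kap_norm : forall i, `|nsq (kap i) - 1| <= K2 * eta) (K2_small : K2 * eta <= 1).
Context (kap_dec : decoupled eta site kap d).

Let w i : R := weight_at eta (site i).
Let w0 i : 0 <= w i. Proof. exact: weight_at_ge0. Qed.
Let N i f : R := nrm (cutoff (outer (site i)) f).

Lemma kernel_value i : Num.sqrt (w i) * complex.Re (kap i (site_center (site i))) = nsq (kap i) /\
  Num.sqrt (w i) * complex.Im (kap i (site_center (site i))) = 0.
Proof.
split; first by rewrite -kap_kernel ipE.
have := kap_kernel i ((0 +i* 1 : C) *: kap i).
rewrite ip_eq0; last first.
  move=> p _; rewrite (_ : ((0 +i* 1 : C) *: kap i) (to_cplx p) = (0 +i* 1) * kap i (to_cplx p))//.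
  by rewrite /dot; case: (kap i _) => a b /=; ring.
rewrite (_ : ((0 +i* 1 : C) *: kap i) (site_center _) = (0 +i* 1) * kap i (site_center (site i)))//.
by case: (kap i _) => a b /= /eqP; rewrite mul0r mul1r sub0r mulrN eq_sym oppr_eq0 => /eqP.
Qed.

Lemma center_dot f i : w i * dot (f (site_center (site i))) (kap i (site_center (site i))) =
  Num.sqrt (w i) * complex.Re (f (site_center (site i))) * nsq (kap i).
Proof.
have [h1 h2] := kernel_value i; rewrite -[w i in LHS](sqr_sqrtr (w0 i)) -h1 /dot.
move: h2; move: (Num.sqrt _) (kap i _) (f _) => r [a b] [x y] /= rb.
have -> : r ^+ 2 * (x * a + y * b) = r * x * (r * a) + r * b * (r * y) by ring.
by rewrite rb; ring.
Qed.

Lemma N_Z c f i : N i (c *: f) = cmodulus c * N i f.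
Proof.
rewrite /N /nrm nsq_cutoffZ; last exact: measurable_outer.
by rewrite sqrtrM ?sqr_ge0// sqrtr_sqr ger0_norm ?cmodulus_ge0.
Qed.

(** The deviation of [T be] from acting diagonally at the i-th site. *)
Definition center_error be i f : bergman R := T be f - be i *: f.

(** The value at the centre is a pairing with the normalised kernel. On the i-th square that pairing
    is the rank one form up to [form_le], and the kernel contributes its squared norm, within K2 eta
    of 1; the other squares contribute little because the kernel decouples from them. *)
Lemma center_real be M f i : (forall j, cmodulus (be j) <= M) ->
  Num.sqrt (w i) * complex.Re (center_error be i f (site_center (site i))) <=
  M * ((K1 + K2 * Num.sqrt W) * eta * N i f + Num.sqrt W * Num.sqrt (d * 2^-1 ^+ i.+1) * nrm f).
Proof.
move=> bM; have M0 := bound_ge0 bM; set F := be i *: f.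
have split_ip := offsite_split f (kap i) i bM; rewrite -/F in split_ip.
have k2 : nsq (kap i) <= 2.
  have := kap_norm i; rewrite ler_norml => /andP[_]; rewrite lerBlDr => h1.
  by apply: (le_trans h1); rewrite -[leRHS]/(1 + 1) lerD2r.
have NF : N i F <= M * N i f by rewrite N_Z; apply: ler_wpM2r; [exact: nrm_ge0|exact: bM].
rewrite -kap_kernel bipBl split_ip -/F ip_site// kap_kernel.
have h1 := form_le F (site i) e0 e8 k2; rewrite /site_form center_dot -/(N i F) in h1.
have h2 : `|Num.sqrt (w i) * complex.Re (F (site_center (site i)))| <= Num.sqrt W * N i F.
  rewrite normrM ger0_norm ?sqrtr_ge0//.
  apply: (le_trans (ler_wpM2l (sqrtr_ge0 _) (normRe_le _))).
  rewrite -[cmodulus _]ger0_norm ?cmodulus_ge0// -sqrtr_sqr -sqrtrM ?w0// -sqrtrM//.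
  by apply: ler_wsqrtr; exact: center_outer.
have h3 : `|Num.sqrt (w i) * complex.Re (F (site_center (site i))) * (nsq (kap i) - 1)| <=
    Num.sqrt W * N i F * (K2 * eta) by rewrite normrM; apply: ler_pM.
have h4 : `|ip (fun z => mult E (offsite be i) z * f z) (kap i)| <=
    M * Num.sqrt W * nrm f * Num.sqrt (d * 2^-1 ^+ i.+1).
  have -> : offsite be i = fun j => (be j * root j) * (if j == i then 0 else root j).
    by apply/funext => j; rewrite /offsite; case: ifP; rewrite ?mulr0// -mulrA root_root.
  have := ip_mult_le e0 e8 site_inc (fun j => root_coef e0 e8 j M0 (fun j => root_coefM j bM))
    (fun j => root_coef e0 e8 j ler01 (offsite_root i)) (bergmanL2 f) (bergmanL2 (kap i)).
  move=> h5; apply: (le_trans h5); apply: ler_pM; rewrite ?nrm_ge0//.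
    exact: (nrm_root_le e0 e8 site_inc f M0 (fun j => root_coefM j bM)).
  rewrite (_ : (fun j => _) = (fun j => if j == i then 0 else root j)).
    by apply: offsite_mass => // j ij; exact: kap_dec.
  by apply/funext => j; case: ifP => _; [exact: conjc0|exact: conjc_real].
have h5 := ler_wpM2l (mulr_ge0 K10 (ltW e0)) NF.
have h6 := ler_wpM2l (mulr_ge0 (mulr_ge0 (sqrtr_ge0 W) K20) (ltW e0)) NF.
move: h1 h3 h4 h5 h6; rewrite !ler_norml => /andP[_ h1] /andP[_ h3] /andP[_ h4].
set x1 := height _ _ * _ in h1 *; set x2 := ip _ _ in h4 *.
set x3 := Num.sqrt (w i) * _ in h1 h3 *.
rewrite -/(w i) -/x3.
move=> h5 h6.
(* Three errors: the rank one approximation, the norm of the kernel, and the other squares. *)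
have -> : x1 + x2 - x3 = x1 - x3 * nsq (kap i) + x3 * (nsq (kap i) - 1) + x2 by ring.
rewrite (_ : Num.sqrt W * N i F * (K2 * eta) = Num.sqrt W * K2 * eta * N i F) in h3; last by ring.
apply: (le_trans (lerD (lerD (le_trans h1 h5) (le_trans h3 h6)) h4)).
by apply: le_of_eq; ring.
Qed.

Lemma cmodulus_by_rotation (z : C) X :
  (forall c : C, cmodulus c = 1 -> complex.Re (c * z) <= X) -> cmodulus z <= X.
Proof.
move=> hX; have [zE|z0] := eqVneq z 0.
  by have := hX 1 (eq_trans (cmodulusR 1) (normr1 _)); rewrite zE mulr0 cmodulus0.
have zp : cmodulus z != 0 by apply: contra z0 => /eqP/cmodulus_eq0/eqP.
have := hX ((cmodulus z)^-1%:C * z^*) _; rewrite cmodulusM cmodulusR cmodulus_conj.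
rewrite ger0_norm ?invr_ge0 ?cmodulus_ge0// mulVf// => /(_ erefl).
rewrite -mulrA (_ : z^* * z = (cmodulus z ^+ 2)%:C).
  by rewrite -rmorphM /= expr2 mulrA mulVf// mul1r.
by rewrite cmodulus_sqr; case: (z) => a b; apply/eqP; rewrite eq_complex /=; apply/andP; split; apply/eqP; ring.
Qed.

Lemma center_errorZ be M (c : C) i f : (forall j, cmodulus (be j) <= M) ->
  center_error be i (c *: f) = c *: center_error be i f.
Proof.
move=> bM; rewrite /center_error (toeplitzZ _ _ (sym_bounded e0 e8 site_inc bM)) scalerBr.
by rewrite !scalerA mulrC.
Qed.

Lemma center_cmodulus be M f i : (forall j, cmodulus (be j) <= M) ->
  Num.sqrt (w i) * cmodulus (center_error be i f (site_center (site i))) <=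
  M * ((K1 + K2 * Num.sqrt W) * eta * N i f + Num.sqrt W * Num.sqrt (d * 2^-1 ^+ i.+1) * nrm f).
Proof.
move=> bM; rewrite -[Num.sqrt (w i)]ger0_norm ?sqrtr_ge0// -cmodulusR -cmodulusM.
apply: cmodulus_by_rotation => c c1; have := center_real (c *: f) i bM.
rewrite N_Z bnrmZ c1 !mul1r (center_errorZ _ _ _ bM).
rewrite (_ : (c *: center_error be i f) (site_center _) = c * center_error be i f (site_center (site i)))//.
apply: le_trans; rewrite mulrCA; case: (c * _) => a b /=.
by rewrite mul0r subr0.
Qed.

Context (K3 : R) (K30 : 0 <= K3).
Context (center_le : forall f eta m, 0 < eta -> eta <= 8%:R^-1 ->
  `|height eta m * mass eta m f - weight_at eta m * cmodulus (f (site_center m)) ^+ 2| <=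
  K3 * eta * nsq (cutoff (outer m) f)).

Lemma nsq_cutoffB_le (S : set plane) f g : measurable S ->
  nsq (cutoff S (f - g)) <= 2 * (nsq (cutoff S f) + nsq (cutoff S g)).
Proof.
move=> mS; have := nsq_ge0 (cutoff S (f + g)).
rewrite nsq_cutoffD// => p; rewrite -subr_ge0 nsq_cutoffB//.
by apply: (le_trans p); apply: le_of_eq; ring.
Qed.

Lemma sqr_sum_le (a b c : R) : 0 <= c -> c <= a + b -> c ^+ 2 <= 2 * (a ^+ 2 + b ^+ 2).
Proof.
move=> c0 cab; apply: (@le_trans _ _ ((a + b) ^+ 2)).
  by rewrite ler_sqr ?nnegrE//; exact: le_trans c0 cab.
rewrite -subr_ge0; apply: (le_trans (sqr_ge0 (a - b))).
by apply: le_of_eq; ring.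
Qed.

Let slope : R := (K1 + K2 * Num.sqrt W) * eta.

(** Every term carries a factor [eta] or [d], so with [d = eta] the whole is O(eta). *)
Definition defect_cst : R := 2 * slope ^+ 2 + 2 * W * d + K3 * eta * (2 * W ^+ 2 + 2).

(** [mass_center] converts the central value of the error into its mass on the inner square, at the
    price of O(eta) times its outer mass. *)
Lemma site_mass_error be M f i : (forall j, cmodulus (be j) <= M) ->
  h i * mass eta (site i) (center_error be i f) <=
  M ^+ 2 * (2 * slope ^+ 2 + 2 * (K3 * eta)) * nsq (cutoff (outer (site i)) f) +
  2 * M ^+ 2 * W * d * nsq f * 2^-1 ^+ i.+1 +
  2 * (K3 * eta) * nsq (cutoff (outer (site i)) (T be f)).
Proof.
move=> bM; have M0 := bound_ge0 bM.
have KE : 0 <= K3 * eta by rewrite mulr_ge0// ltW.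
have q0 : 0 <= d * 2^-1 ^+ i.+1 by rewrite mulr_ge0 ?exprn_ge0 ?invr_ge0// ltW.
have h1 := center_le (center_error be i f) (site i) e0 e8.
rewrite ler_norml in h1; case/andP: h1 => _; rewrite lerBlDr => h1.
apply: (le_trans h1).
have h2 : w i * cmodulus (center_error be i f (site_center (site i))) ^+ 2 <=
    2 * ((M * slope * N i f) ^+ 2 + (M * Num.sqrt W * Num.sqrt (d * 2^-1 ^+ i.+1) * nrm f) ^+ 2).
  rewrite -[w i](sqr_sqrtr (w0 i)) -exprMn; apply: sqr_sum_le.
    by rewrite mulr_ge0 ?sqrtr_ge0 ?cmodulus_ge0.
  apply: (le_trans (center_cmodulus f i bM)).
  by apply: le_of_eq; rewrite /slope; ring.
have h3 := nsq_cutoffB_le (T be f) (be i *: f) (measurable_outer (site i)).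
rewrite nsq_cutoffZ in h3; last exact: measurable_outer.
have h4 : cmodulus (be i) ^+ 2 * nsq (cutoff (outer (site i)) f) <= M ^+ 2 * nsq (cutoff (outer (site i)) f).
  by apply: ler_wpM2r; [exact: nsq_ge0|rewrite ler_sqr ?nnegrE ?cmodulus_ge0].
have h5 := ler_wpM2l KE (le_trans h3 (ler_wpM2l (ler0n R 2) (lerD (lexx _) h4))).
apply: (le_trans (lerD h5 h2)).
rewrite !exprMn !nrm_sqr sqr_sqrtr// sqr_sqrtr//.
by apply: le_of_eq; ring.
Qed.

(** On the squares [T be f] is close to [be] times [f]. The site errors can be summed: outer masses
    add up to at most the squared norm by disjointness, and the decoupling terms form a geometric
    series. *)
Lemma symbol_defect be M f : (forall j, cmodulus (be j) <= M) ->
  nsq (fun z => mult E root z * (T be f z - mult E be z * f z)) <= M ^+ 2 * defect_cst * nsq f.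
Proof.
move=> bM; have M0 := bound_ge0 bM.
have KE : 0 <= K3 * eta by rewrite mulr_ge0// ltW.
have Lu : L2_disc (fun z => T be f z - mult E be z * f z).
  by apply: L2B (bergmanL2 _) _; exact: (L2_mult e0 e8 site_inc bM (bergmanL2 f)).
apply: (nsq_mult_le dE mE ED Lu).
  exact: (L2_mult e0 e8 site_inc root1 Lu).
move=> n.
apply: (@le_trans _ _ (\sum_(i < n) (M ^+ 2 * (2 * slope ^+ 2 + 2 * (K3 * eta)) * nsq (cutoff (outer (site i)) f) +
  2 * M ^+ 2 * W * d * nsq f * 2^-1 ^+ i.+1 +
  2 * (K3 * eta) * nsq (cutoff (outer (site i)) (T be f))))).
  apply: ler_sum => i _; apply: le_trans (site_mass_error f i bM).
  rewrite root_sqr; apply: le_of_eq; congr (_ * nsq _).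
  apply/funext => z; rewrite /cutoff; case: ifPn => // /set_mem Ei.
  have zE : z = to_cplx (complex.Re z, complex.Im z) by case: z {Ei}.
  rewrite zE in Ei *; rewrite (mult_in _ dE (j := i))//.
rewrite !big_split /= -!mulr_sumr.
have M2 := sqr_ge0 M; have q := nsq_ge0 f.
have s1 := sum_outer_le site_inc n (bergmanL2 f).
have s2 := sum_outer_le site_inc n (bergmanL2 (T be f)).
have s3 : nsq (T be f) <= (M * W) ^+ 2 * nsq f.
  rewrite -!nrm_sqr -exprMn ler_sqr ?nnegrE ?nrm_ge0//; first exact: nrm_toeplitz_sym.
  exact: (mulr_ge0 (mulr_ge0 M0 W0) (nrm_ge0 f)).
have c1 : 0 <= M ^+ 2 * (2 * slope ^+ 2 + 2 * (K3 * eta)).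
  by apply: mulr_ge0 => //; apply: addr_ge0; apply: mulr_ge0 => //; exact: sqr_ge0.
have c2 : 0 <= 2 * M ^+ 2 * W * d * nsq f.
  exact: (mulr_ge0 (mulr_ge0 (mulr_ge0 (mulr_ge0 (ler0n R 2) M2) W0) (ltW d0)) q).
have c3 : 0 <= 2 * (K3 * eta) by exact: (mulr_ge0 (ler0n R 2) KE).
have := lerD (lerD (ler_wpM2l c1 s1) (ler_wpM2l c2 (sum_half_pow n))) (ler_wpM2l c3 (le_trans s2 s3)).
move=> l; apply: (le_trans l).
by apply: le_of_eq; rewrite /defect_cst; ring.
Qed.

(** The difference is the projection of [sym al] times u, where u = T be f - be f is small in the
    height-weighted norm by [symbol_defect]. It is paired with itself, half of the height going to
    each factor. *)
Lemma almost_multiplicative al be M M' f :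
  (forall j, cmodulus (al j) <= M) -> (forall j, cmodulus (be j) <= M') ->
  nsq (T al (T be f) - T (fun j => al j * be j) f) <= M ^+ 2 * M' ^+ 2 * (defect_cst * W) * nsq f.
Proof.
move=> aM bM; have M0 := bound_ge0 aM; have M'0 := bound_ge0 bM.
set g := T al _ - _.
pose u z := T be f z - mult E be z * f z.
have Lu : L2_disc u.
  by apply: L2B (bergmanL2 _) _; exact: (L2_mult e0 e8 site_inc bM (bergmanL2 f)).
have abM j : cmodulus (al j * be j) <= M * M'.
  by rewrite cmodulusM ler_pM ?cmodulus_ge0.
have gg : nsq g = ip (fun z => sym eta site al z * u z) g.
  rewrite -ipE {1}/g bipBl (toeplitzP _ _ (sym_bounded e0 e8 site_inc aM)).
  rewrite (toeplitzP _ _ (sym_bounded e0 e8 site_inc abM)) -ipBl; last exact: bergmanL2.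
  - congr ip; apply/funext => z; rewrite /u mulrBr; congr (_ - _); rewrite mulrA; congr (_ * _).
    rewrite /sym (mult_comp _ be (F := fun a b => a * b) z dE) ?mulr0//.
    by congr (mult _ _ z); apply/funext => j; rewrite mulrAC.
  - exact: (L2_symbol _ (sym_bounded e0 e8 site_inc aM)).
  - exact: (L2_symbol _ (sym_bounded e0 e8 site_inc abM)).
have Lr : L2_disc (fun z => mult E root z * u z) := L2_mult e0 e8 site_inc root1 Lu.
have h1 : nsq (fun z => mult E (fun j => al j * root j) z * u z) <= M ^+ 2 * (M' ^+ 2 * defect_cst * nsq f).
  rewrite (_ : (fun z => _) = fun z => mult E al z * (mult E root z * u z)).
    have [ma ba] := bounded_mult dE mE aM.
    apply: (le_trans (nsqM_le ma ba Lr)); apply: ler_wpM2l; first exact: sqr_ge0.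
    exact: symbol_defect.
  apply/funext => z; rewrite mulrA; congr (_ * _).
  by rewrite (mult_comp _ _ (F := fun a b => a * b) z dE) ?mulr0.
have h2 := nsq_root_le e0 e8 site_inc g ler01 root_coef1; rewrite expr1n mul1r in h2.
have h3 := le_trans (ler_norm _) (ip_sym_le aM Lu (bergmanL2 g)); rewrite -gg in h3.
have [n0|n0] := eqVneq (nsq g) 0.
  rewrite n0 in h3 *; have := ler_wpM2r W0 (le_trans (nsq_ge0 _) h1).
  by rewrite mul0r => /le_trans; apply; apply: le_of_eq; ring.
have np : 0 < nsq g by rewrite lt_neqAle eq_sym n0 nsq_ge0.
have h4 : nsq g ^+ 2 <= M ^+ 2 * (M' ^+ 2 * defect_cst * nsq f) * (W * nsq g).
  have h5 : nsq g ^+ 2 <= (nrm (fun z => mult E (fun j => al j * root j) z * u z) *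
      nrm (fun z => mult E root z * g z)) ^+ 2.
    by rewrite ler_sqr ?nnegrE ?nsq_ge0// mulr_ge0 ?nrm_ge0.
  apply: (le_trans h5); rewrite exprMn !nrm_sqr; apply: ler_pM => //; exact: nsq_ge0.
rewrite -(ler_pM2r np) -expr2; apply: (le_trans h4).
by apply: le_of_eq; ring.
Qed.

End AlmostMultiplicative.

(** * The essential spectrum *)

Section Parametrix.
Context {R : realType}.
Local Notation C := (Cplx R).
Implicit Types (f g u v : bergman R) (e : R).

Section Neumann.
Context (E : bergman R -> bergman R) (E_sub : forall f g, E (f - g) = E f - E g).
Context (E_half : forall f, nrm (E f) <= 2^-1 * nrm f).

(** Fixed point iteration of u -> v - E u, which contracts distances by 1/2. *)
Lemma neumann v : exists u, u + E u = v.
Proof.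
pose u := fix u n := if n is n'.+1 then v - E (u n') else 0 : bergman R.
have nv := nrm_ge0 v.
have z0 : nrm (0 : bergman R) = 0 by rewrite -(scale0r (0 : bergman R)) bnrmZ cmodulus0 mul0r.
have u0 k : nrm (u k) <= 2 * nrm v.
  elim: k => [|k IH]; first by rewrite [u 0%N]/(0 : bergman R) z0 mulr_ge0.
  by apply: (le_trans (bnrmB _ _)); have := E_half (u k); lra.
have du n k : nrm (u (n + k)%N - u n) <= 2^-1 ^+ n * (2 * nrm v).
  elim: n => [|n IH]; first by rewrite add0n expr0 mul1r subr0; exact: u0.
  have -> : u (n.+1 + k)%N - u n.+1 = E (u n - u (n + k)%N).
    by rewrite E_sub addSn /= opprB addrC addrA subrK.
  rewrite exprS -mulrA.
  apply: (le_trans (E_half _)); rewrite -opprB bnrmN.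
  by apply: ler_wpM2l => //; rewrite invr_ge0.
have small e : 0 < e -> exists n0, forall n, (n0 <= n)%N -> 2^-1 ^+ n * (2 * nrm v) <= e.
  move=> e0; have p0 : 0 < 2 * nrm v + 1 by rewrite ltr_wpDl ?mulr_ge0.
  have [n0 hn] := half_pow_vanish (divr_gt0 e0 p0); exists n0 => n /hn h.
  apply: (@le_trans _ _ (2^-1 ^+ n * (2 * nrm v + 1))).
    by apply: ler_wpM2l; [rewrite exprn_ge0 ?invr_ge0|rewrite lerDl].
  by rewrite -ler_pdivlMr.
have [w hw] : exists w, forall e, 0 < e -> exists n0, forall n, (n0 <= n)%N -> nrm (u n - w) <= e.
  apply: bergman_complete => e e0; have [n0 hn] := small e e0; exists n0 => n m.
  wlog nm : n m / (n <= m)%N => [hw hn0 hm0|hn0 _].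
    case/orP: (leq_total n m) => nm; first exact: hw.
    by rewrite -opprB bnrmN; exact: hw.
  rewrite -opprB bnrmN -(subnKC nm); exact: le_trans (du _ _) (hn n hn0).
exists w; apply/eqP; rewrite -subr_eq0; apply/eqP/bnrm_eq0/le_anti; rewrite nrm_ge0 andbT.
apply/ler_addgt0Pl => e e0; rewrite addr0.
have e2 : 0 < e / 2 by rewrite divr_gt0.
have [n0 hn] := hw _ e2.
have h1 := hn n0 (leqnn _); have h2 := hn n0.+1 (leqnSn _).
have -> : w + E w - v = E (w - u n0) - (u n0.+1 - w).
  by rewrite E_sub /= !opprB addrACA addKr (addrC (E w)).
apply: (le_trans (bnrmB _ _)); rewrite (splitr e); apply: lerD => //.
apply: (le_trans (E_half _)); rewrite -opprB bnrmN; apply: le_trans h1.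
by rewrite ler_piMl ?nrm_ge0// invf_le1// ler1n.
Qed.

End Neumann.

(** The first estimate and [neumann] make [S] onto, the second makes it injective; so kernel and
    cokernel are zero and the range is everything. *)
Lemma fredholm_parametrix (S Q : bergman R -> bergman R) : bounded_operator S ->
  (forall f g, Q (f - g) = Q f - Q g) ->
  (forall f, nrm (S (Q f) - f) <= 2^-1 * nrm f) ->
  (forall f, nrm (Q (S f) - f) <= 2^-1 * nrm f) -> fredholm S.
Proof.
move=> bS Qsub SQ QS; have [lS _] := bS.
have Ssub f g : S (f - g) = S f - S g.
  by rewrite -[f - g]/(f + - g) -scaleN1r addrC lS scaleN1r addrC.
have surj v : exists u, S u = v.
  have [|u hu] := @neumann (fun f => S (Q f) - f) _ SQ v.
    by move=> f g; rewrite Qsub Ssub !opprB !addrA addrAC [RHS]addrAC; congr (_ + g); rewrite addrAC.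
  by exists (Q u); rewrite -hu addrC subrK.
split => //.
- exists 0%N, (fun i : 'I_0 => 0) => v Sv; exists (fun i => 0); rewrite big_ord0.
  have Q0 : Q 0 = 0 by have := Qsub 0 0; rewrite !subrr.
  have := QS v; rewrite Sv Q0 sub0r bnrmN => h.
  by apply: bnrm_eq0; apply/le_anti; rewrite nrm_ge0 andbT; lra.
- rewrite (_ : range S = setT); first exact: closedT.
  by apply/seteqP; split => // v _; have [u <-] := surj v; exists u.
- exists 0%N, (fun i : 'I_0 => 0) => v; have [u <-] := surj v.
  by exists u, (fun i => 0); rewrite big_ord0 addr0.
Qed.

End Parametrix.

(** * Choice of the sites *)

Section Sites.
Context {R : realType}.
Local Notation C := (Cplx R).

Lemma increasing_ge (site : nat -> nat) : (forall i j, (i < j)%N -> (site i < site j)%N) ->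
  forall n, (n <= site n)%N.
Proof. by move=> inc; elim=> // n IH; exact: leq_ltn_trans IH (inc n n.+1 (ltnSn n)). Qed.

Lemma weakly_null_subsequence (u : nat -> bergman R) (site : nat -> nat) :
  (forall i j, (i < j)%N -> (site i < site j)%N) -> weakly_null u -> weakly_null (u \o site).
Proof.
move=> inc wu g e e0; have [n hn] := wu g e e0; exists n => m nm; apply: hn.
exact: leq_trans nm (increasing_ge inc m).
Qed.

(** [K] is fixed before [eta]; this order of quantifiers is what lets [eta] be chosen small
    depending on the x_n and on eps. *)
Lemma sites_exist : exists2 K : R, 0 <= K & forall eta : R, 0 < eta -> eta <= 8%:R^-1 -> K * eta <= 1 ->
  exists (site : nat -> nat) (ee : nat -> bergman R),
  [/\ forall i j, (i < j)%N -> (site i < site j)%N, decoupled eta site ee eta,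
      forall j, maximizing eta (site j) (ee j), weakly_null ee &
      forall (al be : nat -> C) (M M' : R) f,
        (forall j, cmodulus (al j) <= M) -> (forall j, cmodulus (be j) <= M') ->
        nsq (toeplitz (sym eta site al) (toeplitz (sym eta site be) f) -
             toeplitz (sym eta site (fun j => al j * be j)) f) <= (M * M') ^+ 2 * (K * eta) * nsq f].
Proof.
have [K1 K10 hK1] := @site_form_le R.
have [K2 K20 hK2] := @site_kernels R.
have [K3 K30 hK3] := @mass_center R.
pose W := @mass_cst R; have W0 : 0 <= W := mass_cst_ge0.
pose a := K1 + K2 * Num.sqrt W.
pose K4 := (2 * a ^+ 2 + 2 * W + K3 * (2 * W ^+ 2 + 2)) * W.
have a2 := sqr_ge0 a; have W2 := sqr_ge0 W.
have K40 : 0 <= K4.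
  apply: mulr_ge0 => //; apply: addr_ge0; last by apply: mulr_ge0 => //; lra.
  by apply: addr_ge0; apply: mulr_ge0.
exists (K2 + K4); first exact: addr_ge0.
move=> eta e0 e8 Ke.
have K4e : 0 <= K4 * eta by rewrite mulr_ge0// ltW.
have K2e : K2 * eta <= 1 by move: Ke; rewrite mulrDl; lra.
have [kap hkap] := hK2 eta e0 e8; have [ee hee] := maximizers e0 e8.
have wk := kernels_weakly_null e0 e8 (fun m => (hkap m).1).
have we := maximizers_weakly_null e0 e8 hee.
have k2 m : nsq (kap m) <= 2.
  have := (hkap m).2; rewrite ler_norml => /andP[_]; rewrite lerBlDr => h1.
  by apply: (le_trans h1); rewrite -[leRHS]/(1 + 1) lerD2r.
have e2 m : nsq (ee m) <= 2 by have [h _ _] := hee m; apply: (le_trans h); rewrite ler1n.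
(* The decoupling tolerance is [eta] itself, so that the term of [defect_cst] in [d] is O(eta)
   too. *)
have [site [inc dk de]] := sparse_sites e0 e8 e0 wk we k2 e2.
exists site, (ee \o site); split => //.
  exact: weakly_null_subsequence.
move=> al be M M' f aM bM.
have := almost_multiplicative e0 e8 inc K10 K20 e0 (fun f g eta m => @hK1 f g eta m)
  (fun i => (hkap (site i)).1) (fun i => (hkap (site i)).2) K2e dk K30 (fun f eta m => @hK3 f eta m) f aM bM.
move=> h; apply: (le_trans h); apply: ler_wpM2r; first exact: nsq_ge0.
rewrite -exprMn; apply: ler_wpM2l; first exact: sqr_ge0.
apply: (@le_trans _ _ (K4 * eta)); last by rewrite mulrDl lerDr mulr_ge0// ltW.
rewrite /K4 mulrAC; apply: ler_wpM2r => //.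
rewrite /defect_cst -/W -/a.
have e1 : eta <= 1 by apply: (le_trans e8); rewrite invf_le1// ler1n.
have ea : (a * eta) ^+ 2 <= a ^+ 2 * eta.
  by rewrite exprMn; apply: ler_wpM2l => //; rewrite expr2 ler_piMl// ltW.
rewrite (_ : (2 * a ^+ 2 + 2 * W + K3 * (2 * W ^+ 2 + 2)) * eta = 2 * (a ^+ 2 * eta) + 2 * W * eta + K3 * eta * (2 * W ^+ 2 + 2)); last by ring.
by rewrite !lerD2r ler_wpM2l.
Qed.

End Sites.

(** * Invertibility away from the prescribed values *)

Section Resolvent.
Context {R : realType} (eta : R) (e0 : 0 < eta) (e8 : eta <= 8%:R^-1).
Context (site : nat -> nat) (site_inc : forall i j, (i < j)%N -> (site i < site j)%N).
Local Notation C := (Cplx R).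
Local Notation T al := (toeplitz (sym eta site al)).
Implicit Types (f g : bergman R) (al be : nat -> C) (M : R).

Let dE := site_disjoint e0 e8 site_inc.

Lemma toeplitz_scale (k : C) (a : C -> C) M f : bounded_symbol a M ->
  toeplitz (fun z => k * a z) f = k *: toeplitz a f.
Proof.
move=> ba; rewrite -(toeplitzZ _ _ ba); congr bergman_proj; apply/funext => z.
rewrite (_ : (k *: f) z = k * f z)//; ring.
Qed.

Lemma toeplitz_symZ (k : C) al M f : (forall j, cmodulus (al j) <= M) ->
  T (fun j => k * al j) f = k *: T al f.
Proof.
move=> aM; rewrite -(toeplitz_scale _ _ (sym_bounded e0 e8 site_inc aM)).
congr (toeplitz _ f); apply/funext => z.
rewrite /sym (mult_comp _ _ (F := fun a _ => k * a) z dE) ?mulr0//.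
by congr (mult _ _ z); apply/funext => j; rewrite mulrA.
Qed.

Lemma toeplitz_symDl al be M M' f :
  (forall j, cmodulus (al j) <= M) -> (forall j, cmodulus (be j) <= M') ->
  T (fun j => al j + be j) f = T al f + T be f.
Proof.
move=> aM bM.
rewrite -(toeplitz_symD _ (sym_bounded e0 e8 site_inc aM) (sym_bounded e0 e8 site_inc bM)).
congr (toeplitz _ f); apply/funext => z.
rewrite /sym (mult_comp _ _ (F := fun a b => a + b) z dE) ?addr0//.
by congr (mult _ _ z); apply/funext => j; rewrite mulrDl.
Qed.

Context (K : R) (mul_le : forall (al be : nat -> C) (M M' : R) f,
  (forall j, cmodulus (al j) <= M) -> (forall j, cmodulus (be j) <= M') ->
  nsq (T al (T be f) - T (fun j => al j * be j) f) <= (M * M') ^+ 2 * (K * eta) * nsq f).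

(** The inverse of c_j - mu is -1/mu + be_j with be_j = c_j / (mu (c_j - mu)). Almost
    multiplicativity turns this scalar identity into a two-sided parametrix, -1/mu acting as a
    multiple of the identity. *)
Lemma resolvent (c : nat -> C) (mu : C) M (eps : R) : 0 < eps -> (forall j, cmodulus (c j) <= M) ->
  eps <= cmodulus mu -> (forall j, eps <= cmodulus (c j - mu)) ->
  (M * (M / eps ^+ 2)) ^+ 2 * (K * eta) <= 2^-1 ^+ 2 ->
  fredholm (fun f => T c f - mu *: f).
Proof.
move=> ep cM mue cmue small.
have sc := sym_bounded e0 e8 site_inc cM.
have nz (z : C) : eps <= cmodulus z -> z != 0.
  by move=> h; apply: contraTneq (lt_le_trans ep h) => ->; rewrite cmodulus0 ltxx.
have mu0 := nz _ mue; have cmu0 j := nz _ (cmue j).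
have M0 : 0 <= M := le_trans (cmodulus_ge0 _) (cM 0%N).
pose be j : C := c j / (mu * (c j - mu)).
have bM j : cmodulus (be j) <= M / eps ^+ 2.
  rewrite /be cmodulusM cmodulusV ?mulf_neq0// cmodulusM; apply: ler_pM => //.
  - exact: cmodulus_ge0.
  - by rewrite invr_ge0 mulr_ge0 ?cmodulus_ge0.
  - rewrite lef_pV2 ?posrE ?exprn_gt0//; last by rewrite mulr_gt0// (lt_le_trans ep).
    by rewrite expr2 ler_pM// ltW.
(* Thanks to this identity the remainders of the parametrix are exactly the multiplicativity defects
   of the pairs (c, be) and (be, c). *)
have bE j : c j * be j = mu^-1 * c j + mu * be j.
  by rewrite /be; field; rewrite mu0 cmu0.
have sub al M' f g : (forall j, cmodulus (al j) <= M') -> T al (f - g) = T al f - T al g.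
  by move=> aM; exact: toeplitzB (sym_bounded e0 e8 site_inc aM).
have half (al be' : nat -> C) (M1 M2 : R) f : (forall j, cmodulus (al j) <= M1) ->
    (forall j, cmodulus (be' j) <= M2) -> (M1 * M2) ^+ 2 * (K * eta) <= 2^-1 ^+ 2 ->
    nrm (T al (T be' f) - T (fun j => al j * be' j) f) <= 2^-1 * nrm f.
  move=> aM b'M sm; rewrite -ler_sqr ?nnegrE ?mulr_ge0 ?nrm_ge0 ?invr_ge0//.
  rewrite exprMn !nrm_sqr; apply: (le_trans (mul_le f aM b'M)).
  by apply: ler_wpM2r => //; exact: nsq_ge0.
have cbE f : T (fun j => c j * be j) f = mu^-1 *: T c f + mu *: T be f.
  rewrite -(toeplitz_symZ _ _ cM) -(toeplitz_symZ _ _ bM).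
  rewrite -(@toeplitz_symDl _ _ (cmodulus mu^-1 * M) (cmodulus mu * (M / eps ^+ 2))).
  - by congr (T _ f); apply/funext => j; rewrite bE.
  - by move=> j; rewrite cmodulusM ler_wpM2l ?cmodulus_ge0.
  - by move=> j; rewrite cmodulusM ler_wpM2l ?cmodulus_ge0.
have bcE f : T (fun j => be j * c j) f = mu^-1 *: T c f + mu *: T be f.
  by rewrite -cbE; congr (T _ f); apply/funext => j; rewrite mulrC.
apply: (@fredholm_parametrix R _ (fun f => - mu^-1 *: f + T be f)).
- have -> : (fun f => T c f - mu *: f) = toeplitz (fun z => sym eta site c z + - mu).
    apply/funext => f; rewrite (toeplitz_symD _ sc (bounded_symbol_cst _)) toeplitz_cst.
    by rewrite scaleNr.
  apply: (@toeplitz_bounded _ _ (M * (weight_cst / eta ^+ 2) + cmodulus (- mu))).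
  split; first exact: (measurable_discD sc.1 (bounded_symbol_cst (- mu)).1).
  by move=> z Dz; apply: (le_trans (cmodulusD _ _)); rewrite lerD2r; exact: sc.2.
- by move=> f g; rewrite (sub _ _ _ _ bM) scalerBr opprD addrACA.
- move=> f; have := half c be M (M / eps ^+ 2) f cM bM small; rewrite cbE.
  have -> : T c (- mu^-1 *: f + T be f) = - (mu^-1 *: T c f) + T c (T be f).
    by rewrite (toeplitzD _ _ sc) (toeplitzZ _ _ sc) scaleNr.
  rewrite scalerDr scalerA mulrN mulfV// scaleN1r.
  rewrite (_ : _ - _ - f = T c (T be f) - (mu^-1 *: T c f + mu *: T be f))//.
  by rewrite opprD opprK [_ + T c _]addrC addrAC addrA subrK opprD addrA.
- move=> f; have := half be c (M / eps ^+ 2) M f bM cM; rewrite bcE [_ * M]mulrC => /(_ small).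
  have sb := sym_bounded e0 e8 site_inc bM.
  rewrite (toeplitzB _ _ sb) (toeplitzZ _ _ sb) scalerBr scalerA mulNr mulVf// scaleN1r opprK scaleNr.
  rewrite (_ : _ + _ - f = T be (T c f) - (mu^-1 *: T c f + mu *: T be f))//.
  by rewrite addrAC addrK addrCA -opprD.
Qed.

End Resolvent.

(** * Infinite codimension by a gliding hump *)

Section NotFredholm.
Context {R : realType}.
Local Notation C := (Cplx R).
Implicit Types (f g u v : bergman R) (e : R).

Lemma eventually_all n (P : 'I_n -> nat -> Prop) :
  (forall i, exists N, forall m, (N <= m)%N -> P i m) -> exists N, forall m, (N <= m)%N -> forall i, P i m.
Proof.
move=> /choice[N hN]; exists (\max_i N i)%N => m Nm i; apply: hN.
by apply: leq_trans Nm; exact: leq_bigmax.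
Qed.

Lemma ip0l g : ip (0 : bergman R) g = 0.
Proof. by have := bipBl (0 : bergman R) 0 g; rewrite !subrr. Qed.

Lemma ip_suml n (F : nat -> bergman R) g : ip (\sum_(i < n) F i) g = \sum_(i < n) ip (F i) g.
Proof.
elim: n => [|n IH]; first by rewrite !big_ord0 ip0l.
by rewrite !big_ord_recr /= bipDl IH.
Qed.

Lemma ip_sum_ord n (F : 'I_n -> bergman R) g : ip (\sum_i F i) g = \sum_i ip (F i) g.
Proof.
elim: n F => [|n IH] F; first by rewrite !big_ord0 ip0l.
by rewrite !big_ord_recr /= bipDl IH.
Qed.

Definition vanishing (r : nat -> R) := forall e, 0 < e -> exists N, forall m, (N <= m)%N -> r m <= e.

(** Along a sparse subsequence t_l of [b], the vector v = sum_l 8^-l t_l pairs with t_l to at least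
    8^-l / 4 minus a multiple of 16^-l. A vector S u + sum_i d_i c_i pairs with t_l to O(16^-l)
    only: S is symmetric with S t_l small, and t_l is almost orthogonal to the finitely many c_i. *)
Lemma infinite_cokernel (S : bergman R -> bergman R) (b : nat -> bergman R) :
  (forall f g, ip (S f) g = ip f (S g)) -> weakly_null b -> (forall l, nsq (b l) <= 1) ->
  (forall l, 2^-1 <= nsq (b l)) -> vanishing (fun l => nrm (S (b l))) -> ~ finite_dim_cokernel S.
Proof.
move=> Ssym wb b1 b2 Sb [n [c hc]].
pose q l : R := 8%:R^-1 ^+ l; have q0 l : 0 < q l by rewrite exprn_gt0// invr_gt0.
pose r l : R := 16%:R^-1 ^+ l; have r0 l : 0 < r l by rewrite exprn_gt0// invr_gt0.
(* [ip] is only the real part of the inner product, so complex coefficients require testing against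
   i c_i as well. *)
pose ci i := (0 +i* 1 : C) *: c i.
have [|l a|phi [inc hQ hP]] := @select_subsequence
  (fun l m => nrm (S (b m)) <= r l /\ forall i, `|ip (b m) (c i)| <= r l /\ `|ip (b m) (ci i)| <= r l)
  (fun l a m => `|ip (b m) (b a)| <= r l).
- move=> l; have [N1 h1] := Sb _ (r0 l).
  have [N2 h2] : exists N, forall m, (N <= m)%N -> forall i, `|ip (b m) (c i)| <= r l /\ `|ip (b m) (ci i)| <= r l.
    apply: eventually_all => i; have [n1 hn1] := wb (c i) _ (r0 l); have [n2 hn2] := wb (ci i) _ (r0 l).
    by exists (maxn n1 n2) => m; rewrite geq_max => /andP[/hn1 ? /hn2 ?].
  by exists (maxn N1 N2) => m; rewrite geq_max => /andP[/h1 ? /h2 ?].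
- exact: wb.
pose t l := b (phi l).
pose V m := \sum_(l < m) (q l)%:C *: t l.
have nt l : nrm (t l) <= 1 by rewrite -[leRHS]sqrtr1; exact: (ler_wsqrtr (b1 _)).
have VS m : V m.+1 = V m + (q m)%:C *: t m by rewrite /V big_ord_recr.
move: V VS (fun l => erefl (V l) : V l = \sum_(i < l) (q i)%:C *: t i) => V VS VE.
have tail m k : nrm (V (m + k)%N - V m) <= 2 * (q m - q (m + k)%N).
  elim: k => [|k IH]; first by rewrite addn0 !subrr mulr0 -(scale0r (0 : bergman R)) bnrmZ cmodulus0 mul0r.
  rewrite addnS VS addrAC; apply: (le_trans (bnrmD (V (m + k)%N - V m) _)).
  have h : nrm ((q (m + k)%N)%:C *: t (m + k)%N) <= q (m + k)%N.
    by rewrite bnrmZ cmodulusR gtr0_norm// ler_piMr// ltW.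
  apply: (le_trans (lerD IH h)); rewrite -subr_ge0.
  rewrite (_ : q (m + k).+1 = 8%:R^-1 * q (m + k)%N); last by rewrite /q exprS.
  rewrite (_ : _ - _ = 3%:R / 4%:R * q (m + k)%N); last by field.
  by rewrite mulr_ge0// ltW.
have qv : vanishing q.
  move=> e ep; have [N hN] := half_pow_vanish ep; exists N => m /hN; apply: le_trans.
  by rewrite /q; apply: lerXn2r; rewrite ?nnegrE ?invr_ge0// lef_pV2 ?posrE// ler_nat.
have tail2 m k : nrm (V (m + k)%N - V m) <= 2 * q m.
  by apply: (le_trans (tail m k)); rewrite ler_wpM2l// gerBl ltW.
have [v hv] : exists v, forall e, 0 < e -> exists n0, forall n, (n0 <= n)%N -> nrm (V n - v) <= e.
  apply: bergman_complete => e ep; have [n0 hn] := qv _ (divr_gt0 ep (ltr0n R 2)).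
  exists n0 => k m.
  wlog km : k m / (k <= m)%N => [hw hn0 hm0|hn0 _].
    case/orP: (leq_total k m) => km; first exact: hw.
    by rewrite -opprB bnrmN; exact: hw.
  rewrite -opprB bnrmN -(subnKC km); apply: (le_trans (tail2 _ _)).
  by rewrite mulrC -ler_pdivlMr//; exact: hn.
have vV m : nrm (v - V m) <= 2 * q m.
  apply/ler_addgt0Pl => e ep; have [n0 hn] := hv e ep.
  rewrite -(subrK (V (m + n0)%N) v) -addrA; apply: (le_trans (bnrmD _ _)); apply: lerD => //.
  by rewrite -opprB bnrmN; apply: hn; exact: leq_addl.
have [u [d vE]] := hc v.
(* The final 2 absorbs the term [2 * r l] of the lower bound. *)
pose G := nrm u + \sum_i (`|complex.Re (d i)| + `|complex.Im (d i)|) + 2.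
have upper l : ip v (t l) <= (G - 2) * r l.
  have [Sr hcr] := hQ l.
  rewrite vE bipDl ip_sum_ord /G addrK mulrDl; apply: lerD.
    rewrite Ssym; apply: (le_trans (ler_norm _)); apply: (le_trans (bCS _ _)).
    by apply: ler_wpM2l => //; exact: nrm_ge0.
  rewrite mulr_suml; apply: ler_sum => i _; have [h1 h2] := hcr i.
  have -> : ip (d i *: c i) (t l) = complex.Re (d i) * ip (t l) (c i) + complex.Im (d i) * ip (t l) (ci i).
    rewrite (_ : d i *: c i = (complex.Re (d i))%:C *: c i + (complex.Im (d i))%:C *: ci i).
      by rewrite bipDl !bipZl ![ip _ (t l)]ipC.
    rewrite /ci scalerA -scalerDl; congr (_ *: _); case: (d i) => a a' /=.
    by apply/eqP; rewrite eq_complex /=; apply/andP; split; apply/eqP; ring.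
  rewrite mulrDl; apply: lerD; apply: (le_trans (ler_norm _)); rewrite normrM;
    by apply: ler_wpM2l.
(* The hump at l gives at least q l / 2, the earlier ones at most 2 r l by near orthogonality, and
   the later ones at most 2 q (l+1) = q l / 4. *)
have lower l : q l / 4%:R - 2 * r l <= ip v (t l).
  have -> : ip v (t l) = ip (V l) (t l) + q l * nsq (t l) + ip (v - V l.+1) (t l).
    rewrite bipBl VS bipDl bipZl ipE; ring.
  have h1 : `|ip (v - V l.+1) (t l)| <= q l / 4%:R.
    apply: (le_trans (bCS _ _)); apply: (@le_trans _ _ (2 * q l.+1 * 1)).
      by apply: ler_pM; rewrite ?nrm_ge0.
    by rewrite /q exprS; apply: le_of_eq; field.
  have h2 : `|ip (V l) (t l)| <= 2 * r l.
    rewrite VE (ip_suml l (fun i => (q i)%:C *: t i)); apply: (le_trans (ler_norm_sum _ _ _)).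
    apply: (@le_trans _ _ (\sum_(i < l) (2^-1 ^+ i.+1) * (2 * r l))).
      apply: ler_sum => i _; rewrite bipZl normrM gtr0_norm// ipC.
      rewrite (_ : 2^-1 ^+ i.+1 * (2 * r l) = 2^-1 ^+ i * r l); last by rewrite exprS; field.
      apply: ler_pM => //; [exact: ltW| |exact: hP].
      by rewrite /q; apply: lerXn2r; rewrite ?nnegrE ?invr_ge0// lef_pV2 ?posrE// ler_nat.
    by rewrite -mulr_suml ler_piMl ?sum_half_pow// mulr_ge0// ltW.
  have h3 : q l / 2 <= q l * nsq (t l) by apply: ler_wpM2l; [exact: ltW|exact: b2].
  move: h1 h2 h3; rewrite !ler_norml => /andP[h1 _] /andP[h2 _] h3.
  have := lerD (lerD h2 h3) h1; apply: le_trans.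
  by apply: le_of_eq; field.
have G0 : 0 < G.
  by rewrite ltr_wpDl// addr_ge0 ?nrm_ge0// sumr_ge0// => i _; rewrite addr_ge0.
have key l : 4%:R^-1 <= G * 2^-1 ^+ l.
  have := le_trans (lower l) (upper l); rewrite lerBlDr -mulrDl subrK.
  rewrite (_ : r l = q l * 2^-1 ^+ l).
    by rewrite mulrCA ler_pM2l.
  by rewrite /r /q -exprMn; congr (_ ^+ _); field.
have g8 : 0 < (8%:R * G)^-1 by rewrite invr_gt0 mulr_gt0.
have [N hN] := half_pow_vanish g8.
have := le_trans (key N) (ler_wpM2l (ltW G0) (hN N (leqnn N))).
rewrite invfM mulrCA divff ?gt_eqF// mulr1 lef_pV2 ?posrE// ler_nat.
by [].
Qed.

End NotFredholm.

(** * Approximate eigenvectors and the choice of parameters *)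

Section Assembly.
Context {R : realType}.
Local Notation C := (Cplx R).
Implicit Types (f g : bergman R) (e : R).

Lemma set_dist_empty (A B : set C) (d : R) : A = set0 \/ B = set0 -> (d%:E <= set_dist A B)%E.
Proof.
move=> AB; apply: le_ereal_inf_tmp => y [s As [t Bt _]].
by case: AB => E; [rewrite E in As|rewrite E in Bt].
Qed.

Lemma ballE (c l : C) e : ball c e%:C l = (cmodulus (c - l) < e) :> Prop.
Proof. by rewrite -ball_normE /= cmodulus_ltE. Qed.

Lemma shifted_operator (a : C -> C) (M : R) (x0 l : C) : bounded_symbol a M ->
  (fun v => toeplitz (fun z => x0 + a z) v - l *: v) = (fun v => toeplitz a v - (l - x0) *: v).
Proof.
move=> ba; apply/funext => v.
rewrite (toeplitz_symD _ (bounded_symbol_cst x0) ba) toeplitz_cst scalerBl opprB.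
by rewrite [_ + toeplitz a v]addrC addrA.
Qed.

Lemma bounded_symbol_shift (a : C -> C) (M : R) (x0 : C) : bounded_symbol a M ->
  bounded_symbol (fun z => x0 + a z) (cmodulus x0 + M).
Proof.
move=> [ma ba]; split; first exact: (measurable_discD (bounded_symbol_cst x0).1 ma).
by move=> z Dz; apply: (le_trans (cmodulusD _ _)); rewrite lerD2l; exact: ba.
Qed.

Lemma Linfty_bounded_symbol (a : C -> C) (M : R) : bounded_symbol a M -> Linfty_disc a.
Proof. by move=> [ma ba]; split => //; exists M; apply: aeW => p Dp; exact: ba. Qed.

Lemma toeplitz_symmetric (a : C -> C) (M : R) (r : R) f g : bounded_symbol a M ->
  (forall z, a z \is Num.real) ->
  ip (toeplitz a f - r%:C *: f) g = ip f (toeplitz a g - r%:C *: g).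
Proof.
move=> ba ra; have E : (fun z => (a z)^*) = a.
  by apply/funext => z; have /complex_realP[k ->] := ra z; exact: conjc_real.
have adj := toeplitz_adj f g ba; rewrite E in adj.
by rewrite bipBl bipBr adj bipZl bipZr.
Qed.

Section RealSymbol.
Context (eta : R) (e0 : 0 < eta) (e8 : eta <= 8%:R^-1).
Context (site : nat -> nat) (ee : nat -> bergman R).
Context (inc : forall i j, (i < j)%N -> (site i < site j)%N).
Context (dec : decoupled eta site ee eta) (maxi : forall j, maximizing eta (site j) (ee j)).
Context (wee : weakly_null ee).
Local Notation T al := (toeplitz (sym eta site al)).

(** [T c (ee j)] differs from [c j *: ee j] by the action of the other squares, small by decoupling,
    and by the eigenvalue defect of the maximiser. *)
Lemma quasimode (c : nat -> C) (M : R) : (forall j, cmodulus (c j) <= M) ->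
  vanishing (fun j => nrm (T c (ee j) - c j *: ee j)).
Proof.
move=> cM e ep; have M0 : 0 <= M := le_trans (cmodulus_ge0 _) (cM 0%N).
pose A := M * Num.sqrt mass_cst * Num.sqrt eta + 1.
have A0 : 0 < A by rewrite ltr_wpDl// !mulr_ge0 ?sqrtr_ge0.
have e2 : 0 < (e / 2 / A) ^+ 2 by rewrite exprn_gt0// divr_gt0// divr_gt0.
have B0 : 0 < e / 2 / (M + 1) by rewrite !divr_gt0// ltr_wpDl.
have [N1 h1] := half_pow_vanish e2; have [N2 h2] := half_pow_vanish B0.
exists (maxn N1 N2) => j; rewrite geq_max => /andP[N1j N2j].
have sb := site_symbol_bounded (site j) e0 e8.
have -> : T c (ee j) - c j *: ee j = (T c (ee j) - toeplitz (site_symbol eta (site j)) (c j *: ee j)) +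
    c j *: (toeplitz (site_symbol eta (site j)) (ee j) - ee j).
  by rewrite (toeplitzZ _ _ sb) scalerBr addrA subrK.
apply: (le_trans (bnrmD _ _)); rewrite (splitr e); apply: lerD.
  apply: (le_trans (offsite_image e0 e8 inc e0 cM (fun k jk => dec jk))).
  rewrite (sqrtrM _ (ltW e0)) mulrA; apply: (@le_trans _ _ (A * (e / 2 / A))); last first.
    by rewrite mulrC divfK// gt_eqF.
  apply: ler_pM; rewrite ?sqrtr_ge0 ?mulr_ge0 ?sqrtr_ge0//; first by rewrite /A lerDl.
  rewrite -[leRHS]ger0_norm; last by rewrite ltW// divr_gt0// divr_gt0.
  by rewrite -sqrtr_sqr; apply: ler_wsqrtr; apply: h1; exact: leqW.
rewrite bnrmZ; have [_ _ h] := maxi j.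
apply: (@le_trans _ _ ((M + 1) * (e / 2 / (M + 1)))); last first.
  by rewrite mulrC divfK// gt_eqF// ltr_wpDl.
apply: ler_pM; rewrite ?nrm_ge0 ?cmodulus_ge0//; first by apply: (le_trans (cM j)); rewrite lerDl.
apply: (le_trans h); apply: h2; apply: leq_trans N2j _; exact: increasing_ge.
Qed.

(** Along [q] the vectors [ee] are approximate null vectors of the shifted operator, which is
    symmetric because its symbol is real; [infinite_cokernel] then applies. *)
Lemma essential_value (c : nat -> C) (M : R) (x0 r : R) (q : nat -> nat) :
  (forall j, cmodulus (c j) <= M) -> (forall j, c j \is Num.real) ->
  (forall i j, (i < j)%N -> (q i < q j)%N) -> (forall l, c (q l) = (r - x0)%:C) ->
  essential_spectrum (toeplitz (fun z => x0%:C + sym eta site c z)) r%:C.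
Proof.
move=> cM cr qinc cq [_ _ _]; have sb := sym_bounded e0 e8 inc cM.
have rb : (r%:C - x0%:C : C) = (r - x0)%:C by rewrite rmorphB.
rewrite (shifted_operator _ _ sb) rb; apply: (@infinite_cokernel R _ (ee \o q)).
- move=> f g; apply: (toeplitz_symmetric _ _ _ sb) => z.
  apply: (@mult_case R (fun w => w \is Num.real)) => //; first exact: site_disjoint.
  by move=> j; apply: rpredM; rewrite ?complex_real.
- exact: weakly_null_subsequence.
- by move=> l; have [] := maxi (q l).
- by move=> l; have [] := maxi (q l).
- move=> e ep; have [N hN] := quasimode cM ep; exists N => l Nl; rewrite /= -(cq l).
  by apply: hN; exact: leq_trans Nl (increasing_ge qinc l).
Qed.

End RealSymbol.
End Assembly.

Theorem theorem5p1 (R : realType) (K : nat) (x : 'I_K -> R)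
    (x_decr : forall i j : 'I_K, (i < j)%N -> x j < x i) :
  exists2 delta : R, 0 < delta &
    \forall eps \near (0 : R)^'+,
      let U : set (Cplx R) :=
        \bigcup_(n in [set: 'I_K]) ball ((x n)%:C : Cplx R) eps%:C in
      exists a : Cplx R -> Cplx R,
        let S : set (Cplx R) := essential_spectrum (toeplitz a) in
        [/\ Linfty_disc a,
            (forall z, unit_disc z -> a z \is Num.real),
            bounded_operator (toeplitz a),
            (forall n : 'I_K, S `&` ball ((x n)%:C : Cplx R) eps%:C !=set0) &
            (delta%:E <= set_dist (S `&` U) (S `\` U))%E].
Proof.
(* The essential spectrum will lie inside [U], so the distance is +oo, and 1 serves as [delta]. *)
exists 1 => //; near=> eps; have eps0 : 0 < eps by near: eps; exact: nbhs_right_gt.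
case: K x {x_decr} => [|k] x /=.
  (* With no points [U] is empty, and the zero symbol will do. *)
  exists (fun=> 0); split => //.
  - exact: Linfty_bounded_symbol (bounded_symbol_cst 0).
  - exact: toeplitz_bounded (bounded_symbol_cst 0).
  - by case.
  - by apply: set_dist_empty; left; rewrite bigcup0 ?setI0// => -[].
(* Cyclic indexing makes every x_n the value of infinitely many sites. *)
pose id j : 'I_k.+1 := Ordinal (ltn_pmod j (ltn0Sn k)).
pose c j : Cplx R := (x (id j) - x ord0)%:C.
pose M : R := \sum_i `|x i - x ord0|.
have M0 : 0 <= M by exact: sumr_ge0.
have cM j : cmodulus (c j) <= M.
  by rewrite /c cmodulusR /M (bigD1 (id j))//= lerDl sumr_ge0.
have [K1 K10 hK] := @sites_exist R.
pose P := (M * (M / eps ^+ 2)) ^+ 2; have P0 : 0 <= P by exact: sqr_ge0.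
(* For [eta = Z^-1] the three summands ensure in turn [eta <= 1/8], [K1 * eta <= 1], and a squared
   parametrix error of at most 1/4. *)
pose Z := 8%:R + K1 + 4%:R * (P * K1).
have PK : 0 <= P * K1 by exact: mulr_ge0.
have Z8 : 8%:R <= Z by rewrite /Z; lra.
have Z0 : 0 < Z by apply: lt_le_trans Z8.
pose eta := Z^-1; have e0 : 0 < eta by rewrite invr_gt0.
have e8 : eta <= 8%:R^-1 by rewrite lef_pV2// posrE.
have Ke : K1 * eta <= 1 by rewrite ler_pdivrMr// mul1r /Z; lra.
have Pe : P * (K1 * eta) <= 2^-1 ^+ 2.
  by rewrite mulrA ler_pdivrMr// /Z; lra.
have [site [ee [inc dec maxi wee mul]]] := hK eta e0 e8 Ke.
have sb := sym_bounded e0 e8 inc cM.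
exists (fun z => (x ord0)%:C + sym eta site c z).
have bs := bounded_symbol_shift (x ord0)%:C sb.
set S := essential_spectrum _; set U := \bigcup_n _.
(* If l is at distance at least eps from every x_n, then mu = l - x_1 is at distance at least eps
   from 0 and from every c_j, so [resolvent] applies. *)
have SU : S `<=` U.
  move=> l Sl; apply: contrapT => nU; apply: Sl.
  rewrite (shifted_operator _ _ sb).
  have far n : eps <= cmodulus ((x n)%:C - l).
    by rewrite leNgt; apply/negP => h; apply: nU; exists n => //; rewrite ballE.
  apply: (resolvent e0 e8 inc mul eps0 cM) Pe => //.
    by rewrite cmodulusB; exact: far.
  move=> j; rewrite /c (_ : _ - (l - _) = (x (id j))%:C - l); first exact: far.
  by rewrite rmorphB opprB addrA subrK.
split.
- exact: Linfty_bounded_symbol bs.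
- move=> z _; apply: rpredD; first by rewrite complex_real.
  apply: (@mult_case R (fun w => w \is Num.real)) => //; first exact: site_disjoint.
  by move=> j; apply: rpredM; rewrite ?complex_real.
- exact: toeplitz_bounded bs.
- move=> n; exists (x n)%:C; split; last by apply: ballxx; rewrite ltcR.
  (* The indices congruent to n modulo k+1 are sites with c_j = x_n - x_1. *)
  apply: (@essential_value R eta e0 e8 site ee inc dec maxi wee c M (x ord0) (x n) (fun l => n + k.+1 * l)%N) => //.
  + by move=> j; rewrite complex_real.
  + by move=> i j ij; rewrite ltn_add2l ltn_pmul2l.
  + move=> l; rewrite /c; congr ((x _ - _)%:C); apply/val_inj => /=.
    by rewrite addnC mulnC modnMDl modn_small.
- by apply: set_dist_empty; right; apply/seteqP; split => // l [/SU].
Unshelve. all: by end_near.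
Qed.
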